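(* Let $\mathbf A,\mathbf B\in\mathbb{C}\setminus\{0\}$, and let $a,b,c,\delta,d\in\mathbb{C}$ with $a\delta-bc=1$. Put $\mathbb{T}=\frac{a\tau+b}{c\tau+\delta}$ (on a domain of $\tau$ where $c\tau+\delta\ne0$ and $\Im\mathbb T>0$, with a branch of $\sqrt{c\tau+\delta}$). Then $$\vartheta_2=d\frac{\vartheta_2(\mathbb T)}{\sqrt{c\tau+\delta}},\quad \vartheta_3=\frac1{\mathbf A}\frac{\vartheta_3(\mathbb T)}{\sqrt{c\tau+\delta}},\quad \vartheta_4=\frac1{\mathbf B}\frac{\vartheta_4(\mathbb T)}{\sqrt{c\tau+\delta}},$$ $$\eta=\frac1{(c\tau+\delta)^2}\Big\{\eta(\mathbb T)+\frac{\pi^2}{12}\big[(1-\mathbf A^{-4})\vartheta_3^4(\mathbb T)+(1-\mathbf B^{-4})\vartheta_4^4(\mathbb T)\big]\Big\}+\frac12\frac{\pi ic}{c\tau+\delta}$$ is the general solution of the system $$\frac{d\vartheta_2}{d\tau}=\frac i\pi\Big\{\eta+\frac{\pi^2}{12}(\vartheta_3^4+\vartheta_4^4)\Big\}\vartheta_2,\quad \frac{d\vartheta_3}{d\tau}=\frac i\pi\Big\{\eta+\frac{\pi^2}{12}(\vartheta_3^4+\vartheta_4^4-3\mathbf B^4\vartheta_4^4)\Big\}\vartheta_3,$$ $$\frac{d\vartheta_4}{d\tau}=\frac i\pi\Big\{\eta+\frac{\pi^2}{12}(\vartheta_3^4+\vartheta_4^4-3\mathbf A^4\vartheta_3^4)\Big\}\vartheta_4,\quad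 \frac{d\eta}{d\tau}=\frac i\pi2\eta^2-\frac{\pi^3}{72}i\big\{\vartheta_3^8+(9\mathbf A^4\mathbf B^4-6\mathbf A^4-6\mathbf B^4+2)\vartheta_3^4\vartheta_4^4+\vartheta_4^8\big\}.$$
   Context: On the right-hand sides $\vartheta_k(\mathbb T)$ and $\eta(\mathbb T)$ denote the canonical series: $\vartheta_2(t)=\sum_{k\in\mathbb Z}e^{(k+1/2)^2\pi it}$, $\vartheta_3(t)=\sum_{k\in\mathbb Z}e^{k^2\pi it}$, $\vartheta_4(t)=\sum_{k\in\mathbb Z}(-1)^ke^{k^2\pi it}$, $\eta(t)=2\pi^2\{\frac1{24}-\sum_{k\ge1}\frac{e^{2k\pi it}}{(1-e^{2k\pi it})^2}\}$, for $\Im t>0$.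
   Formalization: ''General solution'' is taken as: every member solves the system, and every solution agrees near any point where ϑ3ϑ4≠0 and A⁴ϑ3⁴≠B⁴ϑ4⁴ with a member of the family; solutions violating this (e.g. all functions zero) are not in the family. *)

(* Defs.v *)
From Stdlib Require Import Reals ZArith.
From Coquelicot Require Import Coquelicot.
Open Scope C_scope.

Definition cexp (z : C) : C :=
  (exp (Re z) * cos (Im z), exp (Re z) * sin (Im z))%R.

Definition csum (a : nat -> C) : C :=
  (Series (fun n => Re (a n)), Series (fun n => Im (a n))).

Definition zsum (f : Z -> C) : C :=
  csum (fun n => f (Z.of_nat n)) + csum (fun n => f (- Z.of_nat (S n))%Z).

Definition zsign (k : Z) : C := if Z.even k then 1 else -1.

Definition theta2 (t : C) : C :=
  zsum (fun k => cexp (((IZR k + /2)%R ^ 2) * PI * Ci * t)).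
Definition theta3 (t : C) : C :=
  zsum (fun k => cexp ((IZR k ^ 2) * PI * Ci * t)).
Definition theta4 (t : C) : C :=
  zsum (fun k => zsign k * cexp ((IZR k ^ 2) * PI * Ci * t)).
Definition eta (t : C) : C :=
  2 * PI ^ 2 * (/ 24 - csum (fun n =>
     let qk := cexp (2 * INR (S n) * PI * Ci * t) in qk / ((1 - qk) ^ 2))).

Definition cderiv (f : C -> C) (z l : C) : Prop :=
  @is_derive C_AbsRing C_NormedModule f z l.

Definition halphen_system (A B : C) (U : C -> Prop)
    (th2 th3 th4 et : C -> C) : Prop :=
  forall z, U z ->
    cderiv th2 z (Ci / PI * (et z + PI ^ 2 / 12 * (th3 z ^ 4 + th4 z ^ 4)) * th2 z) /\
    cderiv th3 z (Ci / PI * (et z + PI ^ 2 / 12 *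
                   (th3 z ^ 4 + th4 z ^ 4 - 3 * B ^ 4 * th4 z ^ 4)) * th3 z) /\
    cderiv th4 z (Ci / PI * (et z + PI ^ 2 / 12 *
                   (th3 z ^ 4 + th4 z ^ 4 - 3 * A ^ 4 * th3 z ^ 4)) * th4 z) /\
    cderiv et z (Ci / PI * 2 * et z ^ 2 - PI ^ 3 / 72 * Ci *
                  (th3 z ^ 8 + (9 * A ^ 4 * B ^ 4 - 6 * A ^ 4 - 6 * B ^ 4 + 2)
                               * th3 z ^ 4 * th4 z ^ 4 + th4 z ^ 8)).

Definition mob (a b c dl : C) (t : C) : C := (a * t + b) / (c * t + dl).

(* the claimed solution family; s is the chosen branch of sqrt(c tau + dl) *)
Definition sol2 (a b c dl d : C) (s : C -> C) (t : C) : C :=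
  d * theta2 (mob a b c dl t) / s t.
Definition sol3 (A : C) (a b c dl : C) (s : C -> C) (t : C) : C :=
  / A * theta3 (mob a b c dl t) / s t.
Definition sol4 (B : C) (a b c dl : C) (s : C -> C) (t : C) : C :=
  / B * theta4 (mob a b c dl t) / s t.
Definition soleta (A B : C) (a b c dl : C) (t : C) : C :=
  let T := mob a b c dl t in
  / ((c * t + dl) ^ 2) *
    (eta T + PI ^ 2 / 12 * ((1 - / A ^ 4) * theta3 T ^ 4
                            + (1 - / B ^ 4) * theta4 T ^ 4))
  + / 2 * (PI * Ci * c / (c * t + dl)).

Definition admissible (a b c dl : C) (s : C -> C) (V : C -> Prop) : Prop :=
  forall t, V t ->
    c * t + dl <> 0 /\ (0 < Im (mob a b c dl t))%R /\
    s t * s t = c * t + dl /\ continuous s t.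

(* Main.v *)
Require Import Defs.
From Stdlib Require Import Reals ZArith Lra Lia Psatz.
From Coquelicot Require Import Coquelicot.
Open Scope C_scope.

(** Everything is expressed through [phi x = sum_{n in Z} x^(n^2)] on the unit disc: with
    [q = exp (i pi t)] one has [theta3 t = phi q], [theta4 t = phi (-q)], and
    [theta2 t = (phi y - phi (-y)) / 2] for [y = exp (i pi t / 4)].

    A finite identity of Shanks gives Gauss's product
    [phi (-x) = prod (1 - x^k) / (1 + x^k)], whence [phi x * phi (-x) = phi (-x^2)^2];
    together with [phi x + phi (-x) = 2 phi (x^4)] this yields
    [phi x^2 + phi (-x)^2 = 2 phi (x^2)^2].  Each differential identity is then obtained by
    comparing both sides at [x] and [x^2]: the defect [f] satisfies [|f x| <= 4 |f (x^2)|] and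
    is O(x) at 0, so it vanishes.  The Lambert series in [eta] enters through the logarithmic
    derivative of Gauss's product.  The Moebius action and the scalings by [A] and [B] reduce
    the general system to the one satisfied by the canonical series.

    For generality, the duplication formulas are the arithmetic-geometric mean: iterating it with
    the right choice of roots drives any value of [theta4 / theta3] with fourth power different
    from 0 and 1 into the range reached near [q = 0], so all these values are attained, and the
    initial data of any generic solution are those of a member of the family.  Uniqueness for the
    polynomial system concludes. *)

(** Neither the modular transformation laws of theta functions nor contour integration is used; the
    map x -> x^2 takes their place. A quantity that squaring changes by a bounded factor is governed
    by its behaviour at 0, because |x|^(2^n) outruns every c^n. Vanishing ([squaring_zero]) and
    non-vanishing ([squaring_descent]) are both obtained in this way.

    The family has as many degrees of freedom as the system has unknowns: the quotient of th4 and
    th3 fixes T, their size fixes the root s, eta fixes c, and th2, which enters its own equation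
    linearly and no other equation, fixes d. The only nonlinear condition is theta4 T / theta3 T = w
    with w = B th4 / (A th3). The values w = 0 and w^4 = 1 are out of reach, since theta4 has no
    zero and theta3^4 - theta4^4, which is theta2^4 by Jacobi, has none either; this is the origin
    of the genericity conditions on the initial values. *)

Lemma RtoC_neq (x y : R) : x <> y -> RtoC x <> RtoC y.
Proof. intros H E. apply H, RtoC_inj, E. Qed.

Lemma IZR_C_neq0 (n : Z) : n <> 0%Z -> RtoC (IZR n) <> 0.
Proof. intros H. apply RtoC_neq. now apply not_0_IZR. Qed.

Lemma PI_C_neq0 : RtoC PI <> 0.
Proof. apply RtoC_neq, PI_neq0. Qed.

Lemma Ci2 : Ci * Ci = -1.
Proof. unfold Ci, Cmult, RtoC; simpl. f_equal; ring. Qed.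

Lemma Cmod_minus_sym (x y : C) : Cmod (x - y) = Cmod (y - x).
Proof. rewrite <- Cmod_opp. f_equal. ring. Qed.

Lemma Cmod_triangle_minus (x y : C) : (Cmod (x - y) <= Cmod x + Cmod y)%R.
Proof. unfold Cminus. rewrite <- (Cmod_opp y). apply Cmod_triangle. Qed.

Lemma Cmod_triangle_inv (x y : C) : (Cmod x - Cmod y <= Cmod (x + y))%R.
Proof.
  assert (H := Cmod_triangle (x + y) (- y)).
  replace (x + y + - y) with x in H by ring. rewrite Cmod_opp in H. lra.
Qed.

Lemma Re_le_Cmod (z : C) : (Re z <= Cmod z)%R.
Proof. apply Rle_trans with (2 := re_le_Cmod z). apply Rle_abs. Qed.

Lemma Im_abs_le_Cmod (z : C) : (Rabs (Im z) <= Cmod z)%R.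
Proof. apply Rle_trans with (2 := Rmax_Cmod z). apply Rmax_r. Qed.

Lemma Cmod_le_Re_Im (z : C) : (Cmod z <= Rabs (Re z) + Rabs (Im z))%R.
Proof.
  replace z with (RtoC (Re z) + Ci * RtoC (Im z)) at 1.
  2: { destruct z as [a b]. unfold Ci, RtoC, Cplus, Cmult; simpl. f_equal; ring. }
  eapply Rle_trans; [apply Cmod_triangle|].
  rewrite Cmod_mult, Cmod_Ci, !Cmod_R. lra.
Qed.

Lemma Re_minus (x y : C) : Re (x - y) = (Re x - Re y)%R.
Proof. reflexivity. Qed.

Lemma Re_scal_R (r : R) (x : C) : Re (r * x) = (r * Re x)%R.
Proof. unfold Re, Cmult, RtoC; simpl; ring. Qed.

Lemma C_eq_Re_Im (x y : C) : Re x = Re y -> Im x = Im y -> x = y.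
Proof. destruct x, y; simpl; intros; subst; reflexivity. Qed.

(** * Epsilon-delta calculus for complex derivatives *)

Lemma cderiv_iff (f : C -> C) (z l : C) :
  cderiv f z l <->
  forall eps : R, (0 < eps)%R -> exists d : R, (0 < d)%R /\
    forall y, (Cmod (y - z) < d)%R ->
      (Cmod (f y - f z - (y - z) * l) <= eps * Cmod (y - z))%R.
Proof.
  split.
  - intros [_ H] eps He.
    specialize (H z (fun P HP => HP) (mkposreal eps He)).
    destruct H as [d Hd].
    exists d. split; [apply cond_pos|].
    intros y Hy. specialize (Hd y Hy).
    change (Cmod (f y - f z - (y - z) * l) <= eps * Cmod (y - z))%R. exact Hd.
  - intros H. split.
    + apply @is_linear_scal_l.
    (* The library asks for the estimate at every limit [x] of the filter of neighbourhoods of z;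
       separation leaves only z. *)
    + intros x Hx.
      assert (Ex := @is_filter_lim_locally_unique C_AbsRing (AbsRing_NormedModule C_AbsRing) z x Hx).
      subst x. intros eps.
      destruct (H eps (cond_pos eps)) as [d [Hd0 Hd]].
      exists (mkposreal d Hd0). intros y Hy. exact (Hd y Hy).
Qed.

Lemma open_C_iff (U : C -> Prop) :
  open U <-> forall z, U z -> exists d : R, (0 < d)%R /\ forall y, (Cmod (y - z) < d)%R -> U y.
Proof.
  split.
  - intros HU z Hz. destruct (proj1 (locally_C z U) (HU z Hz)) as [d Hd].
    exists d. split; [apply cond_pos|]. exact Hd.
  - intros H z Hz. apply locally_C. destruct (H z Hz) as [d [Hd0 Hd]].
    exists (mkposreal d Hd0). exact Hd.
Qed.

Definition ccont (f : C -> C) (z : C) : Prop :=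
  forall eps : R, (0 < eps)%R -> exists d : R, (0 < d)%R /\
    forall y, (Cmod (y - z) < d)%R -> (Cmod (f y - f z) < eps)%R.

Lemma continuous_C_iff (f : C -> C) (z : C) : continuous f z <-> ccont f z.
Proof.
  split.
  - intros H eps He.
    assert (L : locally (T := C_UniformSpace) (f z) (fun y => Cmod (y - f z) < eps)%R).
    { apply locally_C. exists (mkposreal eps He). intros y Hy. exact Hy. }
    destruct (proj1 (locally_C z _) (H _ L)) as [d Hd].
    exists d. split; [apply cond_pos|]. exact Hd.
  - intros H P HP. apply locally_C in HP. destruct HP as [e He].
    destruct (H e (cond_pos e)) as [d [Hd0 Hd]].
    apply (proj2 (locally_C z (fun x => P (f x)))).
    exists (mkposreal d Hd0). intros y Hy. apply He. exact (Hd y Hy).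
Qed.

Lemma cderiv_ccont (f : C -> C) (z l : C) : cderiv f z l -> ccont f z.
Proof.
  rewrite cderiv_iff. intros H eps He.
  destruct (H 1%R Rlt_0_1) as [d [Hd0 Hd]].
  assert (K := Cmod_ge_0 l).
  exists (Rmin d (eps / (2 + Cmod l))). split.
  { apply Rmin_glb_lt; auto. apply Rdiv_lt_0_compat; lra. }
  intros y Hy.
  assert (Hy1 := Rlt_le_trans _ _ _ Hy (Rmin_l _ _)).
  assert (Hy2 := Rlt_le_trans _ _ _ Hy (Rmin_r _ _)).
  specialize (Hd y Hy1).
  replace (f y - f z) with ((f y - f z - (y - z) * l) + (y - z) * l) by ring.
  eapply Rle_lt_trans; [apply Cmod_triangle|]. rewrite Cmod_mult.
  apply Rle_lt_trans with (Cmod (y - z) * (1 + Cmod l))%R; [lra|].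
  assert (Hz := Cmod_ge_0 (y - z)).
  apply Rle_lt_trans with (Cmod (y - z) * (2 + Cmod l))%R; [nra|].
  apply (Rmult_lt_compat_r (2 + Cmod l)) in Hy2; [|lra].
  unfold Rdiv in Hy2. rewrite Rmult_assoc, Rinv_l in Hy2; lra.
Qed.

Lemma cderiv_ext_loc (f g : C -> C) (z l : C) (r : R) : (0 < r)%R ->
  (forall y, (Cmod (y - z) < r)%R -> f y = g y) -> cderiv f z l -> cderiv g z l.
Proof.
  intros Hr E. rewrite !cderiv_iff. intros H eps He.
  destruct (H eps He) as [d [Hd0 Hd]].
  exists (Rmin d r). split; [apply Rmin_glb_lt; auto|].
  intros y Hy.
  rewrite <- (E y), <- (E z).
  - apply Hd. apply Rlt_le_trans with (1 := Hy), Rmin_l.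
  - replace (z - z) with (RtoC 0) by ring. now rewrite Cmod_0.
  - apply Rlt_le_trans with (1 := Hy), Rmin_r.
Qed.

Lemma cderiv_ext (f g : C -> C) (z l : C) :
  (forall y, f y = g y) -> cderiv f z l -> cderiv g z l.
Proof. intros E. apply (cderiv_ext_loc f g z l 1); [lra|auto]. Qed.

Lemma cderiv_const (c z : C) : cderiv (fun _ => c) z 0.
Proof.
  apply cderiv_iff. intros eps He. exists 1%R. split; [lra|]. intros y _.
  replace (c - c - (y - z) * 0) with (RtoC 0) by ring. rewrite Cmod_0.
  apply Rmult_le_pos; [lra|apply Cmod_ge_0].
Qed.

Lemma cderiv_id (z : C) : cderiv (fun x => x) z 1.
Proof.
  apply cderiv_iff. intros eps He. exists 1%R. split; [lra|]. intros y _.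
  replace (y - z - (y - z) * 1) with (RtoC 0) by ring. rewrite Cmod_0.
  apply Rmult_le_pos; [lra|apply Cmod_ge_0].
Qed.

Lemma cderiv_plus (f g : C -> C) (z l m : C) :
  cderiv f z l -> cderiv g z m -> cderiv (fun x => f x + g x) z (l + m).
Proof.
  rewrite !cderiv_iff. intros Hf Hg eps He.
  destruct (Hf (eps / 2)%R) as [d1 [P1 H1]]; [lra|].
  destruct (Hg (eps / 2)%R) as [d2 [P2 H2]]; [lra|].
  exists (Rmin d1 d2). split; [apply Rmin_glb_lt; auto|]. intros y Hy.
  specialize (H1 y (Rlt_le_trans _ _ _ Hy (Rmin_l _ _))).
  specialize (H2 y (Rlt_le_trans _ _ _ Hy (Rmin_r _ _))).
  replace (f y + g y - (f z + g z) - (y - z) * (l + m)) with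
    ((f y - f z - (y - z) * l) + (g y - g z - (y - z) * m)) by ring.
  eapply Rle_trans; [apply Cmod_triangle|]. lra.
Qed.

Lemma ccont_bounded (f : C -> C) (z : C) : ccont f z ->
  exists d : R, (0 < d)%R /\ forall y, (Cmod (y - z) < d)%R -> (Cmod (f y) <= Cmod (f z) + 1)%R.
Proof.
  intros H. destruct (H 1%R Rlt_0_1) as [d [Hd0 Hd]]. exists d. split; auto.
  intros y Hy. specialize (Hd y Hy).
  replace (f y) with (f z + (f y - f z)) by ring.
  eapply Rle_trans; [apply Cmod_triangle|]. lra.
Qed.

Lemma cderiv_mult (f g : C -> C) (z l m : C) :
  cderiv f z l -> cderiv g z m -> cderiv (fun x => f x * g x) z (l * g z + f z * m).
Proof.
  intros Hf Hg.
  destruct (ccont_bounded g z (cderiv_ccont _ _ _ Hg)) as [d0 [P0 H0]].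
  assert (Cg := cderiv_ccont _ _ _ Hg).
  rewrite cderiv_iff in Hf, Hg |- *. intros eps He.
  assert (N1 := Cmod_ge_0 (f z)). assert (N2 := Cmod_ge_0 (g z)). assert (N3 := Cmod_ge_0 l).
  set (M := (Cmod (f z) + Cmod (g z) + Cmod l + 2)%R).
  assert (HM : (2 <= M)%R) by (unfold M; lra).
  assert (He3 : (0 < eps / (3 * M))%R) by (apply Rdiv_lt_0_compat; lra).
  assert (HMM : (eps / (3 * M) * M = eps / 3)%R) by (field; lra).
  destruct (Hf _ He3) as [d1 [P1 H1]].
  destruct (Hg _ He3) as [d2 [P2 H2]].
  destruct (Cg _ He3) as [d3 [P3 H3]].
  exists (Rmin (Rmin d0 d1) (Rmin d2 d3)). split; [repeat apply Rmin_glb_lt; auto|].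
  intros y Hy.
  assert (Ya := Rlt_le_trans _ _ _ Hy (Rmin_l _ _)). assert (Yb := Rlt_le_trans _ _ _ Hy (Rmin_r _ _)).
  specialize (H0 y (Rlt_le_trans _ _ _ Ya (Rmin_l _ _))).
  specialize (H1 y (Rlt_le_trans _ _ _ Ya (Rmin_r _ _))).
  specialize (H2 y (Rlt_le_trans _ _ _ Yb (Rmin_l _ _))).
  specialize (H3 y (Rlt_le_trans _ _ _ Yb (Rmin_r _ _))).
  replace (f y * g y - f z * g z - (y - z) * (l * g z + f z * m)) with
    ((f y - f z - (y - z) * l) * g y + (f z * (g y - g z - (y - z) * m) + (y - z) * l * (g y - g z))) by ring.
  eapply Rle_trans; [apply Cmod_triangle|].
  eapply Rle_trans; [apply Rplus_le_compat_l, Cmod_triangle|].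
  rewrite !Cmod_mult.
  set (e := (eps / (3 * M))%R) in *. set (h := Cmod (y - z)) in *.
  assert (Hh : (0 <= h)%R) by apply Cmod_ge_0.
  assert (A1 : (Cmod (f y - f z - (y - z) * l) * Cmod (g y) <= e * h * M)%R).
  { apply Rmult_le_compat; auto using Cmod_ge_0. unfold M; lra. }
  assert (A2 : (Cmod (f z) * Cmod (g y - g z - (y - z) * m) <= M * (e * h))%R).
  { apply Rmult_le_compat; auto using Cmod_ge_0. unfold M; lra. }
  assert (A3 : (h * Cmod l * Cmod (g y - g z) <= h * M * e)%R).
  { apply Rmult_le_compat; auto using Cmod_ge_0; try lra.
    - apply Rmult_le_pos; auto.
    - apply Rmult_le_compat_l; auto. unfold M; lra. }
  replace (eps * h)%R with (3 * (eps / 3) * h)%R by field. rewrite <- HMM. lra.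
Qed.

Lemma cderiv_comp (f g : C -> C) (z l m : C) :
  cderiv f z l -> cderiv g (f z) m -> cderiv (fun x => g (f x)) z (l * m).
Proof.
  intros Hf Hg. assert (Cf := cderiv_ccont _ _ _ Hf).
  rewrite cderiv_iff in Hf, Hg |- *. intros eps He.
  assert (N1 := Cmod_ge_0 l). assert (N2 := Cmod_ge_0 m).
  set (M := (Cmod l + Cmod m + 2)%R).
  assert (HM : (2 <= M)%R) by (unfold M; lra).
  assert (He3 : (0 < eps / (2 * M))%R) by (apply Rdiv_lt_0_compat; lra).
  assert (HMM : (eps / (2 * M) * M = eps / 2)%R) by (field; lra).
  set (e := (eps / (2 * M))%R) in *.
  destruct (Hf 1%R Rlt_0_1) as [d0 [P0 H0]].
  destruct (Hf _ He3) as [d1 [P1 H1]].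
  destruct (Hg _ He3) as [d2 [P2 H2]].
  destruct (Cf _ P2) as [d3 [P3 H3]].
  exists (Rmin d0 (Rmin d1 d3)). split; [repeat apply Rmin_glb_lt; auto|].
  intros y Hy.
  assert (Yb := Rlt_le_trans _ _ _ Hy (Rmin_r _ _)).
  specialize (H0 y (Rlt_le_trans _ _ _ Hy (Rmin_l _ _))).
  specialize (H1 y (Rlt_le_trans _ _ _ Yb (Rmin_l _ _))).
  specialize (H3 y (Rlt_le_trans _ _ _ Yb (Rmin_r _ _))).
  specialize (H2 _ H3).
  set (h := Cmod (y - z)) in *.
  assert (Hh : (0 <= h)%R) by apply Cmod_ge_0.
  assert (B : (Cmod (f y - f z) <= h * M)%R).
  { replace (f y - f z) with ((f y - f z - (y - z) * l) + (y - z) * l) by ring.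
    eapply Rle_trans; [apply Cmod_triangle|]. rewrite Cmod_mult. fold h.
    apply Rle_trans with (h * (1 + Cmod l))%R; [lra|].
    apply Rmult_le_compat_l; auto. unfold M; lra. }
  replace (g (f y) - g (f z) - (y - z) * (l * m)) with
    ((g (f y) - g (f z) - (f y - f z) * m) + (f y - f z - (y - z) * l) * m) by ring.
  eapply Rle_trans; [apply Cmod_triangle|]. rewrite Cmod_mult.
  assert (A1 : (e * Cmod (f y - f z) <= e * (h * M))%R) by (apply Rmult_le_compat_l; lra).
  assert (A2 : (Cmod (f y - f z - (y - z) * l) * Cmod m <= e * h * M)%R).
  { apply Rmult_le_compat; auto using Cmod_ge_0. unfold M; lra. }
  replace (eps * h)%R with (2 * (eps / 2) * h)%R by field. rewrite <- HMM. lra.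
Qed.

Lemma cderiv_Cinv (z : C) : z <> 0 -> cderiv Cinv z (- / (z * z)).
Proof.
  intros Hz. apply cderiv_iff. intros eps He.
  assert (P := proj1 (Cmod_gt_0 z) Hz). set (r := Cmod z) in *.
  exists (Rmin (r / 2) (eps * r * r * r / 2)). split.
  { apply Rmin_glb_lt; [lra|]. assert (0 < eps * r)%R by nra. assert (0 < eps * r * r)%R by nra. nra. }
  intros y Hy.
  assert (Ya := Rlt_le_trans _ _ _ Hy (Rmin_l _ _)). assert (Yb := Rlt_le_trans _ _ _ Hy (Rmin_r _ _)).
  assert (Y : (r / 2 <= Cmod y)%R).
  { assert (T := Cmod_triangle_inv z (y - z)). replace (z + (y - z)) with y in T by ring. unfold r in *. lra. }
  assert (y <> 0) by (apply Cmod_gt_0; lra).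
  replace (/ y - / z - (y - z) * - / (z * z)) with ((y - z) * ((y - z) * / (y * (z * z)))).
  2: { field. split; auto. }
  rewrite (Cmod_mult (y - z)), Rmult_comm. apply Rmult_le_compat_r; [apply Cmod_ge_0|].
  rewrite Cmod_mult, Cmod_inv, !Cmod_mult by (repeat apply Cmult_neq_0; auto). fold r.
  assert (0 < Cmod y * (r * r))%R by (apply Rmult_lt_0_compat; nra).
  apply Rmult_le_reg_r with (Cmod y * (r * r))%R; auto.
  rewrite Rmult_assoc, Rinv_l, Rmult_1_r by lra.
  apply Rle_trans with (eps * r * r * r / 2)%R; [lra|].
  replace (eps * r * r * r / 2)%R with (eps * (r / 2 * (r * r)))%R by field.
  apply Rmult_le_compat_l; [lra|]. apply Rmult_le_compat_r; nra.
Qed.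

Lemma cderiv_eq (f : C -> C) (z l m : C) : l = m -> cderiv f z l -> cderiv f z m.
Proof. now intros ->. Qed.

Lemma cderiv_opp (f : C -> C) (z l : C) : cderiv f z l -> cderiv (fun x => - f x) z (- l).
Proof.
  intros H. eapply cderiv_ext; [|eapply cderiv_eq; [|apply (cderiv_mult _ _ _ _ _ (cderiv_const (-1) z) H)]].
  - intros y; simpl; ring.
  - simpl; ring.
Qed.

Lemma cderiv_minus (f g : C -> C) (z l m : C) :
  cderiv f z l -> cderiv g z m -> cderiv (fun x => f x - g x) z (l - m).
Proof. intros Hf Hg. apply cderiv_plus; auto. now apply cderiv_opp. Qed.

Lemma cderiv_inv (f : C -> C) (z l : C) : f z <> 0 ->
  cderiv f z l -> cderiv (fun x => / f x) z (- l / (f z * f z)).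
Proof.
  intros Hz H. eapply cderiv_eq; [|apply (cderiv_comp _ _ _ _ _ H (cderiv_Cinv _ Hz))].
  field; auto.
Qed.

Lemma cderiv_div (f g : C -> C) (z l m : C) : g z <> 0 ->
  cderiv f z l -> cderiv g z m -> cderiv (fun x => f x / g x) z ((l * g z - f z * m) / (g z * g z)).
Proof.
  intros Hz Hf Hg. eapply cderiv_eq; [|apply (cderiv_mult _ _ _ _ _ Hf (cderiv_inv _ _ _ Hz Hg))].
  field; auto.
Qed.

Lemma cderiv_pow (f : C -> C) (z l : C) (n : nat) :
  cderiv f z l -> cderiv (fun x => f x ^ n) z (INR n * l * f z ^ pred n).
Proof.
  intros H. induction n as [|n IH].
  - eapply cderiv_eq; [|apply (cderiv_const 1)]. simpl; ring.
  - eapply cderiv_eq; [|apply (cderiv_mult _ _ _ _ _ H IH)].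
    rewrite S_INR, RtoC_plus. destruct n; simpl; ring.
Qed.

Lemma cderiv_unique (f : C -> C) (z l m : C) : cderiv f z l -> cderiv f z m -> l = m.
Proof.
  intros H1 H2. apply is_C_derive_unique in H1. apply is_C_derive_unique in H2. congruence.
Qed.

(* Mean value inequality along a segment: project the increment on its own direction
   and apply the real mean value theorem. *)
Lemma cderiv_mean_value (f g : C -> C) (z w c : C) (K : R) :
  (forall t : R, (0 <= t <= 1)%R -> cderiv f (z + t * (w - z)) (g (z + t * (w - z)))) ->
  (forall t : R, (0 <= t <= 1)%R -> (Cmod (g (z + t * (w - z))%C - c) <= K)%R) ->
  (Cmod (f w - f z - (w - z) * c) <= K * Cmod (w - z))%R.
Proof.
  intros Hd Hb.
  set (v := f w - f z - (w - z) * c).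
  set (phi := fun t : R => Re (Cconj v * (f (z + t * (w - z)) - t * (w - z) * c))).
  set (dphi := fun t : R => Re (Cconj v * ((w - z) * (g (z + t * (w - z)) - c)))).
  assert (Dphi : forall t, (0 <= t <= 1)%R -> derivable_pt_lim phi t (dphi t)).
  { intros t Ht eps He.
    assert (Nv := Cmod_ge_0 v). assert (Nw := Cmod_ge_0 (w - z)).
    set (M := (Cmod v * Cmod (w - z) + 1)%R).
    assert (HM : (1 <= M)%R) by (unfold M; nra).
    assert (He' : (0 < eps / (2 * M))%R) by (apply Rdiv_lt_0_compat; lra).
    destruct (proj1 (cderiv_iff _ _ _) (Hd t Ht) _ He') as [d [Hd0 Hd1]].
    assert (Hdm : (0 < d / (Cmod (w - z) + 1))%R) by (apply Rdiv_lt_0_compat; lra).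
    exists (mkposreal _ Hdm). intros h Hh0 Hh. simpl in Hh.
    specialize (Hd1 (z + RtoC (t + h) * (w - z))).
    replace (z + RtoC (t + h) * (w - z) - (z + t * (w - z))) with (h * (w - z)) in Hd1
      by (rewrite RtoC_plus; ring).
    rewrite Cmod_mult, Cmod_R in Hd1.
    assert (Ph : (0 < Rabs h)%R) by now apply Rabs_pos_lt.
    assert (Hlt : (Rabs h * Cmod (w - z) < d)%R).
    { apply Rle_lt_trans with (Rabs h * (Cmod (w - z) + 1))%R; [nra|].
      apply (Rmult_lt_compat_r (Cmod (w - z) + 1)) in Hh; [|lra].
      unfold Rdiv in Hh. rewrite Rmult_assoc, Rinv_l in Hh; lra. }
    specialize (Hd1 Hlt).
    replace ((phi (t + h) - phi t) / h - dphi t)%R with ((phi (t + h) - phi t - h * dphi t) / h)%R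
      by (field; auto).
    replace (phi (t + h) - phi t - h * dphi t)%R with
      (Re (Cconj v * (f (z + RtoC (t + h) * (w - z)) - f (z + t * (w - z)) - h * (w - z) * g (z + t * (w - z))))).
    2: { unfold phi, dphi.
         set (p := z + t * (w - z)). set (p' := z + RtoC (t + h) * (w - z)).
         rewrite <- Re_scal_R, <- !Re_minus. f_equal. rewrite RtoC_plus. ring. }
    unfold Rdiv. rewrite Rabs_mult, Rabs_inv.
    apply Rmult_lt_reg_r with (Rabs h); auto.
    rewrite Rmult_assoc, Rinv_l, Rmult_1_r by lra.
    eapply Rle_lt_trans; [apply re_le_Cmod|].
    rewrite Cmod_mult, Cmod_conj.
    eapply Rle_lt_trans; [apply Rmult_le_compat_l; [exact Nv|exact Hd1]|].
    replace (Cmod v * (eps / (2 * M) * (Rabs h * Cmod (w - z))))%R with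
      (eps / (2 * M) * (Cmod v * Cmod (w - z)) * Rabs h)%R by ring.
    apply Rmult_lt_compat_r; auto.
    apply Rle_lt_trans with (eps / (2 * M) * M)%R.
    - apply Rmult_le_compat_l; [lra|]. unfold M; lra.
    - replace (eps / (2 * M) * M)%R with (eps / 2)%R by (field; lra). lra. }
  destruct (MVT_gen phi 0 1 dphi) as [t [Ht Et]].
  { rewrite Rmin_left, Rmax_right by lra. intros x Hx. apply is_derive_Reals, Dphi; lra. }
  { rewrite Rmin_left, Rmax_right by lra. intros x Hx.
    apply derivable_continuous_pt. exists (dphi x). apply Dphi; lra. }
  rewrite Rmin_left, Rmax_right in Ht by lra.
  assert (Evv : (phi 1 - phi 0)%R = (Cmod v * Cmod v)%R).
  { replace (Cmod v * Cmod v)%R with (Cmod v ^ 2)%R by ring.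
    apply RtoC_inj. rewrite Cmod2_conj. unfold phi.
    replace (z + 1 * (w - z)) with w by ring. replace (z + 0 * (w - z)) with z by ring.
    replace (f w - 1 * (w - z) * c) with (v + f z) by (unfold v; ring).
    replace (f z - 0 * (w - z) * c) with (f z) by ring.
    destruct v as [v1 v2], (f z) as [u1 u2].
    unfold Cconj, Cmult, Cplus, RtoC, Re; simpl. f_equal; ring. }
  rewrite Evv in Et.
  assert (Nv := Cmod_ge_0 v). assert (Nw := Cmod_ge_0 (w - z)).
  assert (B : (Cmod v * Cmod v <= Cmod v * (K * Cmod (w - z)))%R).
  { rewrite Et. unfold dphi. rewrite Rminus_0_r, Rmult_1_r.
    eapply Rle_trans; [apply Re_le_Cmod|]. rewrite !Cmod_mult, Cmod_conj.
    apply Rmult_le_compat_l; auto. rewrite Rmult_comm.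
    apply Rmult_le_compat_r; auto. }
  destruct (Req_dec (Cmod v) 0) as [E|E].
  - rewrite E. apply Rmult_le_pos; auto.
    eapply Rle_trans; [apply Cmod_ge_0|apply (Hb 0%R)]; lra.
  - apply Rmult_le_reg_l with (Cmod v); lra.
Qed.

(** * Limits of complex sequences, reduced to real limits of moduli *)

Definition Clim (u : nat -> C) (l : C) : Prop := is_lim_seq (fun n => Cmod (u n - l)) 0.

Lemma Clim_ext (u v : nat -> C) (l : C) : (forall n, u n = v n) -> Clim u l -> Clim v l.
Proof. intros E. apply is_lim_seq_ext. intros n. now rewrite E. Qed.

Lemma Clim_squeeze (u : nat -> C) (l : C) (v : nat -> R) :
  (forall n, (Cmod (u n - l) <= v n)%R) -> is_lim_seq v 0 -> Clim u l.
Proof.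
  intros H Hv. apply (is_lim_seq_le_le (fun _ => 0%R) _ v); auto.
  - intros n. split; [apply Cmod_ge_0|apply H].
  - apply is_lim_seq_const.
Qed.

Lemma Clim_const (l : C) : Clim (fun _ => l) l.
Proof.
  apply is_lim_seq_ext with (fun _ => 0%R); [|apply is_lim_seq_const].
  intros _. replace (l - l) with (RtoC 0) by ring. now rewrite Cmod_0.
Qed.

Lemma is_lim_seq_plus0 (u v : nat -> R) : is_lim_seq u 0 -> is_lim_seq v 0 ->
  is_lim_seq (fun n => u n + v n)%R 0.
Proof.
  intros Hu Hv. replace (Finite 0) with (Finite (0 + 0)) by (f_equal; ring).
  now apply is_lim_seq_plus'.
Qed.

Lemma is_lim_seq_scal0 (c : R) (u : nat -> R) : is_lim_seq u 0 -> is_lim_seq (fun n => c * u n)%R 0.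
Proof.
  intros Hu. replace (Finite 0) with (Finite (c * 0)) by (f_equal; ring).
  apply is_lim_seq_mult'; auto. apply is_lim_seq_const.
Qed.

Lemma Clim_plus (u v : nat -> C) (l m : C) : Clim u l -> Clim v m -> Clim (fun n => u n + v n) (l + m).
Proof.
  intros Hu Hv. eapply Clim_squeeze; [|apply (is_lim_seq_plus0 _ _ Hu Hv)].
  intros n. simpl. replace (u n + v n - (l + m)) with ((u n - l) + (v n - m)) by ring.
  apply Cmod_triangle.
Qed.

Lemma Clim_mult (u v : nat -> C) (l m : C) : Clim u l -> Clim v m -> Clim (fun n => u n * v n) (l * m).
Proof.
  intros Hu Hv.
  apply Clim_squeeze with (fun n => (Cmod (u n - l) * Cmod (v n - m) +
     (Cmod l * Cmod (v n - m) + Cmod m * Cmod (u n - l)))%R).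
  - intros n.
    replace (u n * v n - l * m) with ((u n - l) * (v n - m) + (l * (v n - m) + m * (u n - l))) by ring.
    eapply Rle_trans; [apply Cmod_triangle|].
    eapply Rle_trans; [apply Rplus_le_compat_l, Cmod_triangle|].
    rewrite !Cmod_mult. lra.
  - apply is_lim_seq_plus0; [|apply is_lim_seq_plus0; now apply is_lim_seq_scal0].
    replace (Finite 0) with (Finite (0 * 0)) by (f_equal; ring). now apply is_lim_seq_mult'.
Qed.

Lemma Clim_scal (c : C) (u : nat -> C) (l : C) : Clim u l -> Clim (fun n => c * u n) (c * l).
Proof. intros H. apply Clim_mult; auto. apply Clim_const. Qed.

Lemma Clim_minus (u v : nat -> C) (l m : C) : Clim u l -> Clim v m -> Clim (fun n => u n - v n) (l - m).
Proof.
  intros Hu Hv. replace (l - m) with (l + (-1) * m) by ring.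
  eapply Clim_ext; [|apply (Clim_plus _ _ _ _ Hu (Clim_scal (-1) _ _ Hv))].
  intros n; simpl; ring.
Qed.

Lemma Clim_Cmod_le (u : nat -> C) (l : C) (K : R) (N : nat) :
  Clim u l -> (forall n, (N <= n)%nat -> (Cmod (u n) <= K)%R) -> (Cmod l <= K)%R.
Proof.
  intros H Hb.
  assert (L : is_lim_seq (fun n => K + Cmod (u n - l))%R (K + 0)%R).
  { apply is_lim_seq_plus'; auto. apply is_lim_seq_const. }
  rewrite Rplus_0_r in L.
  assert (X := is_lim_seq_le_loc (fun _ => Cmod l) (fun n => K + Cmod (u n - l))%R (Cmod l) K).
  apply X; auto using is_lim_seq_const.
  exists N. intros n Hn. specialize (Hb n Hn).
  replace l with (u n + - (u n - l)) at 1 by ring.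
  eapply Rle_trans; [apply Cmod_triangle|]. rewrite Cmod_opp. lra.
Qed.

Lemma Clim_unique (u : nat -> C) (l m : C) : Clim u l -> Clim u m -> l = m.
Proof.
  intros H1 H2. assert (H := Clim_minus _ _ _ _ H1 H2).
  assert (B : (Cmod (l - m) <= 0)%R).
  { apply (Clim_Cmod_le _ _ _ 0%nat H). intros n _.
    replace (u n - u n) with (RtoC 0) by ring. rewrite Cmod_0. lra. }
  assert (E : l - m = 0) by (apply Cmod_eq_0, Rle_antisym; auto using Cmod_ge_0).
  now apply Ceq_minus.
Qed.

Lemma Clim_subseq (u : nat -> C) (l : C) (k : nat -> nat) :
  (forall n, (n <= k n)%nat) -> Clim u l -> Clim (fun n => u (k n)) l.
Proof.
  intros Hk H. apply (is_lim_seq_subseq (fun n => Cmod (u n - l)) 0 k); auto.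
  intros P [N HN]. exists N. intros n Hn. apply HN. specialize (Hk n). lia.
Qed.

Lemma Clim_Re_Im (u : nat -> C) (l : C) :
  is_lim_seq (fun n => Re (u n)) (Re l) -> is_lim_seq (fun n => Im (u n)) (Im l) -> Clim u l.
Proof.
  intros H1 H2.
  apply Clim_squeeze with (fun n => Rabs (Re (u n) - Re l) + Rabs (Im (u n) - Im l))%R.
  - intros n. apply Cmod_le_Re_Im.
  - assert (A : forall (v : nat -> R) (l : R), is_lim_seq v l -> is_lim_seq (fun n => Rabs (v n - l)) 0).
    { intros v x Hv. rewrite <- Rabs_R0. apply (is_lim_seq_abs (fun n => v n - x)%R 0).
      replace 0%R with (x - x)%R by ring. apply is_lim_seq_minus'; auto. apply is_lim_seq_const. }
    apply is_lim_seq_plus0; auto.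
Qed.

Lemma Clim_Re (u : nat -> C) (l : C) : Clim u l -> is_lim_seq (fun n => Re (u n)) (Re l).
Proof.
  intros H. apply is_lim_seq_le_le with (fun n => Re l - Cmod (u n - l))%R (fun n => Re l + Cmod (u n - l))%R.
  - intros n. assert (X := re_le_Cmod (u n - l)). rewrite Re_minus in X.
    apply Rabs_le_between in X. lra.
  - replace (Finite (Re l)) with (Finite (Re l - 0)) by (f_equal; ring).
    apply is_lim_seq_minus'; [apply is_lim_seq_const|exact H].
  - replace (Finite (Re l)) with (Finite (Re l + 0)) by (f_equal; ring).
    apply is_lim_seq_plus'; [apply is_lim_seq_const|exact H].
Qed.

Lemma Clim_Im (u : nat -> C) (l : C) : Clim u l -> is_lim_seq (fun n => Im (u n)) (Im l).
Proof.
  intros H.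
  assert (E : forall z : C, Im z = Re (- Ci * z)).
  { intros [a b]. unfold Im, Re, Ci, Copp, Cmult; simpl. ring. }
  rewrite E. eapply is_lim_seq_ext; [|apply (Clim_Re _ _ (Clim_scal (- Ci) _ _ H))].
  intros n. cbv beta. symmetry. apply E.
Qed.

(** * Partial sums, and series with a summable majorant *)

Fixpoint psum (a : nat -> C) (n : nat) : C :=
  match n with O => 0 | S n => psum a n + a n end.

Lemma psum_ext (a b : nat -> C) (n : nat) :
  (forall k, (k < n)%nat -> a k = b k) -> psum a n = psum b n.
Proof.
  induction n as [|n IH]; simpl; intros H; auto. rewrite IH, H; auto.
Qed.

Lemma psum_plus (a b : nat -> C) (n : nat) : psum (fun k => a k + b k) n = psum a n + psum b n.
Proof. induction n as [|n IH]; simpl; [|rewrite IH]; ring. Qed.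

Lemma psum_scal (c : C) (a : nat -> C) (n : nat) : psum (fun k => c * a k) n = c * psum a n.
Proof. induction n as [|n IH]; simpl; [|rewrite IH]; ring. Qed.

Lemma psum_shift (a : nat -> C) (n : nat) : psum a (S n) = a O + psum (fun k => a (S k)) n.
Proof.
  induction n as [|n IH]; [simpl; ring|].
  change (psum a (S (S n))) with (psum a (S n) + a (S n)). rewrite IH. simpl. ring.
Qed.

Lemma psum_add (a : nat -> C) (n m : nat) : psum a (n + m) = psum a n + psum (fun k => a (n + k)%nat) m.
Proof.
  induction m as [|m IH]; [rewrite Nat.add_0_r; simpl; ring|].
  rewrite Nat.add_succ_r. simpl. rewrite IH. ring.
Qed.

Lemma psum_exchange (f : nat -> nat -> C) (n m : nat) :
  psum (fun k => psum (f k) m) n = psum (fun j => psum (fun k => f k j) n) m.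
Proof.
  induction n as [|n IH]; simpl.
  - induction m as [|m IH]; simpl; [|rewrite <- IH]; ring.
  - rewrite IH, <- psum_plus. reflexivity.
Qed.

(** [psum] stops before index n while [sum_n] includes it; the successor makes up for this. *)
Lemma psum_sum_n (a : nat -> C) (n : nat) :
  psum a (S n) = (sum_n (fun k => Re (a k)) n, sum_n (fun k => Im (a k)) n).
Proof.
  induction n as [|n IH].
  - rewrite !sum_O. simpl. destruct (a O). unfold Cplus, RtoC; simpl. f_equal; ring.
  - rewrite !sum_Sn. change (psum a (S (S n))) with (psum a (S n) + a (S n)). rewrite IH.
    reflexivity.
Qed.

(** Both sides are sums over k < n, written by removing the last term because [sum_n] has no empty
    case. *)
Lemma psum_bound (a : nat -> C) (M : nat -> R) (n : nat) :
  (forall k, (k < n)%nat -> (Cmod (a k) <= M k)%R) -> (Cmod (psum a (S n) - a n) <= sum_n M n - M n)%R.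
Proof.
  intros H. induction n as [|n IH].
  - rewrite sum_O. simpl. replace (0 + a O - a O) with (RtoC 0) by ring. rewrite Cmod_0. lra.
  - rewrite sum_Sn. change (psum a (S (S n))) with (psum a (S n) + a (S n)).
    replace (psum a (S n) + a (S n) - a (S n)) with ((psum a (S n) - a n) + a n) by ring.
    change (plus (sum_n M n) (M (S n))) with (sum_n M n + M (S n))%R. eapply Rle_trans; [apply Cmod_triangle|].
    assert (X := H n (Nat.lt_succ_diag_r n)).
    assert (Y : (forall k, (k < n)%nat -> (Cmod (a k) <= M k)%R)) by (intros; apply H; lia).
    specialize (IH Y). lra.
Qed.

Lemma psum_Cmod_le (a : nat -> C) (K : R) (n : nat) :
  (forall k, (k < n)%nat -> (Cmod (a k) <= K)%R) -> (Cmod (psum a n) <= INR n * K)%R.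
Proof.
  induction n as [|n IH]; intros H.
  - simpl. rewrite Cmod_0. lra.
  - rewrite S_INR. simpl. eapply Rle_trans; [apply Cmod_triangle|].
    assert (X := H n (Nat.lt_succ_diag_r n)).
    assert (Y : (Cmod (psum a n) <= INR n * K)%R) by (apply IH; intros; apply H; lia). lra.
Qed.

(** [Series] is total, so a value of [csum] means something only once convergence is known; this
    lemma supplies both at once. *)
Lemma csum_unique (a : nat -> C) (l : C) : Clim (psum a) l -> csum a = l.
Proof.
  intros H. apply (Clim_subseq _ _ S) in H; [|lia].
  unfold csum. apply C_eq_Re_Im; simpl; apply is_series_unique.
  - change (is_lim_seq (sum_n (fun k => Re (a k))) (Re l)).
    apply (is_lim_seq_ext (fun n => Re (psum a (S n)))); [|now apply Clim_Re].
    intros n. now rewrite psum_sum_n.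
  - change (is_lim_seq (sum_n (fun k => Im (a k))) (Im l)).
    apply (is_lim_seq_ext (fun n => Im (psum a (S n)))); [|now apply Clim_Im].
    intros n. now rewrite psum_sum_n.
Qed.

Lemma csum_ext (a b : nat -> C) : (forall n, a n = b n) -> csum a = csum b.
Proof. intros E. unfold csum. f_equal; apply Series_ext; intros n; now rewrite E. Qed.

Section Majorant.

Variables (a : nat -> C) (M : nat -> R).
Hypothesis aM : forall n, (Cmod (a n) <= M n)%R.
Hypothesis sM : ex_series M.

Lemma csum_Clim : Clim (psum a) (csum a).
Proof.
  assert (X : Clim (fun n => psum a (S n)) (csum a)).
  { apply Clim_Re_Im.
    - apply (is_lim_seq_ext (sum_n (fun k => Re (a k)))).
      { intros n. now rewrite psum_sum_n. }
      apply Series_correct. apply (@ex_series_le R_AbsRing R_CompleteNormedModule _ M); auto.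
      intros n. eapply Rle_trans; [apply re_le_Cmod|apply aM].
    - apply (is_lim_seq_ext (sum_n (fun k => Im (a k)))).
      { intros n. now rewrite psum_sum_n. }
      apply Series_correct. apply (@ex_series_le R_AbsRing R_CompleteNormedModule _ M); auto.
      intros n. eapply Rle_trans; [apply Im_abs_le_Cmod|apply aM]. }
  unfold Clim in *. now apply is_lim_seq_incr_1.
Qed.

Lemma psum_Cmod_le_Series (n : nat) : (Cmod (psum a n) <= Series M)%R.
Proof.
  assert (M0 : forall k, (0 <= M k)%R).
  { intros k. eapply Rle_trans; [apply Cmod_ge_0|apply aM]. }
  assert (X : forall n, (sum_n M n <= Series M)%R).
  { intros m. apply (is_lim_seq_incr_compare (sum_n M)).
    - now apply Series_correct.
    - intros k. rewrite sum_Sn. specialize (M0 (S k)).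
      change (plus (sum_n M k) (M (S k))) with (sum_n M k + M (S k))%R. lra. }
  destruct n as [|n].
  { specialize (X O). rewrite sum_O in X. specialize (M0 O). simpl. rewrite Cmod_0. lra. }
  assert (B := psum_bound a M n (fun k _ => aM k)).
  replace (psum a (S n)) with ((psum a (S n) - a n) + a n) by ring.
  eapply Rle_trans; [apply Cmod_triangle|]. specialize (aM n). specialize (X n). lra.
Qed.

Lemma csum_Cmod_le : (Cmod (csum a) <= Series M)%R.
Proof.
  apply (Clim_Cmod_le _ _ _ O csum_Clim). intros n _. apply psum_Cmod_le_Series.
Qed.

End Majorant.

Lemma csum_tail (a : nat -> C) (M : nat -> R) (n : nat) :
  (forall k, (Cmod (a k) <= M k)%R) -> ex_series M ->
  csum a - psum a n = csum (fun k => a (n + k)%nat).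
Proof.
  intros aM sM. symmetry. apply csum_unique.
  apply Clim_ext with (fun m => psum a (n + m) - psum a n).
  { intros m. rewrite psum_add. ring. }
  apply Clim_minus; [|apply Clim_const].
  apply (Clim_subseq (psum a) _ (fun m => n + m)%nat); [lia|].
  now apply (csum_Clim a M).
Qed.

Lemma csum_tail_le (a : nat -> C) (M : nat -> R) (n : nat) :
  (forall k, (Cmod (a k) <= M k)%R) -> ex_series M ->
  (Cmod (csum a - psum a n) <= Series (fun k => M (n + k)%nat))%R.
Proof.
  intros aM sM. rewrite (csum_tail a M n) by auto.
  apply csum_Cmod_le; auto. now apply ex_series_incr_n.
Qed.

Lemma csum_shift (a : nat -> C) (M : nat -> R) :
  (forall k, (Cmod (a k) <= M k)%R) -> ex_series M ->
  csum a = a O + csum (fun k => a (S k)).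
Proof.
  intros aM sM. assert (H := csum_tail a M 1 aM sM). simpl in H.
  rewrite <- H. ring.
Qed.

Lemma psum_even_odd (a : nat -> C) (n : nat) :
  psum a (2 * n) = psum (fun k => a (2 * k)%nat) n + psum (fun k => a (2 * k + 1)%nat) n.
Proof.
  induction n as [|n IH]; [simpl; ring|].
  replace (2 * S n)%nat with (S (S (2 * n))) by lia.
  change (psum a (S (S (2 * n)))) with (psum a (2 * n) + a (2 * n)%nat + a (S (2 * n))).
  rewrite IH. change (psum ?f (S n)) with (psum f n + f n). cbv beta.
  replace (2 * n + 1)%nat with (S (2 * n)) by lia. ring.
Qed.

Lemma csum_even_odd (a : nat -> C) (M : nat -> R) (l m : C) :
  (forall k, (Cmod (a k) <= M k)%R) -> ex_series M ->
  Clim (psum (fun k => a (2 * k)%nat)) l -> Clim (psum (fun k => a (2 * k + 1)%nat)) m ->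
  csum a = l + m.
Proof.
  intros aM sM Hl Hm.
  apply Clim_unique with (fun n => psum a (2 * n)).
  - apply (Clim_subseq (psum a) _ (fun n => 2 * n)%nat); [lia|]. now apply (csum_Clim a M).
  - apply (Clim_ext _ _ _ (fun n => eq_sym (psum_even_odd a n))). now apply Clim_plus.
Qed.

(** The mean value inequality bounds the linearization error of every [fn n] by the variation of
    [gn n] around [g z], and the bound passes to the limit. Uniform convergence of the derivatives
    makes it independent of n. *)
Lemma cderiv_uniform_limit (fn gn : nat -> C -> C) (f g : C -> C) (z : C) (r : R) :
  (0 < r)%R ->
  (forall y, (Cmod (y - z) < r)%R -> Clim (fun n => fn n y) (f y)) ->
  (forall n y, (Cmod (y - z) < r)%R -> cderiv (fn n) y (gn n y)) ->
  (forall n, ccont (gn n) z) ->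
  (forall eps : R, (0 < eps)%R -> exists N, forall n y, (N <= n)%nat -> (Cmod (y - z) < r)%R ->
     (Cmod (gn n y - g y) <= eps)%R) ->
  cderiv f z (g z).
Proof.
  intros Hr Hf Hd Hc Hu. apply cderiv_iff. intros eps He.
  destruct (Hu (eps / 4)%R) as [N HN]; [lra|].
  destruct (Hc N (eps / 4)%R) as [d [Hd0 Hd1]]; [lra|].
  exists (Rmin r d). split; [apply Rmin_glb_lt; auto|].
  intros y Hy.
  assert (Y1 := Rlt_le_trans _ _ _ Hy (Rmin_l _ _)). assert (Y2 := Rlt_le_trans _ _ _ Hy (Rmin_r _ _)).
  assert (Z0 : (Cmod (z - z) < r)%R).
  { replace (z - z) with (RtoC 0) by ring. now rewrite Cmod_0. }
  apply (Clim_Cmod_le (fun n => fn n y - fn n z - (y - z) * g z) _ _ N).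
  { apply Clim_minus; [apply Clim_minus; auto|apply Clim_const]. }
  intros n Hn. apply cderiv_mean_value with (gn n).
  - intros t Ht. apply Hd.
    replace (z + t * (y - z) - z) with (t * (y - z)) by ring.
    rewrite Cmod_mult, Cmod_R, Rabs_right by lra.
    assert (X := Cmod_ge_0 (y - z)). nra.
  - intros t Ht. set (x := z + t * (y - z)).
    assert (Hx : (Cmod (x - z) <= Cmod (y - z))%R).
    { unfold x. replace (z + t * (y - z) - z) with (t * (y - z)) by ring.
      rewrite Cmod_mult, Cmod_R, Rabs_right by lra.
      assert (X := Cmod_ge_0 (y - z)). nra. }
    (* The comparison passes through the fixed index [N]: continuity at z is assumed for each [gn],
       not for [g]. *)
    replace (gn n x - g z) with ((gn n x - g x) + ((g x - gn N x) + ((gn N x - gn N z) + (gn N z - g z)))) by ring.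
    eapply Rle_trans; [apply Cmod_triangle|].
    eapply Rle_trans; [apply Rplus_le_compat_l, Cmod_triangle|].
    eapply Rle_trans; [apply Rplus_le_compat_l, Rplus_le_compat_l, Cmod_triangle|].
    assert (A1 := HN n x Hn ltac:(lra)). assert (A2 := HN N x (le_n N) ltac:(lra)).
    assert (A3 := Hd1 x ltac:(lra)). assert (A4 := HN N z (le_n N) Z0).
    rewrite (Cmod_minus_sym (g x)). lra.
Qed.

(** * Geometric majorants *)

Lemma ex_series_geom_scal (K s : R) : (0 <= s < 1)%R -> ex_series (fun n => K * s ^ n)%R.
Proof. intros Hs. apply (@ex_series_scal R_AbsRing R_NormedModule K (fun n => s ^ n)%R). apply ex_series_geom. rewrite Rabs_right; lra. Qed.

Lemma Series_geom_scal (K s : R) : (0 <= s < 1)%R -> Series (fun n => K * s ^ n)%R = (K / (1 - s))%R.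
Proof.
  intros Hs. rewrite Series_scal_l, Series_geom; [reflexivity|]. rewrite Rabs_right; lra.
Qed.

Section Geometric.

Variables (a : nat -> C) (K s : R).
Hypothesis Hs : (0 <= s < 1)%R.
Hypothesis Ha : forall n, (Cmod (a n) <= K * s ^ n)%R.

Lemma csum_Clim_geom : Clim (psum a) (csum a).
Proof. apply (csum_Clim a _ Ha). now apply ex_series_geom_scal. Qed.

Lemma csum_Cmod_le_geom : (Cmod (csum a) <= K / (1 - s))%R.
Proof.
  rewrite <- Series_geom_scal by auto. apply csum_Cmod_le; auto. now apply ex_series_geom_scal.
Qed.

Lemma psum_Cmod_le_geom (n : nat) : (Cmod (psum a n) <= K / (1 - s))%R.
Proof.
  rewrite <- Series_geom_scal by auto. apply psum_Cmod_le_Series; auto. now apply ex_series_geom_scal.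
Qed.

Lemma csum_tail_geom (n : nat) : (Cmod (csum a - psum a n) <= K / (1 - s) * s ^ n)%R.
Proof.
  eapply Rle_trans; [apply (csum_tail_le a (fun n => K * s ^ n)%R n)|]; auto.
  - now apply ex_series_geom_scal.
  - rewrite (Series_ext _ (fun k => (K * s ^ n) * s ^ k)%R).
    + rewrite Series_geom_scal by auto. apply Req_le. field. lra.
    + intros k. rewrite pow_add. ring.
Qed.

End Geometric.

Lemma pow_le_1 (s : R) (n : nat) : (0 <= s <= 1)%R -> (0 <= s ^ n <= 1)%R.
Proof.
  intros Hs. split; [apply pow_le; lra|]. rewrite <- (pow1 n). apply pow_incr. lra.
Qed.

Lemma pow_antitone (s : R) (n m : nat) : (0 <= s <= 1)%R -> (n <= m)%nat -> (s ^ m <= s ^ n)%R.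
Proof.
  intros Hs Hnm. replace m with (n + (m - n))%nat by lia. rewrite pow_add.
  assert (A := pow_le_1 s n Hs). assert (B := pow_le_1 s (m - n) Hs). nra.
Qed.

(** Each of the n + 1 copies of s^n is at most one of the terms 1, s, ..., s^n of the geometric
    sum. *)
Lemma linear_geom_bound (s : R) (n : nat) : (0 <= s < 1)%R -> ((INR n + 1) * s ^ n <= / (1 - s))%R.
Proof.
  intros Hs.
  assert (B : ((INR n + 1) * s ^ n * (1 - s) <= 1 - s ^ S n)%R).
  { induction n as [|n IH]; [simpl; lra|].
    rewrite S_INR. simpl pow in *. assert (A := pow_le_1 s n ltac:(lra)).
    assert (P := pos_INR n). set (u := (s ^ n)%R) in *.
    assert (X : (s * ((INR n + 1) * u * (1 - s)) <= s * (1 - s * u))%R) by (apply Rmult_le_compat_l; lra).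
    assert (Y : (0 <= s * u)%R) by nra. assert (Z : (s * u <= 1)%R) by nra. nra. }
  apply Rmult_le_reg_r with (1 - s)%R; [lra|]. rewrite Rinv_l by lra.
  assert (A := pow_le_1 s (S n) ltac:(lra)). lra.
Qed.

(** With r = t * t, one factor t^n absorbs one power of n + 1, and the other is left for the
    induction. *)
Lemma poly_geom_bound (k : nat) (r : R) : (0 <= r < 1)%R ->
  exists K s : R, (0 <= K)%R /\ (0 < s < 1)%R /\ forall n, ((INR n + 1) ^ k * r ^ n <= K * s ^ n)%R.
Proof.
  revert r. induction k as [|k IH]; intros r Hr.
  - exists 1%R, ((1 + r) / 2)%R. repeat split; try lra. intros n. rewrite !Rmult_1_l.
    apply pow_incr. lra.
  - set (t := sqrt r).
    assert (Ht : (0 <= t < 1)%R).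
    { split; [apply sqrt_pos|]. unfold t. rewrite <- sqrt_1. apply sqrt_lt_1; lra. }
    assert (Et : (t * t = r)%R) by (apply sqrt_sqrt; lra).
    destruct (IH t Ht) as [K [s [HK [Hs H]]]].
    exists (/ (1 - t) * K)%R, s. split; [|split; auto].
    + apply Rmult_le_pos; auto. apply Rlt_le, Rinv_0_lt_compat; lra.
    + intros n. rewrite <- Et, Rpow_mult_distr.
      replace ((INR n + 1) ^ S k * (t ^ n * t ^ n))%R with
        (((INR n + 1) * t ^ n) * ((INR n + 1) ^ k * t ^ n))%R by (simpl; ring).
      rewrite (Rmult_assoc (/ (1 - t))). assert (P := pos_INR n). assert (A := pow_le_1 t n ltac:(lra)).
      apply Rmult_le_compat; auto using linear_geom_bound.
      * apply Rmult_le_pos; lra.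
      * apply Rmult_le_pos; [apply pow_le; lra|lra].
Qed.

Lemma geom_lim0 (K s : R) : (0 <= s < 1)%R -> is_lim_seq (fun n => K * s ^ n)%R 0.
Proof. intros Hs. apply is_lim_seq_scal0, is_lim_seq_geom. rewrite Rabs_right; lra. Qed.

Lemma pow_taylor_bound (x h : C) (r : R) (e : nat) : (0 <= r)%R ->
  (Cmod x <= r)%R -> (Cmod (x + h) <= r)%R ->
  (r ^ 2 * Cmod ((x + h) ^ e - x ^ e - h * (INR e * x ^ pred e)) <= INR e ^ 2 * r ^ e * Cmod h ^ 2)%R.
Proof.
  intros Hr Hx Hxh. induction e as [|e IH].
  - simpl. replace (1 - 1 - h * (0 * 1)) with (RtoC 0) by ring. rewrite Cmod_0. lra.
  - set (d := (x + h) ^ e - x ^ e - h * (INR e * x ^ pred e)) in *.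
    replace ((x + h) ^ S e - x ^ S e - h * (INR (S e) * x ^ pred (S e))) with
      ((x + h) * d + h * h * (INR e * x ^ pred e)).
    2: { unfold d. rewrite S_INR, RtoC_plus. destruct e; simpl; ring. }
    assert (P := pos_INR e). assert (Ph := Cmod_ge_0 h). assert (Pd := Cmod_ge_0 d).
    set (H := (Cmod h ^ 2)%R) in *. assert (PH : (0 <= H)%R) by apply pow2_ge_0.
    assert (R0 : (0 <= r ^ e)%R) by now apply pow_le.
    assert (A1 : (r ^ 2 * Cmod ((x + h) * d) <= r * (INR e ^ 2 * r ^ e * H))%R).
    { rewrite Cmod_mult. replace (r ^ 2 * (Cmod (x + h) * Cmod d))%R with (Cmod (x + h) * (r ^ 2 * Cmod d))%R by ring.
      apply Rmult_le_compat; auto using Cmod_ge_0. apply Rmult_le_pos; [apply pow2_ge_0|auto]. }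
    assert (A2 : (r ^ 2 * Cmod (h * h * (INR e * x ^ pred e)) <= INR e * (r * r ^ e) * H)%R).
    { rewrite !Cmod_mult, Cmod_R, Cmod_pow, Rabs_right by lra.
      replace (r ^ 2 * (Cmod h * Cmod h * (INR e * Cmod x ^ pred e)))%R with
        (INR e * (r ^ 2 * Cmod x ^ pred e) * H)%R by (unfold H; ring).
      apply Rmult_le_compat_r; auto.
      destruct e as [|e]; [simpl; lra|]. change (pred (S e)) with e.
      apply Rmult_le_compat_l; auto.
      replace (r * r ^ S e)%R with (r ^ 2 * r ^ e)%R by (simpl; ring).
      apply Rmult_le_compat_l; [apply pow2_ge_0|]. apply pow_incr. split; auto using Cmod_ge_0. }
    apply Rle_trans with (r ^ 2 * (Cmod ((x + h) * d) + Cmod (h * h * (INR e * x ^ pred e))))%R.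
    { apply Rmult_le_compat_l; [apply pow2_ge_0|apply Cmod_triangle]. }
    rewrite Rmult_plus_distr_l. eapply Rle_trans; [apply Rplus_le_compat; [exact A1|exact A2]|].
    rewrite S_INR. simpl (r ^ S e)%R.
    assert (X : (0 <= r * r ^ e * H)%R) by (apply Rmult_le_pos; [apply Rmult_le_pos|]; assumption).
    set (Y := (r * r ^ e * H)%R) in *.
    replace (r * (INR e ^ 2 * r ^ e * H) + INR e * (r * r ^ e) * H)%R with ((INR e ^ 2 + INR e) * Y)%R
      by (unfold Y; ring).
    replace ((INR e + 1) ^ 2 * (r * r ^ e) * H)%R with ((INR e + 1) ^ 2 * Y)%R by (unfold Y; ring).
    apply Rmult_le_compat_r; auto. simpl. lra.
Qed.

(** * Termwise differentiation of power series with sparse exponents *)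

Section SparsePowerSeries.

Variables (c : nat -> C) (e : nat -> nat) (r K s : R).
Hypothesis Hr : (0 < r)%R.
Hypothesis Hs : (0 <= s < 1)%R.
Hypothesis Hc : forall n, (Cmod (c n) * (INR (e n) + 1) ^ 2 * r ^ e n <= K * s ^ n)%R.

Lemma sparse_term_bound (x : C) (n : nat) : (Cmod x <= r)%R -> (Cmod (c n * x ^ e n) <= K * s ^ n)%R.
Proof.
  intros Hx. eapply Rle_trans; [|apply Hc]. rewrite Cmod_mult, Cmod_pow.
  assert (P := pos_INR (e n)). assert (Q := Cmod_ge_0 (c n)).
  apply Rle_trans with (Cmod (c n) * 1 * r ^ e n)%R.
  - rewrite Rmult_1_r. apply Rmult_le_compat_l; auto. apply pow_incr. split; auto using Cmod_ge_0.
  - apply Rmult_le_compat_r; [apply pow_le; lra|]. apply Rmult_le_compat_l; auto. simpl; nra.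
Qed.

Lemma sparse_deriv_term_bound (x : C) (n : nat) : (Cmod x <= r)%R ->
  (Cmod (c n * (INR (e n) * x ^ pred (e n))) <= K / r * s ^ n)%R.
Proof.
  intros Hx. apply Rmult_le_reg_l with r; auto.
  replace (r * (K / r * s ^ n))%R with (K * s ^ n)%R by (field; lra).
  eapply Rle_trans; [|apply Hc]. rewrite !Cmod_mult, Cmod_pow, Cmod_R.
  assert (P := pos_INR (e n)). assert (Q := Cmod_ge_0 (c n)). rewrite Rabs_right by lra.
  replace (r * (Cmod (c n) * (INR (e n) * Cmod x ^ pred (e n))))%R with
    (Cmod (c n) * (INR (e n) * (r * Cmod x ^ pred (e n))))%R by ring.
  rewrite Rmult_assoc. apply Rmult_le_compat_l; auto.
  destruct (e n) as [|m]; [simpl; nra|]. change (pred (S m)) with m.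
  apply Rmult_le_compat; auto.
  - apply Rmult_le_pos; [lra|]. apply pow_le, Cmod_ge_0.
  - simpl; nra.
  - simpl. apply Rmult_le_compat_l; [lra|]. apply pow_incr. split; auto using Cmod_ge_0.
Qed.

(** The Taylor remainders of the terms add up to a multiple of |h|^2; their growth in [e n] is why
    [Hc] carries the square of [e n] + 1. A free sequence of exponents avoids padding the series of
    squares with zero coefficients. *)
Lemma sparse_cderiv (x : C) : (Cmod x < r)%R ->
  cderiv (fun y => csum (fun n => c n * y ^ e n)) x (csum (fun n => c n * (INR (e n) * x ^ pred (e n)))).
Proof.
  intros Hx. apply cderiv_iff. intros eps He.
  assert (K0 : (0 <= K)%R).
  { assert (X := sparse_term_bound x 0 ltac:(lra)). simpl in X.
    assert (Y := Cmod_ge_0 (c 0%nat * x ^ e 0%nat)). lra. }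
  (* The sum of the remainder bounds; adding 1 keeps it positive when K is 0. *)
  set (B := (K / r ^ 2 / (1 - s) + 1)%R).
  assert (R2 : (0 < r ^ 2)%R) by (apply pow_lt; auto).
  assert (HB : (0 < B)%R).
  { unfold B. assert (0 <= K / r ^ 2 / (1 - s))%R; [|lra].
    apply Rmult_le_pos; [apply Rmult_le_pos; auto|]; apply Rlt_le, Rinv_0_lt_compat; lra. }
  exists (Rmin (r - Cmod x) (eps / B)). split.
  { apply Rmin_glb_lt; [lra|]. now apply Rdiv_lt_0_compat. }
  intros y Hy.
  assert (Y1 := Rlt_le_trans _ _ _ Hy (Rmin_l _ _)). assert (Y2 := Rlt_le_trans _ _ _ Hy (Rmin_r _ _)).
  set (h := y - x) in *.
  assert (Ey : y = x + h) by (unfold h; ring).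
  assert (Hyr : (Cmod y <= r)%R).
  { rewrite Ey. eapply Rle_trans; [apply Cmod_triangle|]. lra. }
  assert (Hh := Cmod_ge_0 h).
  apply Rle_trans with (B * Cmod h ^ 2)%R.
  - apply (Clim_Cmod_le (psum (fun n => c n * (y ^ e n - x ^ e n - h * (INR (e n) * x ^ pred (e n)))))
              _ _ O).
    + apply Clim_ext with (fun n => psum (fun n => c n * y ^ e n) n - psum (fun n => c n * x ^ e n) n
         - h * psum (fun n => c n * (INR (e n) * x ^ pred (e n))) n).
      { intros n. induction n as [|n IH]; simpl; [ring|]. rewrite <- IH. ring. }
      apply Clim_minus; [apply Clim_minus|apply Clim_scal].
      * apply (csum_Clim_geom _ K s Hs). intros n. now apply sparse_term_bound.
      * apply (csum_Clim_geom _ K s Hs). intros n. apply sparse_term_bound; lra.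
      * apply (csum_Clim_geom _ (K / r) s Hs). intros n. apply sparse_deriv_term_bound; lra.
    + intros n _.
      apply Rle_trans with (K / r ^ 2 * Cmod h ^ 2 / (1 - s))%R.
      * apply psum_Cmod_le_geom; auto. intros k.
        rewrite Cmod_mult. apply Rmult_le_reg_l with (r ^ 2)%R; auto.
        replace (r ^ 2 * (K / r ^ 2 * Cmod h ^ 2 * s ^ k))%R with (K * s ^ k * Cmod h ^ 2)%R by (field; lra).
        eapply Rle_trans; [|apply Rmult_le_compat_r; [apply pow2_ge_0|apply Hc]].
        assert (T := pow_taylor_bound x h r (e k) ltac:(lra) ltac:(lra) ltac:(rewrite <- Ey; lra)).
        rewrite <- Ey in T. assert (P := pos_INR (e k)). assert (Q := Cmod_ge_0 (c k)).
        apply Rle_trans with (Cmod (c k) * (INR (e k) ^ 2 * r ^ e k * Cmod h ^ 2))%R.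
        { rewrite <- Rmult_assoc, (Rmult_comm (r ^ 2)), Rmult_assoc. now apply Rmult_le_compat_l. }
        rewrite !Rmult_assoc. apply Rmult_le_compat_l; auto. apply Rmult_le_compat_r.
        { apply Rmult_le_pos; [apply pow_le; lra|apply pow2_ge_0]. }
        simpl; nra.
      * replace (K / r ^ 2 * Cmod h ^ 2 / (1 - s))%R with (K / r ^ 2 / (1 - s) * Cmod h ^ 2)%R by (unfold Rdiv; ring).
        apply Rmult_le_compat_r; [apply pow2_ge_0|]. unfold B; lra.
  - simpl. rewrite Rmult_1_r, <- Rmult_assoc. apply Rmult_le_compat_r; auto.
    apply (Rmult_lt_compat_r B) in Y2; auto. unfold Rdiv in Y2.
    rewrite Rmult_assoc, Rinv_l in Y2; lra.
Qed.

End SparsePowerSeries.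

(** * The series [phi] and its first two derivatives *)

Definition phi (x : C) : C := 2 * csum (fun n => x ^ (n * n)) - 1.
(** Where [pred] truncates (n = 0 here, n = 0 and n = 1 in [d2phi]), the coefficient is zero, so the
    exponent there does no harm. *)
Definition dphi (x : C) : C := 2 * csum (fun n => INR (n * n) * x ^ pred (n * n)).
Definition d2phi (x : C) : C :=
  2 * csum (fun n => INR (n * n) * (INR (pred (n * n)) * x ^ pred (pred (n * n)))).

(** The exponent n^2 is weakened to n, which leaves a polynomial of degree 2k in n against a
    geometric sequence; dividing by r pays for [pred]. *)
Lemma square_geom_bound (k : nat) (r : R) : (0 < r < 1)%R ->
  exists K s : R, (0 <= K)%R /\ (0 < s < 1)%R /\
    forall n, ((INR (n * n) + 1) ^ k * r ^ pred (n * n) <= K * s ^ n)%R.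
Proof.
  intros Hr. destruct (poly_geom_bound (2 * k) r) as [K [s [HK [Hs H]]]]; [lra|].
  exists (K / r)%R, s. split; [|split; auto].
  - apply Rmult_le_pos; auto. apply Rlt_le, Rinv_0_lt_compat; lra.
  - intros n. apply Rmult_le_reg_l with r; [lra|].
    replace (r * (K / r * s ^ n))%R with (K * s ^ n)%R by (field; lra).
    eapply Rle_trans; [|apply H].
    rewrite (Rmult_comm r), Rmult_assoc. rewrite pow_mult.
    assert (P := pos_INR n).
    apply Rmult_le_compat.
    + apply pow_le. rewrite mult_INR. nra.
    + apply Rmult_le_pos; [apply pow_le|]; lra.
    + apply pow_incr. rewrite mult_INR. simpl. nra.
    + replace (r ^ pred (n * n) * r)%R with (r ^ S (pred (n * n)))%R by (simpl; ring).
      apply pow_antitone; [lra|]. nia.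
Qed.

Lemma square_pow_bound (r : R) (n : nat) : (0 <= r <= 1)%R -> (r ^ (n * n) <= r ^ n)%R.
Proof. intros Hr. apply pow_antitone; [lra|]. nia. Qed.

Lemma phi_term_bound (x : C) (r : R) (n : nat) : (Cmod x <= r <= 1)%R -> (Cmod (x ^ (n * n)) <= 1 * r ^ n)%R.
Proof.
  intros Hx. assert (P := Cmod_ge_0 x). rewrite Cmod_pow, Rmult_1_l.
  apply Rle_trans with (r ^ (n * n))%R; [apply pow_incr; lra|].
  apply square_pow_bound; lra.
Qed.

Lemma exists_between (x : C) : (Cmod x < 1)%R -> exists r : R, (0 < r < 1)%R /\ (Cmod x < r)%R.
Proof. intros H. assert (P := Cmod_ge_0 x). exists ((Cmod x + 1) / 2)%R. lra. Qed.

Lemma cderiv_phi (x : C) : (Cmod x < 1)%R -> cderiv phi x (dphi x).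
Proof.
  intros Hx. destruct (exists_between x Hx) as [r [Hr Hxr]].
  destruct (square_geom_bound 2 r Hr) as [K [s [HK [Hs H]]]].
  assert (D : cderiv (fun y => csum (fun n => 1 * y ^ (n * n))) x
     (csum (fun n => 1 * (INR (n * n) * x ^ pred (n * n))))).
  { apply sparse_cderiv with r K s; [lra|lra| |exact Hxr].
    intros n. rewrite Cmod_1, Rmult_1_l. eapply Rle_trans; [|apply H].
    apply Rmult_le_compat_l; [apply pow_le; assert (P := pos_INR (n * n)); lra|].
    apply pow_antitone; [lra|]. lia. }
  apply (cderiv_mult _ _ _ _ _ (cderiv_const 2 x)) in D.
  apply (fun h => cderiv_minus _ _ _ _ _ h (cderiv_const 1 x)) in D.
  eapply cderiv_ext; [|eapply cderiv_eq; [|exact D]].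
  - intros y. unfold phi. cbv beta. do 2 f_equal. apply csum_ext. intros n. ring.
  - unfold dphi. cbv beta.
    rewrite (csum_ext (fun n => 1 * (INR (n * n) * x ^ pred (n * n))) (fun n => INR (n * n) * x ^ pred (n * n))).
    + ring.
    + intros n; ring.
Qed.

Lemma square_coef_bound (r : R) : (0 < r < 1)%R -> exists K s : R, (0 <= K)%R /\ (0 < s < 1)%R /\
  forall n, (Cmod (INR (n * n)) * (INR (pred (n * n)) + 1) ^ 2 * r ^ pred (n * n) <= K * s ^ n)%R.
Proof.
  intros Hr. destruct (square_geom_bound 3 r Hr) as [K [s [HK [Hs H]]]].
  exists K, s. split; [|split]; auto. intros n. eapply Rle_trans; [|apply H].
  assert (P := pos_INR (n * n)). assert (P' := pos_INR (pred (n * n))).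
  assert (Q : (INR (pred (n * n)) <= INR (n * n))%R) by (apply le_INR; lia).
  apply Rmult_le_compat_r; [apply pow_le; lra|].
  rewrite Cmod_R, Rabs_right by lra.
  apply Rle_trans with (INR (n * n) * (INR (n * n) + 1) ^ 2)%R.
  - apply Rmult_le_compat_l; auto. apply pow_incr. lra.
  - replace ((INR (n * n) + 1) ^ 3)%R with ((INR (n * n) + 1) * (INR (n * n) + 1) ^ 2)%R by ring.
    apply Rmult_le_compat_r; [apply pow2_ge_0|lra].
Qed.

Lemma cderiv_dphi (x : C) : (Cmod x < 1)%R -> cderiv dphi x (d2phi x).
Proof.
  intros Hx. destruct (exists_between x Hx) as [r [Hr Hxr]].
  destruct (square_coef_bound r Hr) as [K [s [HK [Hs H]]]].
  assert (D := sparse_cderiv (fun n => INR (n * n)) (fun n => pred (n * n)) r K s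
     ltac:(lra) ltac:(lra) H x Hxr).
  apply (cderiv_mult _ _ _ _ _ (cderiv_const 2 x)) in D.
  eapply cderiv_eq; [|exact D]. unfold d2phi. cbv beta. ring.
Qed.

(** Serves the O(x) estimate in [efun_ode], where a bound on [d2phi] near 0 replaces a third
    derivative. *)
Lemma d2phi_bounded : exists K : R, forall x, (Cmod x <= / 2)%R -> (Cmod (d2phi x) <= K)%R.
Proof.
  destruct (square_coef_bound (/ 2)) as [K [s [HK [Hs H]]]]; [lra|].
  exists (2 * (K / (/ 2) / (1 - s)))%R. intros x Hx. unfold d2phi.
  rewrite Cmod_mult, Cmod_R, Rabs_right by lra. apply Rmult_le_compat_l; [lra|].
  apply csum_Cmod_le_geom; [lra|]. intros n.
  apply (sparse_deriv_term_bound (fun n => INR (n * n)) (fun n => pred (n * n)) (/ 2) K s); auto; lra.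
Qed.

Lemma phi_0 : phi 0 = 1.
Proof.
  unfold phi. rewrite (csum_unique _ 1); [ring|].
  apply (is_lim_seq_incr_1 (fun n => Cmod (psum (fun n => 0 ^ (n * n)) n - 1))).
  apply Clim_ext with (fun _ => RtoC 1); [|apply Clim_const].
  intros n. rewrite psum_shift. simpl. rewrite (psum_ext _ (fun _ => 0 * 0)).
  - rewrite psum_scal. ring.
  - intros k _. replace (S k * S k)%nat with (S (k + k * S k)) by lia. simpl. ring.
Qed.

Lemma dphi_0 : dphi 0 = 2.
Proof.
  unfold dphi. rewrite (csum_unique _ 1); [ring|].
  set (a := fun n => INR (n * n) * 0 ^ pred (n * n)).
  apply (is_lim_seq_incr_n (fun n => Cmod (psum a n - 1)) 2).
  apply Clim_ext with (fun _ => RtoC 1); [|apply Clim_const].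
  intros n. replace (n + 2)%nat with (2 + n)%nat by lia. rewrite psum_add.
  rewrite (psum_ext (fun k => a (2 + k)%nat) (fun _ => 0 * 0)).
  - rewrite psum_scal. unfold a. simpl. ring.
  - intros k _. unfold a.
    replace (pred ((2 + k) * (2 + k))) with (S (pred (pred ((2 + k) * (2 + k))))) by nia.
    simpl Cpow. ring.
Qed.

Lemma Cmod_pow_le (x : C) (r : R) (n : nat) : (Cmod x <= r)%R -> (Cmod (x ^ n) <= r ^ n)%R.
Proof. intros H. rewrite Cmod_pow. apply pow_incr. split; auto using Cmod_ge_0. Qed.

Lemma Cmod_1_plus (u : C) (r : R) : (Cmod u <= r)%R -> (1 - r <= Cmod (1 + u) <= 1 + r)%R.
Proof.
  intros H. assert (A := Cmod_triangle_inv 1 u). assert (B := Cmod_triangle 1 u).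
  rewrite Cmod_1 in *. lra.
Qed.

Lemma Cmod_1_minus (u : C) (r : R) : (Cmod u <= r)%R -> (1 - r <= Cmod (1 - u) <= 1 + r)%R.
Proof. intros H. unfold Cminus. apply Cmod_1_plus. now rewrite Cmod_opp. Qed.

Lemma Cmod_pow_lt_1 (x : C) (n : nat) : (Cmod x < 1)%R -> (Cmod (x ^ S n) < 1)%R.
Proof.
  intros H. rewrite Cmod_pow. assert (P := Cmod_ge_0 x).
  apply Rle_lt_trans with (Cmod x ^ 1)%R; [|simpl; lra]. apply pow_antitone; [lra|lia].
Qed.

Lemma one_plus_neq0 (u : C) : (Cmod u < 1)%R -> 1 + u <> 0.
Proof. intros H. apply Cmod_gt_0. assert (A := Cmod_1_plus u _ (Rle_refl _)). lra. Qed.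

Lemma one_minus_neq0 (u : C) : (Cmod u < 1)%R -> 1 - u <> 0.
Proof. intros H. apply Cmod_gt_0. assert (A := Cmod_1_minus u _ (Rle_refl _)). lra. Qed.

(** * Gauss's product for [phi (- x)] *)

Fixpoint gprod (x : C) (n : nat) : C :=
  match n with
  | O => 1
  | S m => gprod x m * ((1 - x ^ S m) / (1 + x ^ S m))
  end.

Lemma gprod_neq0 (x : C) (n : nat) : (Cmod x < 1)%R -> gprod x n <> 0.
Proof.
  intros H. induction n as [|n IH]; cbn [gprod]; [apply C1_nz|].
  assert (X := Cmod_pow_lt_1 x n H).
  apply Cmult_neq_0; auto. unfold Cdiv. apply Cmult_neq_0; [now apply one_minus_neq0|].
  intros E. assert (N := one_plus_neq0 _ X). apply (Cmult_neq_0 _ _ N N).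
  replace (1 + x ^ S n) with ((1 + x ^ S n) * (1 + x ^ S n) * / (1 + x ^ S n)) at 1 by (field; auto).
  rewrite E. ring.
Qed.

Lemma neg1_pow_even (j : nat) : (-1) ^ (2 * j) = 1.
Proof. rewrite Cpow_mult_r. replace ((-1) ^ 2) with (RtoC 1) by ring. apply Cpow_1_l. Qed.

Lemma neg1_pow_odd (j : nat) : (-1) ^ (2 * j + 1) = -1.
Proof. rewrite Cpow_add_r, neg1_pow_even. ring. Qed.

Lemma neg1_pow_square (k : nat) : (-1) ^ (k * k) = (-1) ^ k.
Proof.
  rewrite Cpow_mult_r. destruct (Nat.Even_or_Odd k) as [[j ->]|[j ->]].
  - rewrite neg1_pow_even. apply Cpow_1_l.
  - now rewrite neg1_pow_odd, neg1_pow_odd.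
Qed.

Lemma neg_pow_square (x : C) (k : nat) : (- x) ^ (k * k) = (-1) ^ k * x ^ (k * k).
Proof.
  replace (- x) with ((-1) * x) by ring. now rewrite Cpow_mult_l, neg1_pow_square.
Qed.

Section Shanks.

Variable x : C.
Hypothesis Hx : (Cmod x < 1)%R.

(** Summand of Shanks's finite identity. Since x^0 = 1, the term s = 0 is [gprod x n] itself, while
    the terms with s > 0 carry x^(s(n+1)) and fade as n grows; this is how the identity tends to
    Gauss's product. *)
Let F (n s : nat) : C := (-1) ^ s * (gprod x n / gprod x s) * x ^ (s * S n) * (2 / (1 + x ^ s)).
Let H (n j : nat) : C :=
  (-1) ^ S j * (2 / (1 + x ^ S n)) * (gprod x n / gprod x j) * x ^ (S j * S n).

Lemma pow_den_neq0 (n : nat) : 1 + x ^ n <> 0.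
Proof.
  destruct n.
  - simpl. replace (1 + 1) with (RtoC 2) by ring. apply IZR_C_neq0; lia.
  - now apply one_plus_neq0, Cmod_pow_lt_1.
Qed.

(* A Wilf-Zeilberger pair: the difference in [n] telescopes in [s]. *)
Lemma shanks_telescope (n j : nat) : psum (fun s => F (S n) s - F n s) (S j) = H n j.
Proof.
  assert (N2 := pow_den_neq0). assert (G := fun k => gprod_neq0 x k Hx).
  induction j as [|j IH].
  - simpl psum. unfold F, H. cbn [gprod]. rewrite !Nat.mul_0_l, Nat.mul_1_l.
    specialize (N2 (S n)). specialize (G n). simpl (x ^ 0). simpl ((-1) ^ 0). simpl ((-1) ^ 1).
    field. repeat split; auto.
  - change (psum (fun s => F (S n) s - F n s) (S j) + (F (S n) (S j) - F n (S j)) = H n (S j)).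
    rewrite IH. unfold F, H.
    replace (x ^ (S j * S (S n))) with (x ^ (S j * S n) * x ^ S j)
      by (rewrite <- Cpow_add_r; f_equal; lia).
    replace (x ^ (S (S j) * S n)) with (x ^ (S j * S n) * x ^ S n)
      by (rewrite <- Cpow_add_r; f_equal; lia).
    cbn [gprod]. rewrite (Cpow_S (-1) (S j)).
    assert (N3 := N2 (S n)). assert (N4 := N2 (S j)). assert (G1 := G n). assert (G2 := G j).
    assert (N5 := one_minus_neq0 _ (Cmod_pow_lt_1 x j Hx)).
    field. repeat split; auto.
Qed.

(** The telescoped boundary term [H n n] and the new summand [F (S n) (S n)] have quotient x^(n+1),
    so their sum cancels the denominator 1 + x^(n+1) and is twice the next theta term. *)
Lemma shanks_identity (n : nat) :
  psum (F n) (S n) = 2 * psum (fun s => (-1) ^ s * x ^ (s * s)) (S n) - 1.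
Proof.
  assert (N2 := pow_den_neq0). assert (G := fun k => gprod_neq0 x k Hx).
  induction n as [|n IH].
  - unfold F. simpl. field.
  - change (psum (F (S n)) (S n) + F (S n) (S n) =
      2 * (psum (fun s => (-1) ^ s * x ^ (s * s)) (S n) + (-1) ^ S n * x ^ (S n * S n)) - 1).
    assert (T := shanks_telescope n n).
    replace (psum (fun s => F (S n) s - F n s) (S n)) with (psum (F (S n)) (S n) - psum (F n) (S n)) in T.
    2: { rewrite (psum_ext (fun s => F (S n) s - F n s) (fun s => F (S n) s + (-1) * F n s))
           by (intros; ring).
         rewrite psum_plus, psum_scal. ring. }
    replace (psum (F (S n)) (S n)) with (H n n + psum (F n) (S n)) by (rewrite <- T; ring).
    rewrite IH. unfold F, H.
    replace (x ^ (S n * S (S n))) with (x ^ (S n * S n) * x ^ S n)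
      by (rewrite <- Cpow_add_r; f_equal; lia).
    assert (N3 := N2 (S n)). assert (G1 := G n). assert (G2 := G (S n)).
    field. repeat split; auto.
Qed.

End Shanks.

Lemma exp_ge_1_plus (t : R) : (0 <= t)%R -> (1 + t <= exp t)%R.
Proof.
  intros [H|<-]; [now apply Rlt_le, exp_ineq1; lra|]. rewrite exp_0. lra.
Qed.

Section ProductBounds.

Variable r : R.
Hypothesis Hr : (0 < r < 1)%R.

(** Each factor has modulus at most 1 + 2 r^j / (1-r), hence at most the exponential of 2 r^j /
    (1-r) = 2 (r^j - r^(j+1)) / (1-r)^2, and these exponents telescope. *)
Lemma gprod_ratio_bound (x : C) (s k : nat) : (Cmod x <= r)%R ->
  (Cmod (gprod x (s + k) / gprod x s) <= exp (2 / (1 - r) ^ 2 * (r ^ S s - r ^ S (s + k))))%R.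
Proof.
  intros Hx. assert (Hx1 : (Cmod x < 1)%R) by lra.
  assert (G := fun k => gprod_neq0 x k Hx1).
  induction k as [|k IH].
  - rewrite Nat.add_0_r, Rminus_diag, Rmult_0_r, exp_0.
    unfold Cdiv. rewrite Cinv_r, Cmod_1; auto. lra.
  - rewrite Nat.add_succ_r. cbn [gprod]. set (j := S (s + k)) in *.
    assert (Hj := Cmod_pow_le x r j Hx).
    assert (Rj : (0 <= r ^ j <= r)%R).
    { split; [apply pow_le; lra|]. replace r with (r ^ 1)%R at 2 by ring.
      apply pow_antitone; [lra|]. unfold j; lia. }
    assert (A1 := Cmod_1_minus _ _ Hj). assert (A2 := Cmod_1_plus _ _ Hj).
    assert (N : 1 + x ^ j <> 0) by (apply Cmod_gt_0; lra).
    replace (gprod x (s + k) * ((1 - x ^ j) / (1 + x ^ j)) / gprod x s) with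
      (gprod x (s + k) / gprod x s * ((1 - x ^ j) / (1 + x ^ j))) by (field; auto).
    rewrite Cmod_mult.
    replace (2 / (1 - r) ^ 2 * (r ^ S s - r ^ S j))%R with
      (2 / (1 - r) ^ 2 * (r ^ S s - r ^ j) + 2 * r ^ j / (1 - r))%R by (simpl; field; lra).
    rewrite exp_plus. apply Rmult_le_compat; auto using Cmod_ge_0.
    apply Rle_trans with (1 + 2 * r ^ j / (1 - r))%R.
    2: { apply exp_ge_1_plus. apply Rmult_le_pos; [lra|]. apply Rlt_le, Rinv_0_lt_compat; lra. }
    rewrite Cmod_div by auto.
    apply Rmult_le_reg_r with (Cmod (1 + x ^ j)); [lra|].
    unfold Rdiv at 1. rewrite Rmult_assoc, Rinv_l, Rmult_1_r by lra.
    apply Rle_trans with ((1 + 2 * r ^ j / (1 - r)) * (1 - r ^ j))%R.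
    + apply Rle_trans with (1 + r ^ j)%R; [lra|].
      assert (I : (1 <= / (1 - r) * (1 - r ^ j))%R).
      { apply Rmult_le_reg_l with (1 - r)%R; [lra|].
        rewrite <- Rmult_assoc, Rinv_r by lra. lra. }
      unfold Rdiv. nra.
    + apply Rmult_le_compat_l; [|lra].
      assert (0 <= 2 * r ^ j / (1 - r))%R; [|lra].
      apply Rmult_le_pos; [lra|]. apply Rlt_le, Rinv_0_lt_compat; lra.
Qed.

Definition gprod_cst : R := exp (2 / (1 - r) ^ 2).

Lemma gprod_ratio_le_cst (x : C) (n s : nat) : (Cmod x <= r)%R -> (s <= n)%nat ->
  (Cmod (gprod x n / gprod x s) <= gprod_cst)%R.
Proof.
  intros Hx Hsn. replace n with (s + (n - s))%nat by lia.
  eapply Rle_trans; [now apply gprod_ratio_bound|].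
  assert (A := pow_le_1 r (S s) ltac:(lra)). assert (B := pow_le_1 r (S (s + (n - s))) ltac:(lra)).
  assert (P : (0 < 2 / (1 - r) ^ 2)%R) by (apply Rdiv_lt_0_compat; [lra|apply pow_lt; lra]).
  unfold gprod_cst.
  assert (L : (2 / (1 - r) ^ 2 * (r ^ S s - r ^ S (s + (n - s))) <= 2 / (1 - r) ^ 2)%R) by nra.
  destruct L as [L|L]; [now apply Rlt_le, exp_increasing|rewrite L; lra].
Qed.

Lemma gprod_bound (x : C) (n : nat) : (Cmod x <= r)%R -> (Cmod (gprod x n) <= gprod_cst)%R.
Proof.
  intros Hx. assert (B := gprod_ratio_le_cst x n 0 Hx (Nat.le_0_l n)). simpl in B.
  replace (gprod x n / 1) with (gprod x n) in B by field. exact B.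
Qed.

(** Uniformity over the disc of radius r is what later allows the product to be differentiated in
    [dphi_neg_lambert]. *)
Lemma gprod_approx : exists K s : R, (0 <= K)%R /\ (0 < s < 1)%R /\
  forall x n, (Cmod x <= r)%R -> (Cmod (gprod x n - phi (- x)) <= K * s ^ n)%R.
Proof.
  destruct (poly_geom_bound 1 r) as [K [s [HK [Hs HKs]]]]; [lra|].
  set (B := (gprod_cst * (2 / (1 - r)))%R).
  assert (HB : (0 <= B)%R).
  { unfold B, gprod_cst. apply Rmult_le_pos; [apply Rlt_le, exp_pos|].
    apply Rmult_le_pos; [lra|]. apply Rlt_le, Rinv_0_lt_compat; lra. }
  exists (B * K + 2 * (1 / (1 - r)) * K)%R, s.
  assert (HI : (0 <= 2 * (1 / (1 - r)))%R).
  { apply Rmult_le_pos; [lra|]. apply Rmult_le_pos; [lra|]. apply Rlt_le, Rinv_0_lt_compat; lra. }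
  split; [|split; auto]. { apply Rplus_le_le_0_compat; apply Rmult_le_pos; auto. }
  intros x n Hx. assert (Hx1 : (Cmod x < 1)%R) by lra.
  assert (I := shanks_identity x Hx1 n). rewrite psum_shift in I. cbv beta in I.
  (* The error: all Shanks terms except s = 0. There are n of them, each at most B r^n. *)
  set (E := psum (fun k => (-1) ^ S k * (gprod x n / gprod x (S k)) * x ^ (S k * S n) * (2 / (1 + x ^ S k))) n) in I.
  assert (HE : (Cmod E <= B * ((INR n + 1) * r ^ n))%R).
  { apply Rle_trans with (INR n * (B * r ^ n))%R.
    - unfold E. apply psum_Cmod_le. intros k Hk. rewrite !Cmod_mult, (Cmod_div 2).
      2: { apply one_plus_neq0. now apply Cmod_pow_lt_1. }
      rewrite (Cmod_pow (-1)), !Cmod_R.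
      replace (Rabs (-1)) with 1%R by (rewrite Rabs_left; lra).
      rewrite pow1, Rmult_1_l, (Rabs_right 2) by lra.
      replace (B * r ^ n)%R with (gprod_cst * (r ^ n * (2 / (1 - r))))%R by (unfold B; ring).
      rewrite Rmult_assoc.
      assert (Rk : (0 <= r ^ S k <= r)%R).
      { split; [apply pow_le; lra|]. replace r with (r ^ 1)%R at 2 by ring. apply pow_antitone; [lra|lia]. }
      assert (A2 := Cmod_1_plus _ _ (Cmod_pow_le x r (S k) Hx)).
      apply Rmult_le_compat; auto using Cmod_ge_0.
      + apply Rmult_le_pos; [apply Cmod_ge_0|]. apply Rmult_le_pos; [lra|]. apply Rlt_le, Rinv_0_lt_compat; lra.
      + apply gprod_ratio_le_cst; auto.
      + apply Rmult_le_compat; auto using Cmod_ge_0.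
        * apply Rmult_le_pos; [lra|]. apply Rlt_le, Rinv_0_lt_compat; lra.
        * eapply Rle_trans; [apply Cmod_pow_le, Hx|]. apply pow_antitone; [lra|]. nia.
        * apply Rmult_le_compat_l; [lra|]. apply Rinv_le_contravar; lra.
    - assert (P := pos_INR n). assert (Q := pow_le_1 r n ltac:(lra)). assert (0 <= B * r ^ n)%R by nra. nra. }
  set (sg := fun s => (-1) ^ s * x ^ (s * s)) in *.
  assert (HS : (Cmod (2 * psum sg (S n) - 1 - phi (- x)) <= 2 * (1 / (1 - r)) * r ^ n)%R).
  { rewrite (psum_ext sg (fun s => (- x) ^ (s * s))) by (intros; unfold sg; now rewrite neg_pow_square).
    unfold phi.
    replace (2 * psum (fun s => (- x) ^ (s * s)) (S n) - 1 - (2 * csum (fun n => (- x) ^ (n * n)) - 1)) with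
      (- (2 * (csum (fun n => (- x) ^ (n * n)) - psum (fun s => (- x) ^ (s * s)) (S n)))) by ring.
    rewrite Cmod_opp, Cmod_mult, Cmod_R, Rabs_right, Rmult_assoc by lra. apply Rmult_le_compat_l; [lra|].
    eapply Rle_trans; [apply (csum_tail_geom _ 1 r)|].
    - lra.
    - intros k. apply phi_term_bound. rewrite Cmod_opp. lra.
    - apply Rmult_le_compat_l; [lra|]. apply pow_antitone; [lra|lia]. }
  replace (gprod x n - phi (- x)) with
    (- E + (2 * psum sg (S n) - 1 - phi (- x))).
  2: { rewrite <- I. simpl. field. }
  eapply Rle_trans; [apply Cmod_triangle|]. rewrite Cmod_opp, Rmult_plus_distr_r.
  specialize (HKs n). simpl in HKs. rewrite Rmult_1_r in HKs.
  apply Rplus_le_compat.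
  - eapply Rle_trans; [exact HE|]. rewrite Rmult_assoc. now apply Rmult_le_compat_l.
  - eapply Rle_trans; [exact HS|]. rewrite (Rmult_assoc _ K). apply Rmult_le_compat_l; auto.
    eapply Rle_trans; [|exact HKs].
    assert (P := pos_INR n). assert (Q := pow_le_1 r n ltac:(lra)). nra.
Qed.

End ProductBounds.

Lemma gprod_Clim (x : C) : (Cmod x < 1)%R -> Clim (gprod x) (phi (- x)).
Proof.
  intros Hx. destruct (exists_between x Hx) as [r [Hr Hxr]].
  destruct (gprod_approx r Hr) as [K [s [HK [Hs H]]]].
  apply Clim_squeeze with (fun n => K * s ^ n)%R.
  - intros n. apply H. lra.
  - apply geom_lim0. lra.
Qed.

(** Odd-exponent factors at x and at -x are inverse to each other; even-exponent factors coincide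
    and are the factors of the product at x^2. *)
Lemma gprod_duplication (x : C) (n : nat) : (Cmod x < 1)%R ->
  gprod x (2 * n) * gprod (- x) (2 * n) = gprod (x * x) n ^ 2.
Proof.
  intros Hx. induction n as [|n IH]; [simpl; ring|].
  replace (2 * S n)%nat with (S (S (2 * n))) by lia. cbn [gprod].
  assert (E1 : (- x) ^ S (2 * n) = - x ^ S (2 * n)).
  { replace (- x) with ((-1) * x) by ring. rewrite Cpow_mult_l.
    replace (S (2 * n)) with (2 * n + 1)%nat by lia. rewrite neg1_pow_odd. ring. }
  assert (E2 : (- x) ^ S (S (2 * n)) = x ^ S (S (2 * n))).
  { rewrite Cpow_S, E1, (Cpow_S x (S (2 * n))). ring. }
  assert (E3 : (x * x) ^ S n = x ^ S (S (2 * n))).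
  { replace (x * x) with (x ^ 2) by ring. rewrite <- Cpow_mult_r. f_equal. lia. }
  rewrite E1, E2, E3.
  assert (A1 := one_plus_neq0 _ (Cmod_pow_lt_1 x (2 * n) Hx)).
  assert (A2 := one_minus_neq0 _ (Cmod_pow_lt_1 x (2 * n) Hx)).
  assert (A3 := one_plus_neq0 _ (Cmod_pow_lt_1 x (S (2 * n)) Hx)).
  set (a := x ^ S (2 * n)) in *. set (b := x ^ S (S (2 * n))) in *.
  replace (gprod x (2 * n) * ((1 - a) / (1 + a)) * ((1 - b) / (1 + b)) *
     (gprod (- x) (2 * n) * ((1 - - a) / (1 + - a)) * ((1 - b) / (1 + b)))) with
    (gprod x (2 * n) * gprod (- x) (2 * n) * ((1 - b) / (1 + b)) ^ 2).
  - rewrite IH. ring.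
  - field. repeat split; auto.
Qed.

Lemma Cmod_sq_lt_1 (x : C) : (Cmod x < 1)%R -> (Cmod (x * x) < 1)%R.
Proof. intros H. rewrite Cmod_mult. assert (P := Cmod_ge_0 x). nra. Qed.

Lemma Cmod_opp_lt_1 (x : C) : (Cmod x < 1)%R -> (Cmod (- x) < 1)%R.
Proof. now rewrite Cmod_opp. Qed.

#[local] Hint Resolve Cmod_sq_lt_1 Cmod_opp_lt_1 : disc.

Lemma phi_mul_neg (x : C) : (Cmod x < 1)%R -> phi x * phi (- x) = phi (- (x * x)) ^ 2.
Proof.
  intros Hx.
  apply Clim_unique with (fun n => gprod (- x) (2 * n) * gprod x (2 * n)).
  - apply Clim_mult.
    + apply (Clim_subseq (gprod (- x)) _ (fun n => 2 * n)%nat); [lia|].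
      replace x with (- - x) at 2 by ring. apply gprod_Clim. auto with disc.
    + apply (Clim_subseq (gprod x) _ (fun n => 2 * n)%nat); [lia|]. now apply gprod_Clim.
  - apply Clim_ext with (fun n => gprod (x * x) n * gprod (x * x) n).
    { intros n. rewrite (Cmult_comm (gprod (- x) _)), gprod_duplication by auto. ring. }
    replace (phi (- (x * x)) ^ 2) with (phi (- (x * x)) * phi (- (x * x))) by ring.
    apply Clim_mult; apply gprod_Clim; auto with disc.
Qed.

(** Half of the odd part of [phi]; at [nome4 t] it is half of [theta2 t]. *)
Definition odd_squares (x : C) : C := csum (fun n => x ^ ((2 * n + 1) * (2 * n + 1))).

Lemma odd_squares_Clim (x : C) : (Cmod x < 1)%R ->
  Clim (psum (fun n => x ^ ((2 * n + 1) * (2 * n + 1)))) (odd_squares x).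
Proof.
  intros Hx. assert (P := Cmod_ge_0 x). apply csum_Clim_geom with 1%R (Cmod x); [lra|].
  intros n. rewrite Cmod_pow, Rmult_1_l. apply pow_antitone; [lra|nia].
Qed.

(** Even indices 2k give (x^4)^(k^2); the odd ones, counted with both signs, give the second
    summand. *)
Lemma phi_split (x : C) : (Cmod x < 1)%R -> phi x = phi (x ^ 4) + 2 * odd_squares x.
Proof.
  intros Hx. assert (P := Cmod_ge_0 x). unfold phi.
  rewrite (csum_even_odd (fun n => x ^ (n * n)) (fun n => 1 * Cmod x ^ n)%R
             (csum (fun n => (x ^ 4) ^ (n * n))) (odd_squares x)).
  - ring.
  - intros n. apply phi_term_bound. lra.
  - apply ex_series_geom_scal. lra.
  - apply Clim_ext with (psum (fun n => (x ^ 4) ^ (n * n))).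
    { intros n. apply psum_ext. intros k _. rewrite <- Cpow_mult_r. f_equal. lia. }
    assert (X := Cmod_pow_lt_1 x 3 Hx). assert (Y := Cmod_ge_0 (x ^ 4)).
    apply csum_Clim_geom with 1%R (Cmod (x ^ 4)); [lra|].
    intros n. apply phi_term_bound. lra.
  - now apply odd_squares_Clim.
Qed.

Lemma odd_squares_opp (x : C) : (Cmod x < 1)%R -> odd_squares (- x) = - odd_squares x.
Proof.
  intros Hx. apply csum_unique.
  replace (- odd_squares x) with ((-1) * odd_squares x) by ring.
  eapply Clim_ext; [|apply Clim_scal, odd_squares_Clim, Hx].
  intros n. cbv beta. rewrite <- psum_scal. apply psum_ext. intros k _.
  rewrite neg_pow_square, neg1_pow_odd. reflexivity.
Qed.

Lemma phi_split_neg (x : C) : (Cmod x < 1)%R -> phi (- x) = phi (x ^ 4) - 2 * odd_squares x.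
Proof.
  intros Hx. rewrite phi_split by auto with disc. rewrite odd_squares_opp by auto.
  replace ((- x) ^ 4) with (x ^ 4) by ring. ring.
Qed.

Lemma phi_add_neg (x : C) : (Cmod x < 1)%R -> phi x + phi (- x) = 2 * phi (x ^ 4).
Proof. intros Hx. rewrite phi_split_neg, phi_split by auto. ring. Qed.

(** * Functional equations under squaring *)

Lemma pow2_S (x : C) (n : nat) : x ^ (2 ^ S n) = x ^ (2 ^ n) * x ^ (2 ^ n).
Proof. rewrite <- Cpow_add_r. f_equal. simpl. lia. Qed.

(** The factor 4^n is the loss accumulated over n squarings in [squaring_zero]. It is the square of
    2^n, so a quadratic-times-geometric bound at the index 2^n suffices. *)
Lemma pow2_lim0 (r : R) : (0 <= r < 1)%R -> is_lim_seq (fun n => 4 ^ n * r ^ (2 ^ n))%R 0.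
Proof.
  intros Hr. destruct (poly_geom_bound 2 r Hr) as [K [s [HK [Hs H]]]].
  apply is_lim_seq_le_le with (fun _ => 0%R) (fun n => K * s ^ n)%R.
  - intros n. assert (P : (0 <= r ^ (2 ^ n))%R) by (apply pow_le; lra). split.
    + apply Rmult_le_pos; auto. apply pow_le; lra.
    + apply Rle_trans with (K * s ^ (2 ^ n))%R.
      * eapply Rle_trans; [|apply H]. apply Rmult_le_compat_r; auto.
        replace 4%R with (2 * 2)%R by ring. rewrite Rpow_mult_distr, pow_INR.
        change (INR 2) with (1 + 1)%R. replace (1 + 1)%R with 2%R by ring.
        assert (Q : (0 <= 2 ^ n)%R) by (apply pow_le; lra). simpl. nra.
      * apply Rmult_le_compat_l; auto. apply pow_antitone; [lra|]. apply Nat.lt_le_incl, Nat.pow_gt_lin_r. lia.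
  - apply is_lim_seq_const.
  - apply geom_lim0; lra.
Qed.

Lemma pow2_small (x : C) (d : R) : (Cmod x < 1)%R -> (0 < d)%R -> exists n, (Cmod (x ^ (2 ^ n)) < d)%R.
Proof.
  intros Hx Hd. assert (P := Cmod_ge_0 x).
  assert (L := pow2_lim0 (Cmod x) ltac:(lra)).
  apply is_lim_seq_spec in L. destruct (L (mkposreal d Hd)) as [N HN].
  exists N. specialize (HN N (le_n N)). simpl in HN. rewrite Rminus_0_r in HN.
  rewrite Cmod_pow. assert (Q : (0 <= Cmod x ^ (2 ^ N))%R) by (apply pow_le; lra).
  assert (Q4 : (1 <= 4 ^ N)%R) by (apply pow_R1_Rle; lra).
  rewrite Rabs_right in HN by nra. nra.
Qed.

(** A property inherited by squares reaches every punctured neighbourhood of 0. It is applied to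
    properties that fail there, and so refutes them on the whole disc. *)
Lemma squaring_descent (Q : C -> Prop) (x : C) (d : R) :
  (forall y : C, y <> 0 -> (Cmod y < 1)%R -> Q y -> Q (y * y)) ->
  x <> 0 -> (Cmod x < 1)%R -> (0 < d)%R -> Q x ->
  exists y : C, y <> 0 /\ (Cmod y < 1)%R /\ (Cmod y < d)%R /\ Q y.
Proof.
  intros HQ Hx0 Hx Hd Qx. destruct (pow2_small x d Hx Hd) as [n Hn].
  exists (x ^ (2 ^ n)).
  assert (A : forall n, x ^ (2 ^ n) <> 0 /\ (Cmod (x ^ (2 ^ n)) < 1)%R /\ Q (x ^ (2 ^ n))).
  { clear n Hn. induction n as [|n [H1 [H2 H3]]].
    - replace (x ^ (2 ^ 0)) with x by (simpl; ring). auto.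
    - rewrite pow2_S. repeat split; auto using Cmod_sq_lt_1, Cmult_neq_0. }
  destruct (A n) as [A1 [A2 A3]]. auto.
Qed.

Definition small_at_0 (f : C -> C) : Prop :=
  exists K d : R, (0 < d)%R /\ forall x, (Cmod x < d)%R -> (Cmod (f x) <= K * Cmod x)%R.

Lemma cderiv_small_at_0 (f : C -> C) (l : C) : cderiv f 0 l -> f 0 = 0 -> small_at_0 f.
Proof.
  intros H H0. destruct (proj1 (cderiv_iff _ _ _) H 1%R Rlt_0_1) as [d [Hd Hb]].
  exists (1 + Cmod l)%R, d. split; auto. intros x Hx.
  specialize (Hb x). replace (x - 0) with x in Hb by ring. specialize (Hb Hx). rewrite H0 in Hb.
  replace (f x) with ((f x - 0 - x * l) + x * l) by ring.
  eapply Rle_trans; [apply Cmod_triangle|]. rewrite Cmod_mult. lra.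
Qed.

(** Iteration gives |f x| <= 4^n K |x|^(2^n). The constant 4 is exactly the multiplier met in
    [efun_ode]. *)
Lemma squaring_zero (f : C -> C) :
  (forall x, (Cmod x < 1)%R -> (Cmod (f x) <= 4 * Cmod (f (x * x)%C))%R) ->
  small_at_0 f -> forall x, (Cmod x < 1)%R -> f x = 0.
Proof.
  intros Hf [K [d [Hd Hb]]] x Hx. assert (P := Cmod_ge_0 x).
  assert (A : forall n, (Cmod (x ^ (2 ^ n)) < 1)%R).
  { induction n as [|n IH]; [replace (x ^ (2 ^ 0)) with x by (simpl; ring); auto|].
    rewrite pow2_S. auto using Cmod_sq_lt_1. }
  assert (B : forall n, (Cmod (f x) <= 4 ^ n * Cmod (f (x ^ (2 ^ n))%C))%R).
  { induction n as [|n IH]; [replace (x ^ (2 ^ 0)) with x by (simpl; ring); simpl; lra|].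
    rewrite pow2_S. specialize (Hf _ (A n)). eapply Rle_trans; [exact IH|].
    simpl. rewrite (Rmult_comm 4), Rmult_assoc. apply Rmult_le_compat_l; auto. apply pow_le; lra. }
  apply Cmod_eq_0, Rle_antisym; [|apply Cmod_ge_0].
  assert (L := is_lim_seq_scal0 K _ (pow2_lim0 (Cmod x) ltac:(lra))).
  assert (X := is_lim_seq_le_loc (fun _ => Cmod (f x)) (fun n => K * (4 ^ n * Cmod x ^ (2 ^ n)))%R (Cmod (f x)) 0).
  apply X; auto using is_lim_seq_const.
  destruct (pow2_small x d Hx Hd) as [N HN]. exists N. intros n Hn.
  eapply Rle_trans; [apply B|].
  replace (K * (4 ^ n * Cmod x ^ 2 ^ n))%R with (4 ^ n * (K * Cmod x ^ (2 ^ n)))%R by ring.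
  apply Rmult_le_compat_l; [apply pow_le; lra|]. rewrite <- Cmod_pow. apply Hb.
  eapply Rle_lt_trans; [|exact HN]. rewrite !Cmod_pow. apply pow_antitone; [lra|].
  apply Nat.pow_le_mono_r; lia.
Qed.

Lemma cderiv_phi_neg (x : C) : (Cmod x < 1)%R -> cderiv (fun y => phi (- y)) x (- dphi (- x)).
Proof.
  intros Hx. eapply cderiv_eq; [|apply (cderiv_comp (fun y => - y) phi x (- (1)) (dphi (- x)))].
  - ring.
  - apply cderiv_opp, cderiv_id.
  - apply cderiv_phi. auto with disc.
Qed.

Lemma cderiv_sq (x : C) : cderiv (fun y => y * y) x (2 * x).
Proof.
  eapply cderiv_eq; [|apply (cderiv_mult _ _ x _ _ (cderiv_id x) (cderiv_id x))]. simpl; ring.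
Qed.

Lemma cderiv_comp_sq (f : C -> C) (x l : C) : cderiv f (x * x) l -> cderiv (fun y => f (y * y)) x (2 * x * l).
Proof. intros H. apply (cderiv_comp (fun y => y * y) f x); auto using cderiv_sq. Qed.

Lemma cderiv_mult_eq (f g : C -> C) (z l m k : C) :
  cderiv f z l -> cderiv g z m -> l * g z + f z * m = k -> cderiv (fun x => f x * g x) z k.
Proof. intros Hf Hg <-. now apply cderiv_mult. Qed.

Lemma phi_sq_add_neg (x : C) : (Cmod x < 1)%R -> phi x ^ 2 + phi (- x) ^ 2 = 2 * phi (x * x) ^ 2.
Proof.
  intros Hx. set (E := fun x => phi x ^ 2 + phi (- x) ^ 2 - 2 * phi (x * x) ^ 2).
  enough (E x = 0) by (apply Ceq_minus; exact H).
  (* Expand the sum of squares as (sum)^2 - 2 (product) and insert the two known identities, which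
     live at y^4 and at -y^2. *)
  assert (FE : forall y, (Cmod y < 1)%R -> E y = (-2) * E (y * y)).
  { intros y Hy. unfold E.
    assert (A1 := phi_add_neg y Hy). assert (A2 := phi_mul_neg y Hy).
    replace (phi y ^ 2 + phi (- y) ^ 2) with ((phi y + phi (- y)) ^ 2 - 2 * (phi y * phi (- y))) by ring.
    rewrite A1, A2. replace (y * y * (y * y)) with (y ^ 4) by ring. ring. }
  apply squaring_zero; auto.
  - intros y Hy. rewrite (FE y Hy) at 1. rewrite Cmod_mult, Cmod_R, Rabs_left by lra.
    assert (P := Cmod_ge_0 (E (y * y))). lra.
  - assert (D0 : (Cmod 0 < 1)%R) by (rewrite Cmod_0; lra).
    assert (D0' : (Cmod (0 * 0) < 1)%R) by (rewrite Cmult_0_l; auto).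
    eapply cderiv_small_at_0.
    + unfold E. apply cderiv_minus; [apply cderiv_plus|apply cderiv_mult].
      * apply cderiv_pow, cderiv_phi; auto.
      * apply (cderiv_pow (fun y => phi (- y))), cderiv_phi_neg; auto.
      * apply cderiv_const.
      * apply (cderiv_pow (fun y => phi (y * y))), cderiv_comp_sq, cderiv_phi; auto.
    + unfold E. replace (- 0) with (RtoC 0) by ring. rewrite Cmult_0_l, phi_0. ring.
Qed.

Lemma near_1_neq0 (f : C -> C) : ccont f 0 -> f 0 = 1 ->
  exists d : R, (0 < d)%R /\ forall y, (Cmod y < d)%R -> f y <> 0.
Proof.
  intros H H0. destruct (H 1%R Rlt_0_1) as [d [Hd Hb]]. exists d. split; auto.
  intros y Hy E. specialize (Hb y). rewrite E, H0 in Hb. replace (y - 0) with y in Hb by ring.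
  specialize (Hb Hy). replace (0 - 1) with (- (1)) in Hb by ring. rewrite Cmod_opp, Cmod_1 in Hb. lra.
Qed.

Lemma Cmult_integral (x y : C) : x * y = 0 -> x = 0 \/ y = 0.
Proof.
  intros H. destruct (Ceq_dec x 0); auto. destruct (Ceq_dec y 0); auto.
  exfalso. now apply (Cmult_neq_0 x y).
Qed.

(** By [phi_mul_neg], a zero of phi (- y) forces one of phi (- y^2). Zeros would thus accumulate at
    0, where the value is 1. *)
Lemma phi_neq0 (x : C) : (Cmod x < 1)%R -> phi x <> 0.
Proof.
  intros Hx Z. destruct (Ceq_dec x 0) as [->|Hx0].
  { rewrite phi_0 in Z. now apply C1_nz. }
  assert (D0 : (Cmod 0 < 1)%R) by (rewrite Cmod_0; lra).
  destruct (near_1_neq0 (fun y => phi (- y))) as [d [Hd Hb]].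
  { eapply cderiv_ccont, cderiv_phi_neg, D0. }
  { replace (- 0) with (RtoC 0) by ring. apply phi_0. }
  destruct (squaring_descent (fun y => phi (- y) = 0) (- x) d) as [y [_ [_ [Hy Zy]]]]; auto with disc.
  - intros y _ Hy1 E. assert (A := phi_mul_neg y Hy1). rewrite E in A.
    destruct (Cmult_integral (phi (- (y * y))) (phi (- (y * y)))); auto.
    transitivity (phi y * 0); [rewrite A|]; ring.
  - intros E. apply Hx0. replace x with (- - x) by ring. rewrite E. ring.
  - replace (- - x) with x by ring. auto.
  - now apply (Hb y).
Qed.

Lemma phi_neg_neq0 (x : C) : (Cmod x < 1)%R -> phi (- x) <> 0.
Proof. intros Hx. apply phi_neq0. auto with disc. Qed.

Lemma phi_add_neg_neq0 (x : C) : (Cmod x < 1)%R -> phi x + phi (- x) <> 0.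
Proof.
  intros Hx. rewrite phi_add_neg by auto. apply Cmult_neq_0; [apply IZR_C_neq0; lia|].
  apply phi_neq0. now apply Cmod_pow_lt_1.
Qed.

Lemma phi_sq_add_neg_neq0 (x : C) : (Cmod x < 1)%R -> phi x ^ 2 + phi (- x) ^ 2 <> 0.
Proof.
  intros Hx. rewrite phi_sq_add_neg by auto. apply Cmult_neq_0; [apply IZR_C_neq0; lia|].
  apply Cpow_nz, phi_neq0. auto with disc.
Qed.

Lemma cderiv_0_lower (f : C -> C) (l : C) : cderiv f 0 l -> f 0 = 0 -> l <> 0 ->
  exists d : R, (0 < d)%R /\ forall y, (Cmod y < d)%R -> (Cmod l / 2 * Cmod y <= Cmod (f y))%R.
Proof.
  intros H H0 Hl. assert (P := proj1 (Cmod_gt_0 l) Hl).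
  destruct (proj1 (cderiv_iff _ _ _) H (Cmod l / 2)%R) as [d [Hd Hb]]; [lra|].
  exists d. split; auto. intros y Hy. specialize (Hb y).
  replace (y - 0) with y in Hb by ring. specialize (Hb Hy). rewrite H0 in Hb.
  assert (T := Cmod_triangle_inv (y * l) (f y - 0 - y * l)).
  replace (y * l + (f y - 0 - y * l)) with (f y) in T by ring. rewrite Cmod_mult in T. lra.
Qed.

Lemma cderiv_phi_diff_0 : cderiv (fun y => phi y - phi (- y)) 0 4.
Proof.
  assert (D0 : (Cmod 0 < 1)%R) by (rewrite Cmod_0; lra).
  eapply cderiv_eq; [|apply (cderiv_minus _ _ _ _ _ (cderiv_phi 0 D0) (cderiv_phi_neg 0 D0))].
  replace (- 0) with (RtoC 0) by ring. rewrite dphi_0. ring.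
Qed.

(** The difference of the squares at y^2 factors, and the factor phi + phi (-) never vanishes, so
    equality passes from y to y^2; but near 0 the difference behaves like 4 y. At [nome4 t] this
    shows that [theta2] has no zeros. *)
Lemma phi_neq_neg (x : C) : x <> 0 -> (Cmod x < 1)%R -> phi x - phi (- x) <> 0.
Proof.
  intros Hx0 Hx Z.
  destruct (cderiv_0_lower _ _ cderiv_phi_diff_0) as [d [Hd Hb]].
  { replace (- 0) with (RtoC 0) by ring. ring. }
  { apply IZR_C_neq0; lia. }
  destruct (squaring_descent (fun y => phi y - phi (- y) = 0) x d) as [y [Hy0 [_ [Hy Zy]]]]; auto.
  - intros y _ Hy1 E. assert (Hyy := Cmod_sq_lt_1 y Hy1).
    destruct (Cmult_integral (phi (y * y) - phi (- (y * y))) (phi (y * y) + phi (- (y * y)))) as [|E2]; auto.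
    + replace ((phi (y * y) - phi (- (y * y))) * (phi (y * y) + phi (- (y * y)))) with
        (phi (y * y) ^ 2 - phi (- (y * y)) ^ 2) by ring.
      rewrite <- phi_mul_neg by auto.
      replace (phi (y * y) ^ 2) with ((phi y ^ 2 + phi (- y) ^ 2) / 2)
        by (rewrite phi_sq_add_neg by auto; field).
      replace (phi y) with (phi (- y)); [field|]. symmetry. now apply Ceq_minus.
    + now apply phi_add_neg_neq0 in E2.
  - specialize (Hb y Hy). rewrite Zy, Cmod_0, Cmod_R, Rabs_right in Hb by lra.
    apply Cmod_gt_0 in Hy0. lra.
Qed.

(** * Logarithmic derivatives *)

(** The derivation x d/dx, which is d/dt divided by i pi when x is the nome of t, applied to log
    phi(x); [dlog_neg] does the same for log phi(-x). *)
Definition dlog (x : C) : C := x * dphi x / phi x.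
Definition dlog_neg (x : C) : C := - (x * dphi (- x) / phi (- x)).

(** The identity [phi_mul_neg] holds on a whole disc around x, so both sides have the same
    derivative there; [dphi_sq_add_neg] comes from [phi_sq_add_neg] likewise. *)
Lemma dphi_mul_neg (x : C) : (Cmod x < 1)%R ->
  dphi x * phi (- x) - phi x * dphi (- x) = - (4 * x * phi (- (x * x)) * dphi (- (x * x))).
Proof.
  intros Hx.
  apply (cderiv_unique (fun y => phi y * phi (- y)) x).
  - eapply cderiv_mult_eq; [now apply cderiv_phi|now apply cderiv_phi_neg|ring].
  - assert (D := cderiv_comp_sq (fun y => phi (- y)) x _ (cderiv_phi_neg (x * x) (Cmod_sq_lt_1 x Hx))).
    apply (cderiv_pow _ _ _ 2) in D. cbv beta in D.
    apply (cderiv_ext_loc (fun y => phi (- (y * y)) ^ 2) _ x _ (1 - Cmod x)); [lra| |].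
    + intros y Hy. symmetry. apply phi_mul_neg.
      replace y with (x + (y - x)) by ring. eapply Rle_lt_trans; [apply Cmod_triangle|]. lra.
    + eapply cderiv_eq; [|exact D]. rewrite INR_IZR_INZ. simpl. ring.
Qed.

Lemma dphi_sq_add_neg (x : C) : (Cmod x < 1)%R ->
  phi x * dphi x - phi (- x) * dphi (- x) = 4 * x * phi (x * x) * dphi (x * x).
Proof.
  intros Hx.
  enough (E : INR 2 * dphi x * phi x ^ 1 + INR 2 * - dphi (- x) * phi (- x) ^ 1 =
              0 * phi (x * x) ^ 2 + 2 * (INR 2 * (2 * x * dphi (x * x)) * phi (x * x) ^ 1)).
  { rewrite !INR_IZR_INZ in E. simpl Z.of_nat in E.
    replace (phi x * dphi x - phi (- x) * dphi (- x)) with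
      ((2 * dphi x * phi x ^ 1 + 2 * - dphi (- x) * phi (- x) ^ 1) / 2) by field.
    rewrite E. field. }
  apply (cderiv_unique (fun y => phi y ^ 2 + phi (- y) ^ 2) x).
  - apply cderiv_plus; [apply (cderiv_pow _ _ _ 2), cderiv_phi; auto|].
    apply (cderiv_pow (fun y => phi (- y)) _ _ 2), cderiv_phi_neg; auto.
  - apply (cderiv_ext_loc (fun y => 2 * phi (y * y) ^ 2) _ x _ (1 - Cmod x)); [lra| |].
    + intros y Hy. symmetry. apply phi_sq_add_neg.
      replace y with (x + (y - x)) by ring. eapply Rle_lt_trans; [apply Cmod_triangle|]. lra.
    + apply (cderiv_mult (fun _ => RtoC 2) (fun y => phi (y * y) ^ 2)); [apply cderiv_const|].
      apply (cderiv_pow (fun y => phi (y * y)) _ _ 2), cderiv_comp_sq, cderiv_phi. auto with disc.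
Qed.

Lemma dlog_sq (x : C) : (Cmod x < 1)%R ->
  dlog (x * x) = (phi x ^ 2 * dlog x + phi (- x) ^ 2 * dlog_neg x) / (2 * (phi x ^ 2 + phi (- x) ^ 2)).
Proof.
  intros Hx. assert (N1 := phi_neq0 x Hx). assert (N2 := phi_neg_neq0 x Hx).
  assert (N3 := phi_sq_add_neg_neq0 x Hx). assert (N4 := phi_neq0 _ (Cmod_sq_lt_1 x Hx)).
  assert (E1 := dphi_sq_add_neg x Hx). assert (E2 := phi_sq_add_neg x Hx).
  unfold dlog, dlog_neg.
  transitivity (x * (4 * x * phi (x * x) * dphi (x * x)) / (2 * (2 * phi (x * x) ^ 2))).
  { field. auto. }
  rewrite <- E1, <- E2. field. repeat split; auto.
Qed.

Lemma dlog_neg_sq (x : C) : (Cmod x < 1)%R -> dlog_neg (x * x) = (dlog x + dlog_neg x) / 4.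
Proof.
  intros Hx. assert (N1 := phi_neq0 x Hx). assert (N2 := phi_neg_neq0 x Hx).
  assert (N4 := phi_neg_neq0 _ (Cmod_sq_lt_1 x Hx)).
  assert (E1 := dphi_mul_neg x Hx). assert (E2 := phi_mul_neg x Hx).
  unfold dlog, dlog_neg.
  transitivity (x * - (4 * x * phi (- (x * x)) * dphi (- (x * x))) / (4 * phi (- (x * x)) ^ 2)).
  { field. auto. }
  rewrite <- E1, <- E2. field. repeat split; auto.
Qed.

Lemma cderiv_dphi_neg (x : C) : (Cmod x < 1)%R -> cderiv (fun y => dphi (- y)) x (- d2phi (- x)).
Proof.
  intros Hx. eapply cderiv_eq; [|apply (cderiv_comp (fun y => - y) dphi x (- (1)) (d2phi (- x)))].
  - ring.
  - apply cderiv_opp, cderiv_id.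
  - apply cderiv_dphi. auto with disc.
Qed.

Lemma cderiv_dlog (x : C) : (Cmod x < 1)%R ->
  cderiv dlog x ((dphi x + x * d2phi x) / phi x - x * dphi x ^ 2 / phi x ^ 2).
Proof.
  intros Hx. assert (N1 := phi_neq0 x Hx).
  eapply cderiv_eq; [|apply (cderiv_div (fun y => y * dphi y) phi x)]; auto.
  2: apply cderiv_mult; [apply cderiv_id|now apply cderiv_dphi].
  2: now apply cderiv_phi.
  cbv beta. field. auto.
Qed.

Lemma cderiv_dlog_neg (x : C) : (Cmod x < 1)%R ->
  cderiv dlog_neg x (- ((dphi (- x) - x * d2phi (- x)) / phi (- x) + x * dphi (- x) ^ 2 / phi (- x) ^ 2)).
Proof.
  intros Hx. assert (N1 := phi_neg_neq0 x Hx).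
  eapply cderiv_eq; [|apply cderiv_opp, (cderiv_div (fun y => y * dphi (- y)) (fun y => phi (- y)) x)]; auto.
  2: apply cderiv_mult; [apply cderiv_id|now apply cderiv_dphi_neg].
  2: now apply cderiv_phi_neg.
  cbv beta. field. auto.
Qed.

(** By Jacobi's identity this is a quarter of theta2^4. The name anticipates [dlog_sub]: it is the
    Wronskian of phi (- x) and phi x for x d/dx, divided by their product. *)
Definition wronsk (x : C) : C := (phi x ^ 4 - phi (- x) ^ 4) / 4.

Lemma cderiv_wronsk_0 : cderiv wronsk 0 4.
Proof.
  assert (D0 : (Cmod 0 < 1)%R) by (rewrite Cmod_0; lra).
  assert (D1 := cderiv_pow _ _ _ 4 (cderiv_phi 0 D0)).
  assert (D2 := cderiv_pow (fun y => phi (- y)) _ _ 4 (cderiv_phi_neg 0 D0)).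
  assert (D := cderiv_mult _ _ _ _ _ (cderiv_minus _ _ _ _ _ D1 D2) (cderiv_const (/ 4) 0)).
  eapply cderiv_eq; [|exact D]. cbv beta. replace (- 0) with (RtoC 0) by ring.
  rewrite dphi_0, phi_0. rewrite !INR_IZR_INZ. simpl Z.of_nat.
  simpl Cpow. field.
Qed.

Lemma wronsk_sq (x : C) : (Cmod x < 1)%R -> wronsk (x * x) = (phi x ^ 2 - phi (- x) ^ 2) ^ 2 / 16.
Proof.
  intros Hx. unfold wronsk.
  replace (phi (x * x) ^ 4) with (((phi x ^ 2 + phi (- x) ^ 2) / 2) ^ 2)
    by (rewrite phi_sq_add_neg by auto; field).
  replace (phi (- (x * x)) ^ 4) with ((phi x * phi (- x)) ^ 2)
    by (rewrite phi_mul_neg by auto; ring).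
  field.
Qed.

Lemma wronsk_neq0 (x : C) : x <> 0 -> (Cmod x < 1)%R -> wronsk x <> 0.
Proof.
  intros Hx0 Hx. unfold wronsk.
  replace ((phi x ^ 4 - phi (- x) ^ 4) / 4) with
    (/ 4 * ((phi x - phi (- x)) * ((phi x + phi (- x)) * (phi x ^ 2 + phi (- x) ^ 2)))) by field.
  repeat apply Cmult_neq_0.
  - rewrite <- RtoC_inv by lra. apply RtoC_neq. lra.
  - now apply phi_neq_neg.
  - now apply phi_add_neg_neq0.
  - now apply phi_sq_add_neg_neq0.
Qed.

(* [(dlog - dlog_neg) / wronsk] is invariant under squaring and tends to 1 at 0. *)
Lemma dlog_sub (x : C) : (Cmod x < 1)%R -> dlog x - dlog_neg x = wronsk x.
Proof.
  intros Hx. destruct (Ceq_dec x 0) as [->|Hx0].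
  { unfold dlog, dlog_neg, wronsk. replace (- 0) with (RtoC 0) by ring. rewrite phi_0. field. }
  set (V := fun y => dlog y - dlog_neg y - wronsk y).
  assert (D0 : (Cmod 0 < 1)%R) by (rewrite Cmod_0; lra).
  assert (DV : cderiv V 0 0).
  { eapply cderiv_eq; [|apply cderiv_minus; [apply cderiv_minus|apply cderiv_wronsk_0]].
    2: now apply cderiv_dlog. 2: now apply cderiv_dlog_neg.
    replace (- 0) with (RtoC 0) by ring. rewrite dphi_0, phi_0. field. }
  assert (V0 : V 0 = 0).
  { unfold V, dlog, dlog_neg, wronsk. replace (- 0) with (RtoC 0) by ring. rewrite phi_0. field. }
  destruct (Ceq_dec (V x) 0) as [E|NV]; [now apply Ceq_minus|]. exfalso.
  assert (Wx := wronsk_neq0 x Hx0 Hx).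
  set (k := V x / wronsk x).
  assert (Hk : k <> 0).
  { unfold k. intros E. apply NV. replace (V x) with (V x / wronsk x * wronsk x) by (field; auto).
    rewrite E. ring. }
  apply Cmod_gt_0 in Hk.
  destruct (cderiv_0_lower _ _ cderiv_wronsk_0) as [d1 [Hd1 Hb1]].
  { unfold wronsk. replace (- 0) with (RtoC 0) by ring. field. }
  { apply IZR_C_neq0; lia. }
  (* With tolerance |k|, |V y| <= |k| |y| near 0, whereas |k wronsk y| >= 2 |k| |y|; so V = k wronsk
     cannot persist under squaring. *)
  destruct (proj1 (cderiv_iff _ _ _) DV (Cmod k) Hk) as [d2 [Hd2 Hb2]].
  destruct (squaring_descent (fun y => V y = k * wronsk y) x (Rmin d1 d2)) as [y [Hy0 [_ [Hy Ey]]]]; auto.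
  - intros y Hyn Hy1 E. assert (Wy := wronsk_neq0 y Hyn Hy1).
    assert (N1 := phi_neq0 y Hy1). assert (N2 := phi_neg_neq0 y Hy1).
    assert (N3 := phi_sq_add_neg_neq0 y Hy1).
    unfold V. rewrite dlog_sq, dlog_neg_sq, wronsk_sq by auto.
    assert (E' : dlog y - dlog_neg y = (k + 1) * wronsk y).
    { replace (dlog y - dlog_neg y) with (V y + wronsk y) by (unfold V; ring). rewrite E. ring. }
    transitivity ((dlog y - dlog_neg y) * (phi y ^ 2 - phi (- y) ^ 2) / (4 * (phi y ^ 2 + phi (- y) ^ 2))
        - (phi y ^ 2 - phi (- y) ^ 2) ^ 2 / 16).
    { field. auto. }
    rewrite E'. unfold wronsk. field. auto.
  - now apply Rmin_glb_lt.
  - unfold k. field. auto.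
  - specialize (Hb1 y (Rlt_le_trans _ _ _ Hy (Rmin_l _ _))).
    specialize (Hb2 y). replace (y - 0) with y in Hb2 by ring.
    specialize (Hb2 (Rlt_le_trans _ _ _ Hy (Rmin_r _ _))).
    rewrite V0, Ey in Hb2. replace (k * wronsk y - 0 - y * 0) with (k * wronsk y) in Hb2 by ring.
    rewrite Cmod_mult in Hb2. rewrite Cmod_R, Rabs_right in Hb1 by lra.
    apply Cmod_gt_0 in Hy0.
    assert (X : (Cmod k * (4 / 2 * Cmod y) <= Cmod k * Cmod y)%R).
    { eapply Rle_trans; [|exact Hb2]. apply Rmult_le_compat_l; lra. }
    assert (0 < Cmod k * Cmod y)%R by (apply Rmult_lt_0_compat; auto). lra.
Qed.

(** * The quasimodular function *)

(* [efun] is 12/pi^2 times [eta], as a function of the nome; it is Ramanujan's P. *)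
Definition efun (x : C) : C := 12 * dlog x - phi x ^ 4 + 2 * phi (- x) ^ 4.
Definition defun (x : C) : C :=
  12 * ((dphi x + x * d2phi x) / phi x - x * dphi x ^ 2 / phi x ^ 2)
  - 4 * phi x ^ 3 * dphi x - 8 * phi (- x) ^ 3 * dphi (- x).

Lemma cderiv_efun (x : C) : (Cmod x < 1)%R -> cderiv efun x (defun x).
Proof.
  intros Hx.
  assert (D1 := cderiv_pow _ _ _ 4 (cderiv_phi x Hx)).
  assert (D2 := cderiv_pow (fun y => phi (- y)) _ _ 4 (cderiv_phi_neg x Hx)).
  assert (D3 := cderiv_mult _ _ _ _ _ (cderiv_const 12 x) (cderiv_dlog x Hx)).
  assert (D := cderiv_plus _ _ _ _ _ (cderiv_minus _ _ _ _ _ D3 D1)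
                 (cderiv_mult _ _ _ _ _ (cderiv_const 2 x) D2)).
  eapply cderiv_eq; [|exact D]. cbv beta. unfold defun.
  rewrite !INR_IZR_INZ. simpl Z.of_nat.
  simpl pred. field. now apply phi_neq0.
Qed.

Lemma dlog_neg_eq (x : C) : (Cmod x < 1)%R -> dlog_neg x = dlog x - wronsk x.
Proof. intros Hx. rewrite <- dlog_sub by auto. ring. Qed.

Lemma efun_sq (x : C) : (Cmod x < 1)%R -> efun (x * x) = efun x / 2 + (phi x ^ 4 + phi (- x) ^ 4) / 4.
Proof.
  intros Hx. assert (N3 := phi_sq_add_neg_neq0 x Hx).
  unfold efun. rewrite dlog_sq by auto.
  replace (phi (x * x) ^ 4) with (((phi x ^ 2 + phi (- x) ^ 2) / 2) ^ 2)
    by (rewrite phi_sq_add_neg by auto; field).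
  replace (phi (- (x * x)) ^ 4) with ((phi x * phi (- x)) ^ 2)
    by (rewrite phi_mul_neg by auto; ring).
  rewrite dlog_neg_eq by auto. unfold wronsk. field. auto.
Qed.

(** Isolates the change of [efun] under squaring as a logarithmic derivative, which [dlog_neg_ell]
    also shows to be the change of the Lambert series. *)
Lemma efun_sq_dlog (x : C) : (Cmod x < 1)%R -> efun x = efun (x * x) + 12 * dlog_neg (x * x).
Proof.
  intros Hx. rewrite efun_sq, dlog_neg_sq, dlog_neg_eq by auto. unfold efun, wronsk. field.
Qed.

Lemma defun_sq (x : C) : (Cmod x < 1)%R ->
  2 * x * defun (x * x) = defun x / 2 + (phi x ^ 3 * dphi x - phi (- x) ^ 3 * dphi (- x)).
Proof.
  intros Hx.
  apply (cderiv_unique (fun y => efun (y * y)) x).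
  - apply cderiv_comp_sq, cderiv_efun. auto with disc.
  - apply (cderiv_ext_loc (fun y => efun y / 2 + (phi y ^ 4 + phi (- y) ^ 4) / 4) _ x _ (1 - Cmod x)); [lra| |].
    + intros y Hy. symmetry. apply efun_sq.
      replace y with (x + (y - x)) by ring. eapply Rle_lt_trans; [apply Cmod_triangle|]. lra.
    + assert (D1 := cderiv_pow _ _ _ 4 (cderiv_phi x Hx)).
      assert (D2 := cderiv_pow (fun y => phi (- y)) _ _ 4 (cderiv_phi_neg x Hx)).
      assert (D := cderiv_plus _ _ _ _ _ (cderiv_mult _ _ _ _ _ (cderiv_efun x Hx) (cderiv_const (/ 2) x))
          (cderiv_mult _ _ _ _ _ (cderiv_plus _ _ _ _ _ D1 D2) (cderiv_const (/ 4) x))).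
      eapply cderiv_eq; [|exact D]. cbv beta.
      rewrite !INR_IZR_INZ. simpl Z.of_nat.
      simpl pred. field.
Qed.

Lemma efun_0 : efun 0 = 1.
Proof. unfold efun, dlog. replace (- 0) with (RtoC 0) by ring. rewrite phi_0. field. Qed.

(* Ramanujan's equation: the defect satisfies [f x = 4 f (x^2)] and is O(x) at 0. *)
Lemma efun_ode (x : C) : (Cmod x < 1)%R ->
  x * defun x = (efun x ^ 2 - (phi x ^ 8 - phi x ^ 4 * phi (- x) ^ 4 + phi (- x) ^ 8)) / 6.
Proof.
  intros Hx.
  set (G := fun y => (efun y ^ 2 - (phi y ^ 8 - phi y ^ 4 * phi (- y) ^ 4 + phi (- y) ^ 8)) / 6).
  set (X := fun y => y * defun y - G y).
  enough (X x = 0) by (now apply Ceq_minus).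
  apply squaring_zero; auto.
  - intros y Hy.
    assert (E : X y = 4 * X (y * y)).
    { unfold X, G.
      assert (N1 := phi_neq0 y Hy). assert (N2 := phi_neg_neq0 y Hy).
      replace (y * y * defun (y * y)) with (y / 2 * (2 * y * defun (y * y))) by field.
      rewrite defun_sq, efun_sq by auto.
      replace (phi (y * y) ^ 4) with (((phi y ^ 2 + phi (- y) ^ 2) / 2) ^ 2)
        by (rewrite phi_sq_add_neg by auto; field).
      replace (phi (- (y * y)) ^ 4) with ((phi y * phi (- y)) ^ 2)
        by (rewrite phi_mul_neg by auto; ring).
      replace (phi (y * y) ^ 8) with (((phi y ^ 2 + phi (- y) ^ 2) / 2) ^ 4)
        by (rewrite phi_sq_add_neg by auto; field).
      replace (phi (- (y * y)) ^ 8) with ((phi y * phi (- y)) ^ 4)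
        by (rewrite phi_mul_neg by auto; ring).
      (* Trading y phi' for dlog * phi, and then both logarithmic derivatives for [efun], leaves a
         polynomial identity in phi y, phi (- y), efun y and y defun y. *)
      replace (y / 2 * (defun y / 2 + (phi y ^ 3 * dphi y - phi (- y) ^ 3 * dphi (- y)))) with
        (y * defun y / 4 + (phi y ^ 4 * dlog y + phi (- y) ^ 4 * dlog_neg y) / 2)
        by (unfold dlog, dlog_neg; field; auto).
      rewrite dlog_neg_eq by auto.
      replace (dlog y) with ((efun y + phi y ^ 4 - 2 * phi (- y) ^ 4) / 12) by (unfold efun; field).
      unfold wronsk. field. }
    rewrite E, Cmod_mult, Cmod_R, Rabs_right; lra.
  - assert (D0 : (Cmod 0 < 1)%R) by (rewrite Cmod_0; lra).
    assert (SG : small_at_0 G).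
    { eapply cderiv_small_at_0.
      - unfold G. apply (cderiv_mult _ (fun _ => / 6)); [|apply cderiv_const].
        apply cderiv_minus; [apply cderiv_pow, cderiv_efun; auto|].
        assert (Da : cderiv phi 0 (dphi 0)) by (apply cderiv_phi; auto).
        assert (Db : cderiv (fun y => phi (- y)) 0 (- dphi (- 0))) by (apply cderiv_phi_neg; auto).
        apply cderiv_plus; [apply cderiv_minus|].
        + apply cderiv_pow, Da.
        + apply cderiv_mult; apply cderiv_pow; [apply Da|apply Db].
        + apply (cderiv_pow (fun y => phi (- y))), Db.
      - unfold G. replace (- 0) with (RtoC 0) by ring. rewrite efun_0, phi_0. field. }
    (* For y defun y a bound on [defun] near 0 is enough: [d2phi_bounded] covers the second
       derivative, and continuity at 0 covers everything else. *)
    destruct SG as [K1 [d1 [Hd1 Hb1]]].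
    destruct (ccont_bounded _ _ (cderiv_ccont _ _ _ (cderiv_phi 0 D0))) as [e1 [He1 B1]].
    destruct (ccont_bounded _ _ (cderiv_ccont _ _ _ (cderiv_phi_neg 0 D0))) as [e2 [He2 B2]].
    destruct (ccont_bounded _ _ (cderiv_ccont _ _ _ (cderiv_dphi 0 D0))) as [e3 [He3 B3]].
    destruct (ccont_bounded _ _ (cderiv_ccont _ _ _ (cderiv_dphi_neg 0 D0))) as [e4 [He4 B4]].
    assert (Di := cderiv_inv _ _ _ (phi_neq0 0 D0) (cderiv_phi 0 D0)).
    destruct (ccont_bounded _ _ (cderiv_ccont _ _ _ Di)) as [e5 [He5 B5]].
    destruct d2phi_bounded as [K2 HK2].
    replace (- 0) with (RtoC 0) in * by ring. rewrite phi_0 in *. rewrite dphi_0 in *.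
    rewrite Cmod_1 in *. replace (/ 1) with (RtoC 1) in B5 by field. rewrite Cmod_1 in B5.
    rewrite Cmod_R, Rabs_right in * by lra.
    (* At 0 the continuous ingredients have moduli 1 or 2, and [ccont_bounded] adds 1; hence 3. *)
    set (M := (Rmax 3 K2)%R).
    assert (M3 : (3 <= M)%R) by apply Rmax_l.
    assert (MK : (K2 <= M)%R) by apply Rmax_r.
    set (d := Rmin (/ 2) (Rmin d1 (Rmin e1 (Rmin e2 (Rmin e3 (Rmin e4 e5)))))).
    exists (12 * ((M + 1 * M) * M + 1 * M ^ 2 * M ^ 2) + 4 * M ^ 3 * M + 8 * M ^ 3 * M + K1)%R, d.
    split. { unfold d. repeat apply Rmin_glb_lt; auto. lra. }
    intros y Hy.
    assert (H12 : (Cmod y < / 2)%R) by (eapply Rlt_le_trans; [exact Hy|apply Rmin_l]).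
    assert (Hy1 := Rlt_le_trans _ _ _ Hy (Rmin_r _ _)).
    assert (A0 := Rlt_le_trans _ _ _ Hy1 (Rmin_l _ _)). assert (Hy2 := Rlt_le_trans _ _ _ Hy1 (Rmin_r _ _)).
    assert (A1 := Rlt_le_trans _ _ _ Hy2 (Rmin_l _ _)). assert (Hy3 := Rlt_le_trans _ _ _ Hy2 (Rmin_r _ _)).
    assert (A2 := Rlt_le_trans _ _ _ Hy3 (Rmin_l _ _)). assert (Hy4 := Rlt_le_trans _ _ _ Hy3 (Rmin_r _ _)).
    assert (A3 := Rlt_le_trans _ _ _ Hy4 (Rmin_l _ _)). assert (Hy5 := Rlt_le_trans _ _ _ Hy4 (Rmin_r _ _)).
    assert (A4 := Rlt_le_trans _ _ _ Hy5 (Rmin_l _ _)). assert (A5 := Rlt_le_trans _ _ _ Hy5 (Rmin_r _ _)).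
    assert (Ey : y - 0 = y) by ring.
    specialize (B1 y). specialize (B2 y). specialize (B3 y). specialize (B4 y). specialize (B5 y).
    rewrite Ey in *. specialize (B1 A1). specialize (B2 A2). specialize (B3 A3). specialize (B4 A4). specialize (B5 A5).
    specialize (Hb1 y A0). specialize (HK2 y ltac:(lra)).
    unfold X. unfold Cminus at 1. eapply Rle_trans; [apply Cmod_triangle|].
    rewrite Cmod_opp, Rmult_plus_distr_r. apply Rplus_le_compat; auto.
    rewrite Cmod_mult, Rmult_comm. apply Rmult_le_compat_r; [apply Cmod_ge_0|].
    assert (N1 : phi y <> 0) by (apply phi_neq0; lra).
    unfold defun.
    replace (12 * ((dphi y + y * d2phi y) / phi y - y * dphi y ^ 2 / phi y ^ 2)) with
      (12 * ((dphi y + y * d2phi y) * / phi y - y * dphi y ^ 2 * (/ phi y) ^ 2)) by (field; auto).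
    assert (P0 : (0 <= M)%R) by lra.
    assert (Hpow : forall z n, (Cmod z <= M)%R -> (Cmod (z ^ n) <= M ^ n)%R).
    { intros z n Hz. now apply Cmod_pow_le. }
    assert (Hmul : forall a b A B, (Cmod a <= A)%R -> (Cmod b <= B)%R -> (Cmod (a * b) <= A * B)%R).
    { intros a b A B Ha Hb. rewrite Cmod_mult. apply Rmult_le_compat; auto using Cmod_ge_0. }
    assert (Hsub : forall a b A B, (Cmod a <= A)%R -> (Cmod b <= B)%R -> (Cmod (a - b) <= A + B)%R).
    { intros a b A B Ha Hb. eapply Rle_trans; [apply Cmod_triangle_minus|]. lra. }
    assert (Hadd : forall a b A B, (Cmod a <= A)%R -> (Cmod b <= B)%R -> (Cmod (a + b) <= A + B)%R).
    { intros a b A B Ha Hb. eapply Rle_trans; [apply Cmod_triangle|]. lra. }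
    assert (Hcst : forall c : R, (0 <= c)%R -> (Cmod c <= c)%R).
    { intros c Hc. rewrite Cmod_R, Rabs_right; lra. }
    repeat (first [apply Hsub | apply Hadd | apply Hpow | apply Hmul]);
      first [apply Hcst; lra | lra].
Qed.

(** * Lambert series *)

(** Logarithmic derivative of the factor (1 - x^m) / (1 + x^m) of [gprod], with m = k + 1. *)
Definition lam_term (x : C) (k : nat) : C := - (2 * INR (S k) * x ^ k / (1 - x ^ S k * x ^ S k)).

Lemma cderiv_gprod (n : nat) (x : C) : (Cmod x < 1)%R ->
  cderiv (fun y => gprod y n) x (psum (lam_term x) n * gprod x n).
Proof.
  intros Hx. induction n as [|n IH].
  - eapply cderiv_eq; [|apply (cderiv_const 1)]. simpl. ring.
  - cbn [gprod psum].
    assert (N1 := one_plus_neq0 _ (Cmod_pow_lt_1 x n Hx)).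
    assert (N2 := one_minus_neq0 _ (Cmod_pow_lt_1 x n Hx)).
    assert (Dp := cderiv_pow _ _ _ (S n) (cderiv_id x)). cbv beta in Dp. simpl pred in Dp.
    assert (D := cderiv_div (fun y => 1 - y ^ S n) (fun y => 1 + y ^ S n) _ _ _ N1 (cderiv_minus _ _ _ _ _ (cderiv_const 1 x) Dp)
                  (cderiv_plus _ _ _ _ _ (cderiv_const 1 x) Dp)).
    eapply cderiv_eq; [|apply (cderiv_mult _ _ _ _ _ IH D)].
    unfold lam_term. cbv beta. set (X := x ^ S n) in *.
    field. repeat split; auto.
    replace (1 - X * X) with ((1 - X) * (1 + X)) by ring. now apply Cmult_neq_0.
Qed.

Lemma pow_S_le (r : R) (k : nat) : (0 < r < 1)%R -> (0 <= r ^ S k <= r)%R.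
Proof.
  intros Hr. split; [apply pow_le; lra|]. replace r with (r ^ 1)%R at 2 by ring.
  apply pow_antitone; [lra|lia].
Qed.

Lemma lam_term_bound (r : R) : (0 < r < 1)%R -> exists K s : R, (0 <= K)%R /\ (0 < s < 1)%R /\
  forall x k, (Cmod x <= r)%R -> (Cmod (lam_term x k) <= K * s ^ k)%R.
Proof.
  intros Hr. destruct (poly_geom_bound 1 r ltac:(lra)) as [K [s [HK [Hs H]]]].
  exists (2 / (1 - r) * K)%R, s.
  assert (I : (0 < / (1 - r))%R) by (apply Rinv_0_lt_compat; lra).
  split; [|split; auto]. { apply Rmult_le_pos; auto. unfold Rdiv. nra. }
  intros x k Hx. unfold lam_term.
  assert (R1 := pow_S_le r k Hr). assert (Hk := Cmod_pow_le x r (S k) Hx).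
  assert (Hkk : (Cmod (x ^ S k * x ^ S k) <= r)%R).
  { rewrite Cmod_mult. assert (P := Cmod_ge_0 (x ^ S k)). nra. }
  assert (L := Cmod_1_minus _ _ Hkk).
  rewrite Cmod_opp, Cmod_div, !Cmod_mult, !Cmod_R by (apply Cmod_gt_0; lra).
  assert (P := pos_INR (S k)). rewrite !Rabs_right by lra.
  specialize (H k). simpl pow in H at 1. rewrite Rmult_1_r, <- S_INR in H.
  unfold Rdiv. rewrite (Rmult_comm 2 (INR (S k))).
  apply Rle_trans with (INR (S k) * r ^ k * (2 * / (1 - r)))%R.
  - replace (INR (S k) * 2 * Cmod (x ^ k) * / Cmod (1 - x ^ S k * x ^ S k))%R with
      ((INR (S k) * Cmod (x ^ k)) * (2 * / Cmod (1 - x ^ S k * x ^ S k)))%R by ring.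
    assert (I2 : (0 < / Cmod (1 - x ^ S k * x ^ S k))%R) by (apply Rinv_0_lt_compat; lra).
    apply Rmult_le_compat.
    + apply Rmult_le_pos; auto using Cmod_ge_0.
    + lra.
    + apply Rmult_le_compat_l; auto. now apply Cmod_pow_le.
    + apply Rmult_le_compat_l; [lra|]. apply Rinv_le_contravar; lra.
  - replace (2 * / (1 - r) * K * s ^ k)%R with ((K * s ^ k) * (2 * / (1 - r)))%R by ring.
    apply Rmult_le_compat_r; lra.
Qed.

(** Logarithmic differentiation of Gauss's product: on a small disc, both the finite products and
    their logarithmic derivatives converge at a uniform geometric rate, so [cderiv_uniform_limit]
    applies. *)
Lemma dphi_neg_lambert (x : C) : (Cmod x < 1)%R -> - dphi (- x) = csum (lam_term x) * phi (- x).
Proof.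
  intros Hx. apply (cderiv_unique (fun y => phi (- y)) x); [now apply cderiv_phi_neg|].
  destruct (exists_between x Hx) as [r [Hr Hxr]].
  destruct (gprod_approx r Hr) as [K1 [s1 [HK1 [Hs1 H1]]]].
  destruct (lam_term_bound r Hr) as [K2 [s2 [HK2 [Hs2 H2]]]].
  assert (Hball : forall y, (Cmod (y - x) < r - Cmod x)%R -> (Cmod y <= r)%R).
  { intros y Hy. replace y with (x + (y - x)) by ring. eapply Rle_trans; [apply Cmod_triangle|]. lra. }
  apply (cderiv_uniform_limit (fun n y => gprod y n) (fun n y => psum (lam_term y) n * gprod y n)
           (fun y => phi (- y)) (fun y => csum (lam_term y) * phi (- y)) x (r - Cmod x)).
  - lra.
  - intros y Hy. apply gprod_Clim. specialize (Hball y Hy). lra.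
  - intros n y Hy. apply cderiv_gprod. specialize (Hball y Hy). lra.
  - intros n.
    assert (DL : exists l, cderiv (fun y => psum (lam_term y) n) x l).
    { induction n as [|n [l IH]]; [exists 0; apply (cderiv_const 0)|].
      assert (N1 := one_plus_neq0 _ (Cmod_pow_lt_1 x n Hx)).
      assert (N2 := one_minus_neq0 _ (Cmod_pow_lt_1 x n Hx)).
      assert (N3 : 1 - x ^ S n * x ^ S n <> 0).
      { replace (1 - x ^ S n * x ^ S n) with ((1 - x ^ S n) * (1 + x ^ S n)) by ring. now apply Cmult_neq_0. }
      assert (Dn := cderiv_pow (fun y => y) x 1 n (cderiv_id x)).
      assert (DS := cderiv_pow (fun y => y) x 1 (S n) (cderiv_id x)).
      assert (Dnum := cderiv_mult (fun _ => 2 * INR (S n)) (fun y => y ^ n) _ _ _ (cderiv_const _ x) Dn).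
      assert (Dden := cderiv_minus (fun _ => 1) (fun y => y ^ S n * y ^ S n) _ _ _ (cderiv_const 1 x)
                        (cderiv_mult (fun y => y ^ S n) (fun y => y ^ S n) _ _ _ DS DS)).
      assert (Dq := cderiv_opp _ _ _ (cderiv_div (fun y => 2 * INR (S n) * y ^ n)
                      (fun y => 1 - y ^ S n * y ^ S n) _ _ _ N3 Dnum Dden)).
      eexists. exact (cderiv_plus (fun y => psum (lam_term y) n) (fun y => lam_term y n) _ _ _ IH Dq). }
    destruct DL as [l DL].
    apply (cderiv_ccont _ _ _ (cderiv_mult _ _ _ _ _ DL (cderiv_gprod n x Hx))).
  - set (B1 := (K2 / (1 - s2))%R). set (B2 := (gprod_cst r + K1)%R).
    assert (I2 : (0 < / (1 - s2))%R) by (apply Rinv_0_lt_compat; lra).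
    assert (HB1 : (0 <= B1)%R) by (unfold B1, Rdiv; apply Rmult_le_pos; lra).
    assert (HB2 : (0 <= B2)%R) by (unfold B2, gprod_cst; assert (X := exp_pos (2 / (1 - r) ^ 2)); lra).
    assert (L : is_lim_seq (fun n => B1 * K1 * s1 ^ n + B1 * B2 * s2 ^ n)%R 0).
    { apply is_lim_seq_plus0; apply geom_lim0; lra. }
    intros eps He. apply is_lim_seq_spec in L. destruct (L (mkposreal eps He)) as [N HN].
    exists N. intros n y Hn Hy. specialize (HN n Hn). simpl in HN. rewrite Rminus_0_r in HN.
    apply Rlt_le. eapply Rle_lt_trans; [|exact HN]. eapply Rle_trans; [|apply Rle_abs].
    specialize (Hball y Hy).
    replace (psum (lam_term y) n * gprod y n - csum (lam_term y) * phi (- y)) with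
      (psum (lam_term y) n * (gprod y n - phi (- y)) + - (csum (lam_term y) - psum (lam_term y) n) * phi (- y)) by ring.
    eapply Rle_trans; [apply Cmod_triangle|]. rewrite !Cmod_mult, Cmod_opp.
    assert (T1 := psum_Cmod_le_geom (lam_term y) K2 s2 ltac:(lra) (fun k => H2 y k Hball) n).
    assert (T2 := csum_tail_geom (lam_term y) K2 s2 ltac:(lra) (fun k => H2 y k Hball) n).
    assert (T3 := H1 y n Hball).
    assert (T4 : (Cmod (phi (- y)) <= B2)%R).
    { replace (phi (- y)) with (gprod y 0 + - (gprod y 0 - phi (- y))) by ring.
      eapply Rle_trans; [apply Cmod_triangle|]. rewrite Cmod_opp.
      assert (Y1 := gprod_bound r Hr y 0 Hball). assert (Y2 := H1 y 0%nat Hball). simpl pow in Y2.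
      unfold B2. lra. }
    apply Rplus_le_compat.
    + rewrite Rmult_assoc. apply Rmult_le_compat; auto using Cmod_ge_0.
    + replace (B1 * B2 * s2 ^ n)%R with (B1 * s2 ^ n * B2)%R by ring.
      apply Rmult_le_compat; auto using Cmod_ge_0.
Qed.

(** Two Lambert forms of the generating function of the divisor sum: [eta] is defined with this one,
    while the product of Gauss produces [mell_term]. *)
Definition ell_term (x : C) (k : nat) : C := x ^ S k / (1 - x ^ S k) ^ 2.
Definition mell_term (x : C) (k : nat) : C := INR (S k) * (x ^ S k / (1 - x ^ S k)).

Definition ell (x : C) : C := csum (ell_term x).

Section LambertBounds.

Variables (x : C) (r : R).
Hypothesis Hr : (0 < r < 1)%R.
Hypothesis Hx : (Cmod x <= r)%R.

Lemma lambert_den (k : nat) : (1 - r <= Cmod (1 - x ^ S k))%R.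
Proof.
  assert (R1 := pow_S_le r k Hr).
  assert (L := Cmod_1_minus _ _ (Cmod_pow_le x r (S k) Hx)). lra.
Qed.

Lemma lambert_den_neq0 (k : nat) : 1 - x ^ S k <> 0.
Proof. apply Cmod_gt_0. assert (L := lambert_den k). lra. Qed.

Lemma ell_term_bound (k : nat) : (Cmod (ell_term x k) <= Cmod x / (1 - r) ^ 2 * r ^ k)%R.
Proof.
  unfold ell_term. assert (L := lambert_den k). assert (N := lambert_den_neq0 k).
  rewrite Cmod_div, Cpow_S, Cmod_mult by (now apply Cpow_nz).
  rewrite (Cmod_pow (1 - _)).
  assert (I2 : (/ Cmod (1 - x * x ^ k) ^ 2 <= / (1 - r) ^ 2)%R).
  { apply Rinv_le_contravar; [apply pow_lt; lra|]. apply pow_incr. rewrite Cpow_S in L. lra. }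
  unfold Rdiv. rewrite !Rmult_assoc. apply Rmult_le_compat_l; [apply Cmod_ge_0|].
  rewrite (Rmult_comm _ (r ^ k)). apply Rmult_le_compat; auto using Cmod_ge_0.
  - apply Rlt_le, Rinv_0_lt_compat, pow_lt. rewrite Cpow_S in L. lra.
  - now apply Cmod_pow_le.
Qed.

Lemma mell_term_bound : exists K s : R, (0 <= K)%R /\ (0 < s < 1)%R /\
  forall k, (Cmod (mell_term x k) <= K * s ^ k)%R.
Proof.
  destruct (poly_geom_bound 1 r ltac:(lra)) as [K [s [HK [Hs H]]]].
  assert (I : (0 < / (1 - r))%R) by (apply Rinv_0_lt_compat; lra).
  exists (K * / (1 - r))%R, s. split; [|split; auto]. { apply Rmult_le_pos; lra. }
  intros k. unfold mell_term. assert (L := lambert_den k). assert (N := lambert_den_neq0 k).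
  rewrite Cmod_mult, Cmod_div, Cmod_R by auto.
  assert (P := pos_INR (S k)). rewrite Rabs_right by lra.
  specialize (H k). simpl pow in H at 1. rewrite Rmult_1_r, <- S_INR in H.
  apply Rle_trans with (INR (S k) * r ^ k * / (1 - r))%R.
  - unfold Rdiv. rewrite <- Rmult_assoc. apply Rmult_le_compat.
    + apply Rmult_le_pos; auto using Cmod_ge_0.
    + apply Rlt_le, Rinv_0_lt_compat. lra.
    + apply Rmult_le_compat_l; auto. eapply Rle_trans; [apply (Cmod_pow_le x r), Hx|].
      apply pow_antitone; [lra|lia].
    + apply Rinv_le_contravar; lra.
  - replace (K * / (1 - r) * s ^ k)%R with (K * s ^ k * / (1 - r))%R by ring.
    apply Rmult_le_compat_r; lra.
Qed.

Lemma psum_arith_geom (y : C) (n : nat) : 1 - y <> 0 ->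
  psum (fun m => INR (S m) * y ^ S m) n = y / (1 - y) ^ 2 - y ^ S n * (1 + INR n * (1 - y)) / (1 - y) ^ 2.
Proof.
  intros Hy. induction n as [|n IH].
  - simpl. field. auto.
  - cbn [psum]. rewrite IH, !S_INR, !RtoC_plus. rewrite !Cpow_S. field. auto.
Qed.

Lemma psum_geom (y : C) (n : nat) : 1 - y <> 0 ->
  psum (fun m => y ^ S m) n = y / (1 - y) - y ^ S n / (1 - y).
Proof.
  intros Hy. induction n as [|n IH].
  - simpl. field. auto.
  - cbn [psum]. rewrite IH. rewrite !Cpow_S. field. auto.
Qed.

(** Square truncation of the double series of m x^(k m), on which exchanging the sums is a finite
    matter. Summing rows or columns to infinity instead changes it by O(n^2 r^n), since every
    missing tail carries a factor (x^j)^(n+1). *)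
Let rect (n : nat) : C := psum (fun k => psum (fun m => INR (S m) * x ^ (S k * S m)) n) n.

Lemma ell_rect (n : nat) :
  (Cmod (psum (ell_term x) n - rect n) <= 2 / (1 - r) ^ 2 * ((INR n + 1) ^ 2 * r ^ n))%R.
Proof.
  assert (E : psum (ell_term x) n - rect n =
     psum (fun k => (x ^ S k) ^ S n * (1 + INR n * (1 - x ^ S k)) / (1 - x ^ S k) ^ 2) n).
  { unfold rect. replace (psum (ell_term x) n - psum (fun k => psum (fun m => INR (S m) * x ^ (S k * S m)) n) n)
      with (psum (ell_term x) n + (-1) * psum (fun k => psum (fun m => INR (S m) * x ^ (S k * S m)) n) n) by ring.
    rewrite <- psum_scal, <- psum_plus. apply psum_ext. intros k _.
    rewrite (psum_ext _ (fun m => INR (S m) * (x ^ S k) ^ S m)) by (intros; now rewrite Cpow_mult_r).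
    assert (N := lambert_den_neq0 k). rewrite psum_arith_geom by auto.
    unfold ell_term. field. auto. }
  rewrite E.
  assert (P := pos_INR n). assert (Q := pow_le_1 r n ltac:(lra)).
  assert (I : (0 < / (1 - r) ^ 2)%R) by (apply Rinv_0_lt_compat, pow_lt; lra).
  eapply Rle_trans; [apply psum_Cmod_le with (K := (r ^ n * (1 + INR n * 2) * / (1 - r) ^ 2)%R)|].
  - intros k _. assert (L := lambert_den k). assert (N := lambert_den_neq0 k).
    rewrite Cmod_div by (now apply Cpow_nz). rewrite Cmod_mult, (Cmod_pow (1 - _)).
    assert (Hk := Cmod_pow_le x r (S k) Hx). assert (R1 := pow_S_le r k Hr).
    unfold Rdiv. apply Rmult_le_compat.
    + apply Rmult_le_pos; apply Cmod_ge_0.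
    + apply Rlt_le, Rinv_0_lt_compat, pow_lt. lra.
    + apply Rmult_le_compat; auto using Cmod_ge_0.
      * eapply Rle_trans; [apply Cmod_pow_le with (r := r); lra|]. apply pow_antitone; [lra|lia].
      * eapply Rle_trans; [apply Cmod_triangle|]. rewrite Cmod_1, Cmod_mult, Cmod_R, Rabs_right by lra.
        apply Rplus_le_compat_l, Rmult_le_compat_l; auto.
        assert (X := Cmod_1_minus _ _ Hk). lra.
    + apply Rinv_le_contravar; [apply pow_lt; lra|]. apply pow_incr. lra.
  - replace (INR n * (r ^ n * (1 + INR n * 2) * / (1 - r) ^ 2))%R with
      (/ (1 - r) ^ 2 * (r ^ n * (INR n * (1 + INR n * 2))))%R by ring.
    replace (2 / (1 - r) ^ 2 * ((INR n + 1) ^ 2 * r ^ n))%R with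
      (/ (1 - r) ^ 2 * (r ^ n * (2 * (INR n + 1) ^ 2)))%R by (unfold Rdiv; ring).
    apply Rmult_le_compat_l; [lra|]. apply Rmult_le_compat_l; [lra|]. simpl. nra.
Qed.

Lemma mell_rect (n : nat) :
  (Cmod (psum (mell_term x) n - rect n) <= / (1 - r) * ((INR n + 1) ^ 2 * r ^ n))%R.
Proof.
  assert (E : psum (mell_term x) n - rect n = psum (fun m => INR (S m) * ((x ^ S m) ^ S n / (1 - x ^ S m))) n).
  { unfold rect. rewrite psum_exchange.
    replace (psum (mell_term x) n - psum (fun m => psum (fun k => INR (S m) * x ^ (S k * S m)) n) n)
      with (psum (mell_term x) n + (-1) * psum (fun m => psum (fun k => INR (S m) * x ^ (S k * S m)) n) n) by ring.
    rewrite <- psum_scal, <- psum_plus. apply psum_ext. intros m _.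
    rewrite psum_scal.
    rewrite (psum_ext _ (fun k => (x ^ S m) ^ S k)).
    2: { intros k _. rewrite <- Cpow_mult_r. f_equal. lia. }
    assert (N := lambert_den_neq0 m). rewrite psum_geom by auto.
    unfold mell_term. field. auto. }
  rewrite E.
  assert (P := pos_INR n). assert (Q := pow_le_1 r n ltac:(lra)).
  assert (I : (0 < / (1 - r))%R) by (apply Rinv_0_lt_compat; lra).
  eapply Rle_trans; [apply psum_Cmod_le with (K := (INR n * (r ^ n * / (1 - r)))%R)|].
  - intros m Hm. assert (L := lambert_den m). assert (N := lambert_den_neq0 m).
    rewrite Cmod_mult, Cmod_div by auto. rewrite Cmod_R.
    assert (Pm := pos_INR (S m)). rewrite Rabs_right by lra.
    assert (Hk := Cmod_pow_le x r (S m) Hx). assert (R1 := pow_S_le r m Hr).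
    apply Rmult_le_compat; auto.
    + unfold Rdiv. apply Rmult_le_pos; [apply Cmod_ge_0|]. apply Rlt_le, Rinv_0_lt_compat. lra.
    + apply le_INR. lia.
    + unfold Rdiv. apply Rmult_le_compat; auto using Cmod_ge_0.
      * apply Rlt_le, Rinv_0_lt_compat. lra.
      * eapply Rle_trans; [apply Cmod_pow_le with (r := r); lra|]. apply pow_antitone; [lra|lia].
      * apply Rinv_le_contravar; lra.
  - replace (INR n * (INR n * (r ^ n * / (1 - r))))%R with (/ (1 - r) * (INR n * INR n * r ^ n))%R by ring.
    apply Rmult_le_compat_l; [lra|]. apply Rmult_le_compat_r; [lra|]. simpl. nra.
Qed.

Lemma ell_eq_mell : ell x = csum (mell_term x).
Proof.
  assert (R2 : is_lim_seq (fun n => (INR n + 1) ^ 2 * r ^ n)%R 0).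
  { destruct (poly_geom_bound 2 r ltac:(lra)) as [K [s [HK [Hs H]]]].
    apply is_lim_seq_le_le with (fun _ => 0%R) (fun n => K * s ^ n)%R; [|apply is_lim_seq_const|apply geom_lim0; lra].
    intros n. split; auto. apply Rmult_le_pos; [apply pow2_ge_0|apply pow_le; lra]. }
  assert (Z1 : Clim (fun n => psum (ell_term x) n - rect n) 0).
  { eapply Clim_squeeze; [|apply (is_lim_seq_scal0 (2 / (1 - r) ^ 2) _ R2)].
    intros n. replace (psum (ell_term x) n - rect n - 0) with (psum (ell_term x) n - rect n) by ring.
    apply ell_rect. }
  assert (Z2 : Clim (fun n => psum (mell_term x) n - rect n) 0).
  { eapply Clim_squeeze; [|apply (is_lim_seq_scal0 (/ (1 - r)) _ R2)].
    intros n. replace (psum (mell_term x) n - rect n - 0) with (psum (mell_term x) n - rect n) by ring.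
    apply mell_rect. }
  apply csum_unique. destruct mell_term_bound as [K [s [HK [Hs H]]]].
  assert (Z3 := csum_Clim_geom _ K s ltac:(lra) H).
  replace (csum (mell_term x)) with (csum (mell_term x) + (0 - 0)) by ring.
  eapply Clim_ext; [|apply (Clim_plus _ _ _ _ Z3 (Clim_minus _ _ _ _ Z1 Z2))].
  intros n. cbv beta. ring.
Qed.

End LambertBounds.

(** Termwise, with X = x^m, this is the partial fraction identity - X / (1 - X^2) = X^2 / (1 - X^2)
    - X / (1 - X), weighted by 2 m. *)
Lemma dlog_neg_ell (x : C) : (Cmod x < 1)%R -> dlog_neg x = 2 * (ell (x * x) - ell x).
Proof.
  intros Hx. unfold dlog_neg.
  replace (- (x * dphi (- x) / phi (- x))) with (x * - dphi (- x) / phi (- x)).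
  2: { field. now apply phi_neg_neq0. }
  rewrite dphi_neg_lambert by auto.
  replace (x * (csum (lam_term x) * phi (- x)) / phi (- x)) with (x * csum (lam_term x)).
  2: { field. now apply phi_neg_neq0. }
  assert (Hxx := Cmod_sq_lt_1 x Hx).
  destruct (exists_between x Hx) as [r [Hr Hxr]].
  destruct (exists_between (x * x) Hxx) as [r' [Hr' Hxr']].
  rewrite (ell_eq_mell x r), (ell_eq_mell (x * x) r') by lra.
  destruct (lam_term_bound r Hr) as [K1 [s1 [HK1 [Hs1 H1]]]].
  destruct (mell_term_bound x r Hr ltac:(lra)) as [K2 [s2 [HK2 [Hs2 H2]]]].
  destruct (mell_term_bound (x * x) r' Hr' ltac:(lra)) as [K3 [s3 [HK3 [Hs3 H3]]]].
  apply Clim_unique with (fun n => x * psum (lam_term x) n).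
  - apply Clim_scal, (csum_Clim_geom _ K1 s1); [lra|]. intros k. apply H1. lra.
  - eapply Clim_ext; [|apply Clim_scal, Clim_minus;
      [apply (csum_Clim_geom _ K3 s3 ltac:(lra) H3)|apply (csum_Clim_geom _ K2 s2 ltac:(lra) H2)]].
    intros n. cbv beta.
    replace (psum (mell_term (x * x)) n - psum (mell_term x) n) with
      (psum (mell_term (x * x)) n + (-1) * psum (mell_term x) n) by ring.
    rewrite <- (psum_scal (-1)), <- psum_plus, <- !psum_scal. apply psum_ext. intros k _.
    unfold mell_term, lam_term.
    assert (N1 := one_plus_neq0 _ (Cmod_pow_lt_1 x k Hx)).
    assert (N2 := one_minus_neq0 _ (Cmod_pow_lt_1 x k Hx)).
    assert (N3 : 1 - x ^ S k * x ^ S k <> 0).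
    { replace (1 - x ^ S k * x ^ S k) with ((1 - x ^ S k) * (1 + x ^ S k)) by ring. now apply Cmult_neq_0. }
    rewrite Cpow_mult_l.
    replace (x * - (2 * INR (S k) * x ^ k / (1 - x ^ S k * x ^ S k))) with
      (- (2 * INR (S k) * x ^ S k / (1 - x ^ S k * x ^ S k))) by (rewrite (Cpow_S x k) at 1; field; auto).
    set (X := x ^ S k) in *. field. auto.
Qed.

Lemma ell_small (x : C) : (Cmod x <= / 2)%R -> (Cmod (ell x) <= 8 * Cmod x)%R.
Proof.
  intros Hx. unfold ell.
  eapply Rle_trans; [apply (csum_Cmod_le_geom _ (Cmod x / (1 - / 2) ^ 2) (/ 2)); [lra|]|].
  - intros k. apply ell_term_bound; lra.
  - apply Req_le. field.
Qed.

(** Squaring changes both sides by the same amount, so their difference is invariant; an invariant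
    that is O(x) vanishes. *)
Lemma efun_lambert (x : C) : (Cmod x < 1)%R -> efun x = 1 - 24 * ell (x * x).
Proof.
  intros Hx. set (Z := fun y => efun y - (1 - 24 * ell (y * y))).
  enough (Z x = 0) by (now apply Ceq_minus).
  apply squaring_zero; auto.
  - intros y Hy. assert (E : Z y = Z (y * y)).
    { unfold Z. rewrite (efun_sq_dlog y Hy), (dlog_neg_ell (y * y)) by auto with disc. ring. }
    rewrite <- E. assert (P := Cmod_ge_0 (Z y)). lra.
  - assert (D0 : (Cmod 0 < 1)%R) by (rewrite Cmod_0; lra).
    destruct (cderiv_small_at_0 (fun y => efun y - 1) (defun 0 - 0)) as [K [d [Hd Hb]]].
    + apply cderiv_minus; [now apply cderiv_efun|apply cderiv_const].
    + rewrite efun_0. ring.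
    (* 192 is 24 times the constant 8 of [ell_small], used with |y^2| <= |y|. *)
    + exists (K + 192)%R, (Rmin d (/ 2)). split; [apply Rmin_glb_lt; lra|]. intros y Hy.
      specialize (Hb y (Rlt_le_trans _ _ _ Hy (Rmin_l _ _))).
      assert (Hy2 := Rlt_le_trans _ _ _ Hy (Rmin_r _ _)).
      assert (P := Cmod_ge_0 y).
      assert (E := ell_small (y * y)). rewrite Cmod_mult in E. specialize (E ltac:(nra)).
      unfold Z. replace (efun y - (1 - 24 * ell (y * y))) with ((efun y - 1) + 24 * ell (y * y)) by ring.
      eapply Rle_trans; [apply Cmod_triangle|]. rewrite Cmod_mult, Cmod_R, Rabs_right by lra. nra.
Qed.

(** * The theta functions in terms of the nome *)

Lemma cexp_plus (z w : C) : cexp (z + w) = cexp z * cexp w.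
Proof.
  destruct z as [a b], w as [c d]. unfold cexp, Cplus, Cmult, Re, Im; simpl.
  rewrite exp_plus, cos_plus, sin_plus. f_equal; ring.
Qed.

Lemma cexp_0 : cexp 0 = 1.
Proof. unfold cexp, RtoC, Re, Im; simpl. rewrite exp_0, cos_0, sin_0. f_equal; ring. Qed.

Lemma cexp_nat (n : nat) (z : C) : cexp (INR n * z) = cexp z ^ n.
Proof.
  induction n as [|n IH].
  - simpl INR. rewrite Cmult_0_l. apply cexp_0.
  - rewrite S_INR, RtoC_plus, Cmult_plus_distr_r, Cmult_1_l, cexp_plus, IH. simpl. ring.
Qed.

Lemma Cmod_cexp (z : C) : Cmod (cexp z) = exp (Re z).
Proof.
  replace (cexp z) with (RtoC (exp (Re z)) * (cos (Im z), sin (Im z))).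
  2: { unfold cexp, Cmult, RtoC; simpl. f_equal; ring. }
  rewrite Cmod_mult, Cmod_R, Rabs_right by (apply Rle_ge, Rlt_le, exp_pos).
  unfold Cmod; simpl. rewrite !Rmult_1_r.
  replace (cos (Im z) * cos (Im z) + sin (Im z) * sin (Im z))%R with 1%R.
  - rewrite sqrt_1. ring.
  - assert (H := sin2_cos2 (Im z)). unfold Rsqr in H. lra.
Qed.

Lemma derivable_pt_lim_0 (f : R -> R) (l : R) : derivable_pt_lim f 0 l ->
  forall eps : R, (0 < eps)%R -> exists d : R, (0 < d)%R /\
    forall h, (Rabs h < d)%R -> (Rabs (f h - f 0 - l * h) <= eps * Rabs h)%R.
Proof.
  intros H eps He. destruct (H eps He) as [d Hd]. exists d. split; [apply cond_pos|].
  intros h Hh. destruct (Req_dec h 0) as [->|Hh0].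
  - replace (f 0 - f 0 - l * 0)%R with 0%R by ring. rewrite Rabs_R0. lra.
  - specialize (Hd h Hh0 Hh). rewrite Rplus_0_l in Hd.
    replace (f h - f 0 - l * h)%R with (((f h - f 0) / h - l) * h)%R by (field; auto).
    rewrite Rabs_mult. apply Rmult_le_compat_r; [apply Rabs_pos|lra].
Qed.

Lemma cderiv_cexp_0 : cderiv cexp 0 1.
Proof.
  apply cderiv_iff. intros eps He.
  (* The three error terms below are at most e|h|, 2e|h| and 3|h|^2, and |h| < e makes their sum at
     most 6e|h|. *)
  set (e := Rmin 1 (eps / 8)).
  assert (He0 : (0 < e)%R) by (apply Rmin_glb_lt; lra).
  assert (He1 : (e <= 1)%R) by apply Rmin_l. assert (He2 : (e <= eps / 8)%R) by apply Rmin_r.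
  clearbody e.
  assert (Dexp : derivable_pt_lim exp 0 1).
  { rewrite <- exp_0. apply derivable_pt_lim_exp. }
  assert (Dcos : derivable_pt_lim cos 0 0).
  { replace 0%R with (- sin 0)%R at 2 by (rewrite sin_0; ring). apply derivable_pt_lim_cos. }
  assert (Dsin : derivable_pt_lim sin 0 1).
  { rewrite <- cos_0. apply derivable_pt_lim_sin. }
  destruct (derivable_pt_lim_0 _ _ Dexp e He0) as [d1 [P1 H1]].
  destruct (derivable_pt_lim_0 _ _ Dcos e He0) as [d2 [P2 H2]].
  destruct (derivable_pt_lim_0 _ _ Dsin e He0) as [d3 [P3 H3]].
  exists (Rmin e (Rmin d1 (Rmin d2 d3))). split; [repeat apply Rmin_glb_lt; auto|].
  intros h Hh. replace (h - 0) with h in * by ring. rewrite cexp_0.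
  assert (Hh0 := Rlt_le_trans _ _ _ Hh (Rmin_l _ _)). assert (Hh' := Rlt_le_trans _ _ _ Hh (Rmin_r _ _)).
  assert (Hh1 := Rlt_le_trans _ _ _ Hh' (Rmin_l _ _)). assert (Hh'' := Rlt_le_trans _ _ _ Hh' (Rmin_r _ _)).
  assert (Hh2 := Rlt_le_trans _ _ _ Hh'' (Rmin_l _ _)). assert (Hh3 := Rlt_le_trans _ _ _ Hh'' (Rmin_r _ _)).
  assert (Ha := re_le_Cmod h). assert (Hb := Im_abs_le_Cmod h).
  set (a := Re h) in *. set (b := Im h) in *. set (m := Cmod h) in *.
  specialize (H1 a ltac:(lra)). specialize (H2 b ltac:(lra)). specialize (H3 b ltac:(lra)).
  rewrite exp_0 in H1. rewrite cos_0 in H2. rewrite sin_0 in H3.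
  set (u := (cos b, sin b) : C).
  assert (Hu : Cmod u = 1%R).
  { assert (X := Cmod_cexp (0, b)%R). unfold cexp, Re, Im in X; simpl in X. rewrite exp_0, !Rmult_1_l in X. exact X. }
  assert (Hu1 : (Cmod (u - 1 - Ci * b) <= 2 * e * m)%R).
  { eapply Rle_trans; [apply Cmod_le_Re_Im|]. unfold u, Re, Im, Ci, RtoC; simpl.
    replace (cos b + - (1) + - (0 * b - 1 * 0))%R with (cos b - 1 - 0 * b)%R by ring.
    replace (sin b + - 0 + - (0 * 0 + 1 * b))%R with (sin b - 0 - 1 * b)%R by ring. nra. }
  assert (Hu2 : (Cmod (u - 1) <= 3 * m)%R).
  { replace (u - 1) with ((u - 1 - Ci * b) + Ci * b) by ring.
    eapply Rle_trans; [apply Cmod_triangle|]. rewrite Cmod_mult, Cmod_Ci, Cmod_R. assert (Pm := Cmod_ge_0 h). fold m in Pm. nra. }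
  replace (cexp h - 1 - h * 1) with (RtoC (exp a - 1 - 1 * a) * u + ((u - 1 - Ci * b) + a * (u - 1))).
  2: { apply C_eq_Re_Im; unfold cexp, u, a, b; destruct h as [h1 h2];
         unfold Re, Im, Ci, RtoC, Cplus, Cmult, Cminus, Copp; simpl; ring. }
  eapply Rle_trans; [apply Cmod_triangle|].
  eapply Rle_trans; [apply Rplus_le_compat_l, Cmod_triangle|].
  rewrite !Cmod_mult, !Cmod_R, Hu. assert (Pm := Cmod_ge_0 h). fold m in Pm.
  assert (Q : (Rabs a * Cmod (u - 1) <= m * (3 * m))%R)
    by (apply Rmult_le_compat; auto using Rabs_pos, Cmod_ge_0).
  nra.
Qed.

Lemma cderiv_cexp (z : C) : cderiv cexp z (cexp z).
Proof.
  assert (D1 := cderiv_minus _ _ _ _ _ (cderiv_id z) (cderiv_const z z)).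
  assert (E0 : z - z = 0) by ring.
  assert (D2 : cderiv cexp (z - z) 1) by (rewrite E0; apply cderiv_cexp_0).
  assert (D3 := cderiv_comp (fun y => y - z) cexp z _ _ D1 D2).
  assert (D4 := cderiv_mult _ _ _ _ _ (cderiv_const (cexp z) z) D3).
  eapply cderiv_ext; [|eapply cderiv_eq; [|exact D4]].
  - intros y. cbv beta. rewrite <- cexp_plus. f_equal. ring.
  - cbv beta. ring.
Qed.

Definition nome (t : C) : C := cexp (PI * Ci * t).
(** A fourth root of the nome: the exponents (k + 1/2)^2 of [theta2] are quarters of odd squares. *)
Definition nome4 (t : C) : C := cexp (PI * Ci * t / 4).

Lemma Re_PI_Ci (t : C) : Re (PI * Ci * t) = (- (PI * Im t))%R.
Proof. destruct t. unfold Re, Im, Ci, RtoC, Cmult; simpl. ring. Qed.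

Lemma nome_lt_1 (t : C) : (0 < Im t)%R -> (Cmod (nome t) < 1)%R.
Proof.
  intros H. unfold nome. rewrite Cmod_cexp, Re_PI_Ci, <- exp_0. apply exp_increasing.
  assert (P := PI_RGT_0). nra.
Qed.

Lemma nome4_pow (t : C) : nome4 t ^ 4 = nome t.
Proof.
  unfold nome4, nome. rewrite <- cexp_nat. f_equal. rewrite INR_IZR_INZ. simpl Z.of_nat. field.
Qed.

Lemma nome4_lt_1 (t : C) : (0 < Im t)%R -> (Cmod (nome4 t) < 1)%R.
Proof.
  intros H. assert (A := nome_lt_1 t H). rewrite <- nome4_pow, Cmod_pow in A.
  apply Rnot_le_lt. intros L. apply (pow_R1_Rle _ 4) in L. lra.
Qed.

Lemma cderiv_nome (t : C) : cderiv nome t (PI * Ci * nome t).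
Proof.
  eapply cderiv_eq; [|apply (cderiv_comp (fun y => PI * Ci * y) cexp t (PI * Ci) (nome t))].
  - ring.
  - eapply cderiv_mult_eq; [apply (cderiv_const (PI * Ci))|apply cderiv_id|]. cbv beta. ring.
  - apply cderiv_cexp.
Qed.

Lemma cderiv_nome4 (t : C) : cderiv nome4 t (PI * Ci / 4 * nome4 t).
Proof.
  eapply cderiv_eq; [|apply (cderiv_comp (fun y => PI * Ci * y / 4) cexp t (PI * Ci / 4) (nome4 t))].
  - ring.
  - assert (D := cderiv_mult _ _ _ _ _ (cderiv_mult _ _ _ _ _ (cderiv_const (PI * Ci) t) (cderiv_id t)) (cderiv_const (/ 4) t)).
    eapply cderiv_eq; [|exact D]. cbv beta. field.
  - apply cderiv_cexp.
Qed.

(** The shape of [zsum]: indices n >= 0, then the indices -(n+1). *)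
Lemma phi_shift (x : C) : (Cmod x < 1)%R ->
  phi x = csum (fun n => x ^ (n * n)) + csum (fun n => x ^ (S n * S n)).
Proof.
  intros Hx. assert (P := Cmod_ge_0 x). unfold phi.
  assert (E := csum_shift (fun n => x ^ (n * n)) (fun n => 1 * Cmod x ^ n)%R
     (fun n => phi_term_bound x (Cmod x) n ltac:(lra)) (ex_series_geom_scal 1 (Cmod x) ltac:(lra))).
  cbv beta in E. replace (2 * csum (fun n => x ^ (n * n)) - 1) with
    (csum (fun n => x ^ (n * n)) + (csum (fun n => x ^ (n * n)) - 1)) by ring.
  f_equal. rewrite E. simpl (x ^ (0 * 0)). ring.
Qed.

Lemma nome_square_term (t : C) (k : Z) (n : nat) : Z.abs_nat k = n ->
  cexp ((IZR k ^ 2) * PI * Ci * t) = nome t ^ (n * n).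
Proof.
  intros E. unfold nome. rewrite <- cexp_nat. f_equal.
  replace (RtoC (INR (n * n))) with (IZR k ^ 2); [ring|].
  rewrite <- RtoC_pow. f_equal. rewrite mult_INR, <- E, INR_IZR_INZ, Zabs2Nat.id_abs, abs_IZR.
  simpl. rewrite Rmult_1_r, <- Rabs_mult, Rabs_right; auto. apply Rle_ge, Rle_0_sqr.
Qed.

Lemma theta3_nome (t : C) : (0 < Im t)%R -> theta3 t = phi (nome t).
Proof.
  intros H. rewrite phi_shift by now apply nome_lt_1. unfold theta3, zsum.
  f_equal; apply csum_ext; intros n; apply nome_square_term; lia.
Qed.

Lemma zsign_nat (k : Z) (n : nat) : Z.abs_nat k = n -> zsign k = (-1) ^ n.
Proof.
  intros E. unfold zsign. destruct (Z.even k) eqn:Ek.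
  - apply Z.even_spec in Ek. destruct Ek as [j Ej].
    replace n with (2 * Z.abs_nat j)%nat by lia. now rewrite neg1_pow_even.
  - assert (Eo : Z.odd k = true) by (rewrite <- Z.negb_even, Ek; reflexivity).
    apply Z.odd_spec in Eo. destruct Eo as [j Ej].
    destruct (Z_le_gt_dec 0 j).
    + replace n with (2 * Z.abs_nat j + 1)%nat by lia. rewrite neg1_pow_odd. reflexivity.
    + replace n with (2 * Z.abs_nat (j + 1) + 1)%nat by lia. rewrite neg1_pow_odd. reflexivity.
Qed.

Lemma theta4_nome (t : C) : (0 < Im t)%R -> theta4 t = phi (- nome t).
Proof.
  intros H. rewrite phi_shift by (apply Cmod_opp_lt_1; now apply nome_lt_1). unfold theta4, zsum.
  f_equal; apply csum_ext; intros n.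
  - rewrite neg_pow_square, (zsign_nat _ n), (nome_square_term t _ n) by lia. reflexivity.
  - rewrite neg_pow_square, (zsign_nat _ (S n)), (nome_square_term t _ (S n)) by lia. reflexivity.
Qed.

Lemma theta2_nome (t : C) : (0 < Im t)%R -> theta2 t = (phi (nome4 t) - phi (- nome4 t)) / 2.
Proof.
  intros H. assert (H4 := nome4_lt_1 t H).
  rewrite phi_split_neg, phi_split by auto.
  transitivity (odd_squares (nome4 t) + odd_squares (nome4 t)); [|field].
  unfold theta2, zsum, odd_squares.
  (* For k = n and for k = -(n+1) alike, (k + 1/2)^2 = (n + 1/2)^2, so both halves of [zsum] yield
     the same series. *)
  assert (A : forall (y : R) n, (y * y = (INR n + / 2) * (INR n + / 2))%R ->
     cexp (RtoC y ^ 2 * PI * Ci * t) = nome4 t ^ ((2 * n + 1) * (2 * n + 1))).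
  { intros y n E. unfold nome4. rewrite <- cexp_nat. f_equal.
    rewrite <- RtoC_pow. replace (y ^ 2)%R with (INR ((2 * n + 1) * (2 * n + 1)) / 4)%R.
    - rewrite RtoC_div by lra. field.
    - simpl (y ^ 2)%R. rewrite Rmult_1_r, E, mult_INR, plus_INR, mult_INR. simpl. field. }
  f_equal; apply csum_ext; intros n; apply A.
  - now rewrite <- INR_IZR_INZ.
  - rewrite opp_IZR, <- INR_IZR_INZ, S_INR. field.
Qed.

(** The Lambert series in [eta] runs over powers of the squared nome, which matches [ell (x * x)];
    the factor is 2 pi^2 / 24. *)
Lemma eta_nome (t : C) : (0 < Im t)%R -> eta t = PI ^ 2 / 12 * efun (nome t).
Proof.
  intros H. rewrite efun_lambert by now apply nome_lt_1. unfold eta, ell.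
  rewrite (csum_ext _ (ell_term (nome t * nome t))).
  - field.
  - intros n. cbv zeta. unfold ell_term.
    replace (cexp (2 * INR (S n) * PI * Ci * t)) with ((nome t * nome t) ^ S n); auto.
    unfold nome. rewrite <- cexp_plus, <- cexp_nat. f_equal. ring.
Qed.

Lemma Im_near (t y : C) : (Cmod (y - t) < Im t)%R -> (0 < Im y)%R.
Proof.
  intros H. assert (A := Im_abs_le_Cmod (y - t)).
  assert (E : Im (y - t) = (Im y - Im t)%R) by reflexivity. rewrite E in A.
  apply Rabs_le_between in A. lra.
Qed.

Lemma dphi_dlog (x : C) : (Cmod x < 1)%R -> x * dphi x = dlog x * phi x.
Proof. intros H. unfold dlog. field. now apply phi_neq0. Qed.

Lemma dphi_neg_dlog (x : C) : (Cmod x < 1)%R -> x * - dphi (- x) = dlog_neg x * phi (- x).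
Proof. intros H. unfold dlog_neg. field. now apply phi_neg_neq0. Qed.

Lemma dlog_efun (x : C) : dlog x = (efun x + phi x ^ 4 - 2 * phi (- x) ^ 4) / 12.
Proof. unfold efun. field. Qed.

(** The equation for theta2, stated at y = [nome4 t] where y^4 is the nome. Duplication from y^4 to
    y^2 and from y^2 to y brings the right-hand side down to phi y, phi (- y) and dlog y. *)
Lemma dlog_quartic (y : C) : (Cmod y < 1)%R ->
  dlog y * phi y - dlog_neg y * phi (- y) =
  4 * (phi y - phi (- y)) * ((efun (y ^ 4) + phi (y ^ 4) ^ 4 + phi (- y ^ 4) ^ 4) / 12).
Proof.
  intros H. assert (Hy := Cmod_sq_lt_1 y H).
  assert (N1 := phi_add_neg_neq0 y H). assert (N2 := phi_sq_add_neg_neq0 y H).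
  assert (N3 := phi_sq_add_neg_neq0 _ Hy).
  replace (y ^ 4) with (y * y * (y * y)) by ring.
  replace ((efun (y * y * (y * y)) + phi (y * y * (y * y)) ^ 4 + phi (- (y * y * (y * y))) ^ 4) / 12)
    with (dlog (y * y * (y * y)) + phi (- (y * y * (y * y))) ^ 4 / 4) by (rewrite dlog_efun; field).
  replace (phi (- (y * y * (y * y))) ^ 4) with (phi (y * y) ^ 2 * phi (- (y * y)) ^ 2).
  2: { replace (phi (- (y * y * (y * y))) ^ 4) with ((phi (- (y * y * (y * y))) ^ 2) ^ 2) by ring.
       rewrite <- (phi_mul_neg (y * y)) by auto. ring. }
  rewrite dlog_sq, (dlog_neg_eq (y * y)) by auto. unfold wronsk.
  replace (phi (y * y) ^ 4) with ((phi (y * y) ^ 2) ^ 2) by ring.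
  replace (phi (- (y * y)) ^ 4) with ((phi (- (y * y)) ^ 2) ^ 2) by ring.
  assert (EU : phi (y * y) ^ 2 = (phi y ^ 2 + phi (- y) ^ 2) / 2).
  { rewrite phi_sq_add_neg by auto. field. }
  assert (EV : phi (- (y * y)) ^ 2 = phi y * phi (- y)) by (now rewrite phi_mul_neg).
  rewrite EU, EV in *. rewrite dlog_sq, (dlog_neg_eq y) by auto. unfold wronsk.
  set (u := phi y) in *. set (v := phi (- y)) in *.
  field. split; auto.
  intros E. apply (Cmult_neq_0 _ _ N1 N1). rewrite <- E. ring.
Qed.

(** The case A = B = 1 with the identity transformation, from which [sol_system] gets all the
    others. *)
Lemma theta_system : halphen_system 1 1 (fun t => 0 < Im t)%R theta2 theta3 theta4 eta.
Proof.
  intros t Ht.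
  assert (Hn := nome_lt_1 t Ht). assert (Hn4 := nome4_lt_1 t Ht). assert (NP := PI_C_neq0).
  assert (EI : Ci * Ci = -1) by apply Ci2.
  rewrite (theta2_nome t Ht), (theta3_nome t Ht), (theta4_nome t Ht), (eta_nome t Ht).
  assert (Dq := cderiv_nome t). assert (Dq4 := cderiv_nome4 t).
  split; [|split; [|split]].
  - apply (cderiv_ext_loc (fun t => (phi (nome4 t) - phi (- nome4 t)) * / 2) _ t _ (Im t) Ht).
    { intros y Hy. symmetry. apply theta2_nome. now apply Im_near with t. }
    assert (D1 := cderiv_comp nome4 phi t _ _ Dq4 (cderiv_phi _ Hn4)).
    assert (D2 := cderiv_comp nome4 (fun y => phi (- y)) t _ _ Dq4 (cderiv_phi_neg _ Hn4)).
    assert (D := cderiv_mult _ _ _ _ _ (cderiv_minus _ _ _ _ _ D1 D2) (cderiv_const (/ 2) t)).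
    eapply cderiv_eq; [|exact D]. cbv beta.
    assert (Q := dlog_quartic _ Hn4). rewrite <- (dphi_dlog _ Hn4), <- (dphi_neg_dlog _ Hn4), nome4_pow in Q.
    set (y := nome4 t) in *. set (q := nome t) in *.
    transitivity (PI * Ci / 8 * (y * dphi y - y * - dphi (- y))); [field|].
    rewrite Q. field. auto.
  - apply (cderiv_ext_loc (fun t => phi (nome t)) _ t _ (Im t) Ht).
    { intros y Hy. symmetry. apply theta3_nome. now apply Im_near with t. }
    eapply cderiv_eq; [|apply (cderiv_comp nome phi t _ _ Dq (cderiv_phi _ Hn))].
    transitivity (PI * Ci * (nome t * dphi (nome t))); [ring|].
    rewrite dphi_dlog, dlog_efun by auto. field. auto.
  - apply (cderiv_ext_loc (fun t => phi (- nome t)) _ t _ (Im t) Ht).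
    { intros y Hy. symmetry. apply theta4_nome. now apply Im_near with t. }
    eapply cderiv_eq; [|apply (cderiv_comp nome (fun y => phi (- y)) t _ _ Dq (cderiv_phi_neg _ Hn))].
    transitivity (PI * Ci * (nome t * - dphi (- nome t))); [ring|].
    rewrite dphi_neg_dlog, dlog_neg_eq, dlog_efun by auto. unfold wronsk. field. auto.
  - apply (cderiv_ext_loc (fun t => PI ^ 2 / 12 * efun (nome t)) _ t _ (Im t) Ht).
    { intros y Hy. symmetry. apply eta_nome. now apply Im_near with t. }
    assert (D1 := cderiv_comp nome efun t _ _ Dq (cderiv_efun _ Hn)).
    eapply cderiv_eq; [|apply (cderiv_mult _ _ _ _ _ (cderiv_const (PI ^ 2 / 12) t) D1)].
    cbv beta.
    transitivity (PI ^ 2 / 12 * (PI * Ci * (nome t * defun (nome t)))); [ring|].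
    rewrite efun_ode by auto. field. auto.
Qed.

(** * Action of the Moebius group and of the scalings *)

(** Continuity suffices: c (y - t) = (s y - s t)(s y + s t), and continuity keeps the second factor
    away from 0. *)
Lemma cderiv_sqrt_branch (s : C -> C) (c dl t : C) (r : R) : (0 < r)%R ->
  (forall y, (Cmod (y - t) < r)%R -> s y * s y = c * y + dl) ->
  ccont s t -> s t <> 0 -> cderiv s t (c / (2 * s t)).
Proof.
  intros Hr Hs Hc H0. apply cderiv_iff. intros eps He.
  assert (P := proj1 (Cmod_gt_0 _) H0). assert (Pc := Cmod_ge_0 c).
  set (m := Cmod (s t)) in *.
  (* The first bound gives |s y + s t| >= m, as this sum is 2 s t + (s y - s t); the second controls
     the remaining factor |c| |s y - s t| / (2 m^2). *)
  set (e := Rmin m (eps * m * m / (Cmod c + 1))).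
  assert (He1 : (0 < e)%R).
  { apply Rmin_glb_lt; auto. apply Rdiv_lt_0_compat; [|lra].
    apply Rmult_lt_0_compat; auto. now apply Rmult_lt_0_compat. }
  destruct (Hc e He1) as [d [Hd Hb]].
  exists (Rmin r d). split; [apply Rmin_glb_lt; auto|]. intros y Hy.
  assert (Y1 := Rlt_le_trans _ _ _ Hy (Rmin_l _ _)). assert (Y2 := Rlt_le_trans _ _ _ Hy (Rmin_r _ _)).
  specialize (Hb y Y2).
  assert (B1 : (Cmod (s y - s t) < m)%R) by (eapply Rlt_le_trans; [exact Hb|apply Rmin_l]).
  assert (B2 : (Cmod (s y - s t) < eps * m * m / (Cmod c + 1))%R)
    by (eapply Rlt_le_trans; [exact Hb|apply Rmin_r]).
  assert (S2 : (m <= Cmod (s y + s t))%R).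
  { assert (T := Cmod_triangle_inv (2 * s t) (s y - s t)).
    replace (2 * s t + (s y - s t)) with (s y + s t) in T by ring.
    rewrite Cmod_mult, Cmod_R, Rabs_right in T by lra. fold m in T. lra. }
  assert (N : s y + s t <> 0) by (apply Cmod_gt_0; lra).
  assert (Et := Hs t). replace (t - t) with (RtoC 0) in Et by ring. rewrite Cmod_0 in Et. specialize (Et Hr).
  assert (E : c * (y - t) = (s y - s t) * (s y + s t)).
  { replace ((s y - s t) * (s y + s t)) with (s y * s y - s t * s t) by ring.
    rewrite (Hs y Y1), Et. ring. }
  replace (s y - s t - (y - t) * (c / (2 * s t))) with
     ((y - t) * (c * - (s y - s t) * / (2 * s t * (s y + s t)))).
  2: { transitivity (c * (y - t) * (- (s y - s t) * / (2 * s t * (s y + s t)))); [ring|].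
       rewrite E. transitivity (s y - s t - c * (y - t) / (2 * s t)); [|field; auto].
       rewrite E. field. auto. }
  rewrite Cmod_mult, Rmult_comm. apply Rmult_le_compat_r; [apply Cmod_ge_0|].
  rewrite !Cmod_mult, Cmod_inv, !Cmod_mult, Cmod_opp, Cmod_R, Rabs_right; try lra.
  2: { repeat apply Cmult_neq_0; auto. apply IZR_C_neq0; lia. }
  fold m.
  assert (Q : (0 < 2 * m * Cmod (s y + s t))%R) by (apply Rmult_lt_0_compat; lra).
  apply Rmult_le_reg_r with (2 * m * Cmod (s y + s t))%R; auto.
  rewrite Rmult_assoc, Rinv_l, Rmult_1_r by lra.
  apply Rle_trans with (eps * m * m)%R.
  - apply (Rmult_lt_compat_r (Cmod c + 1)) in B2; [|lra].
    unfold Rdiv in B2. rewrite Rmult_assoc, Rinv_l in B2 by lra.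
    assert (X := Cmod_ge_0 (s y - s t)). nra.
  - rewrite !Rmult_assoc. apply Rmult_le_compat_l; [lra|]. nra.
Qed.

Lemma cderiv_mob (a b c dl t : C) : a * dl - b * c = 1 -> c * t + dl <> 0 ->
  cderiv (mob a b c dl) t (/ (c * t + dl) ^ 2).
Proof.
  intros H N.
  assert (D : forall p q : C, cderiv (fun x => p * x + q) t p).
  { intros p q. eapply cderiv_eq;
      [|apply (cderiv_plus _ _ _ _ _ (cderiv_mult _ _ _ _ _ (cderiv_const p t) (cderiv_id t)) (cderiv_const q t))].
    cbv beta. ring. }
  eapply cderiv_eq; [|apply (cderiv_div (fun x => a * x + b) (fun x => c * x + dl) _ _ _ N (D a b) (D c dl))].
  cbv beta. replace (a * (c * t + dl) - (a * t + b) * c) with (a * dl - b * c) by ring.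
  rewrite H. field. auto.
Qed.

(** Scaling leaves A^4 th3^4 and B^4 th4^4 equal to the canonical fourth powers over (c t + dl)^2.
    The correction in [soleta] does the same for et + pi^2/12 (th3^4 + th4^4), up to the term in c,
    which matches the derivative of the root in the denominators. *)
Lemma sol_system (A B : C) (hA : A <> 0) (hB : B <> 0) (a b c dl d : C) (s : C -> C) (U : C -> Prop) :
  a * dl - b * c = 1 -> open U -> admissible a b c dl s U ->
  halphen_system A B U (sol2 a b c dl d s) (sol3 A a b c dl s) (sol4 B a b c dl s) (soleta A B a b c dl).
Proof.
  intros Hdet HU Hadm t Ht.
  destruct (Hadm t Ht) as [N [HI [Hs Hc]]]. apply continuous_C_iff in Hc.
  destruct (proj1 (open_C_iff U) HU t Ht) as [r [Hr Hball]].
  assert (Ns : s t <> 0) by (intros E; apply N; rewrite <- Hs, E; ring).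
  assert (Ds : cderiv s t (c / (2 * s t))).
  { apply (cderiv_sqrt_branch s c dl t r); auto. intros y Hy. apply (Hadm y (Hball y Hy)). }
  assert (Dm := cderiv_mob a b c dl t Hdet N).
  assert (NP := PI_C_neq0).
  destruct (theta_system (mob a b c dl t) HI) as [D2 [D3 [D4 De]]].
  apply (cderiv_comp _ _ _ _ _ Dm) in D2. apply (cderiv_comp _ _ _ _ _ Dm) in D3.
  apply (cderiv_comp _ _ _ _ _ Dm) in D4. apply (cderiv_comp _ _ _ _ _ Dm) in De.
  cbv beta in D2, D3, D4, De.
  assert (Dl : cderiv (fun x => c * x + dl) t c).
  { eapply cderiv_eq;
      [|apply (cderiv_plus _ _ _ _ _ (cderiv_mult _ _ _ _ _ (cderiv_const c t) (cderiv_id t)) (cderiv_const dl t))].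
    cbv beta. ring. }
  split; [|split; [|split]].
  - assert (D := cderiv_div (fun x => d * theta2 (mob a b c dl x)) s _ _ _ Ns
       (cderiv_mult _ _ _ _ _ (cderiv_const d t) D2) Ds).
    eapply cderiv_eq; [|exact D]. cbv beta. unfold sol2, sol3, sol4, soleta. cbv zeta.
    (* Writing c t + dl as the square of [s t] leaves a rational identity modulo the relation Ci *
       Ci = -1. *)
    rewrite <- Hs. field [Ci2]. auto.
  - assert (D := cderiv_div (fun x => (/ A) * theta3 (mob a b c dl x)) s _ _ _ Ns
       (cderiv_mult _ _ _ _ _ (cderiv_const (/ A) t) D3) Ds).
    eapply cderiv_eq; [|exact D]. cbv beta. unfold sol2, sol3, sol4, soleta. cbv zeta.
    rewrite <- Hs. field [Ci2]. auto.
  - assert (D := cderiv_div (fun x => (/ B) * theta4 (mob a b c dl x)) s _ _ _ Ns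
       (cderiv_mult _ _ _ _ _ (cderiv_const (/ B) t) D4) Ds).
    eapply cderiv_eq; [|exact D]. cbv beta. unfold sol2, sol3, sol4, soleta. cbv zeta.
    rewrite <- Hs. field [Ci2]. auto.
  - assert (Nl2 : (c * t + dl) ^ 2 <> 0) by now apply Cpow_nz.
    assert (D3p := cderiv_pow _ _ _ 4 D3). assert (D4p := cderiv_pow _ _ _ 4 D4).
    assert (Dk := cderiv_mult _ _ _ _ _ (cderiv_const (PI ^ 2 / 12) t)
       (cderiv_plus _ _ _ _ _ (cderiv_mult _ _ _ _ _ (cderiv_const (1 - / A ^ 4) t) D3p)
          (cderiv_mult _ _ _ _ _ (cderiv_const (1 - / B ^ 4) t) D4p))).
    assert (Di := cderiv_inv (fun x => (c * x + dl) ^ 2) _ _ Nl2 (cderiv_pow _ _ _ 2 Dl)).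
    assert (D5 := cderiv_mult _ _ _ _ _ Di (cderiv_plus _ _ _ _ _ De Dk)).
    assert (D6 := cderiv_mult _ _ _ _ _ (cderiv_const (/ 2) t)
       (cderiv_div (fun _ => PI * Ci * c) (fun x => c * x + dl) _ _ _ N (cderiv_const (PI * Ci * c) t) Dl)).
    assert (D := cderiv_plus _ _ _ _ _ D5 D6). clear D5 D6 Di Dk D3p D4p.
    eapply cderiv_eq; [|exact D]. cbv beta. unfold sol3, sol4, soleta. cbv zeta.
    rewrite !INR_IZR_INZ. simpl Z.of_nat. simpl pred.
    rewrite <- Hs.
    set (h3 := theta3 (mob a b c dl t)). set (h4 := theta4 (mob a b c dl t)). set (e := eta (mob a b c dl t)).
    set (w := s t) in *. clearbody h3 h4 e w. field [Ci2]. auto.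
Qed.

(** * Values of the quotient [phi (- x) / phi x] *)

Lemma cexp_surj (z : C) : z <> 0 -> exists u, cexp u = z.
Proof.
  intros Hz. assert (P := proj1 (Cmod_gt_0 z) Hz).
  set (r := Cmod z) in *. set (co := (Re z / r)%R). set (si := (Im z / r)%R).
  assert (E1 : (co * co + si * si = 1)%R).
  { assert (X := Cmod2_alt z). unfold co, si.
    replace (Re z / r * (Re z / r) + Im z / r * (Im z / r))%R with ((Re z ^ 2 + Im z ^ 2) / r ^ 2)%R by (field; lra).
    rewrite <- X. unfold r. field. unfold r in P. lra. }
  assert (B : (-1 <= co <= 1)%R) by nra.
  assert (S1 : (sqrt (1 - co²) = Rabs si)%R).
  { replace (1 - co²)%R with (si²)%R by (unfold Rsqr; lra). apply sqrt_Rsqr_abs. }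
  assert (K : exists al, cos al = co /\ sin al = si).
  { destruct (Rle_lt_dec 0 si) as [Hs|Hs].
    - exists (acos co). rewrite cos_acos, sin_acos, S1 by auto. split; auto. apply Rabs_right; lra.
    - exists (- acos co)%R. rewrite cos_neg, sin_neg, cos_acos, sin_acos, S1 by auto. split; auto.
      rewrite Rabs_left; lra. }
  destruct K as [al [E2 E3]]. exists (ln r, al)%R. unfold cexp, Re, Im; simpl.
  rewrite exp_ln, E2, E3 by auto. unfold co, si. destruct z as [z1 z2]. unfold Re, Im; simpl. f_equal; field; lra.
Qed.

Lemma csqrt_exists (z : C) : exists w, w * w = z.
Proof.
  destruct (Ceq_dec z 0) as [->|Hz]; [exists 0; ring|].
  destruct (cexp_surj z Hz) as [u Hu]. exists (cexp (u / 2)).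
  rewrite <- cexp_plus, <- Hu. f_equal. field.
Qed.

(** The iterates from 0 are the partial sums of their increments, so the geometric series lemmas
    provide the limit. *)
Lemma contraction_fixpoint (G : C -> C) (rho : R) : (0 <= rho)%R ->
  (forall x, (Cmod x <= rho)%R -> (Cmod (G x) <= rho)%R) ->
  (forall x y, (Cmod x <= rho)%R -> (Cmod y <= rho)%R -> (Cmod (G x - G y) <= / 2 * Cmod (x - y))%R) ->
  exists x, (Cmod x <= rho)%R /\ G x = x.
Proof.
  intros Hr Hin Hc.
  set (x := fix it (n : nat) := match n with O => RtoC 0 | S m => G (it m) end).
  assert (Bx : forall n, (Cmod (x n) <= rho)%R).
  { induction n; simpl; [rewrite Cmod_0; auto|auto]. }
  assert (Bd : forall n, (Cmod (x (S n) - x n) <= rho * (/ 2) ^ n)%R).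
  { induction n as [|n IH].
    - replace (x 1%nat - x O) with (x 1%nat) by (simpl; ring). simpl pow. rewrite Rmult_1_r. apply Bx.
    - change (x (S (S n)) - x (S n)) with (G (x (S n)) - G (x n)).
      eapply Rle_trans; [apply Hc; auto|]. simpl pow. lra. }
  assert (L := csum_Clim_geom _ rho (/ 2) ltac:(lra) Bd).
  set (X := csum (fun n => x (S n) - x n)) in L.
  apply (Clim_ext _ x) in L.
  2: { induction n as [|n IH]; [reflexivity|]. cbn [psum]. rewrite IH. ring. }
  exists X. assert (BX : (Cmod X <= rho)%R) by (apply (Clim_Cmod_le x X rho 0); auto).
  split; auto.
  apply Clim_unique with (fun n => x (S n)).
  - apply Clim_squeeze with (fun n => / 2 * Cmod (x n - X))%R.
    + intros n. change (x (S n)) with (G (x n)). auto.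
    + now apply is_lim_seq_scal0.
  - apply (Clim_subseq x X S); auto.
Qed.

(** Equals theta2 / theta3 at the nome x^4, a square root of the elliptic modulus there. It is the
    Cayley transform of phi (- x) / phi x, odd in x and zero at 0. *)
Definition kfun (x : C) : C := (phi x - phi (- x)) / (phi x + phi (- x)).

Lemma kfun_opp (x : C) : (Cmod x < 1)%R -> kfun (- x) = - kfun x.
Proof.
  intros Hx. assert (N := phi_add_neg_neq0 x Hx). unfold kfun. replace (- - x) with x by ring.
  field. auto.
Qed.

(** Landen's transformation, cross-multiplied. Read as a quadratic equation for kfun (x^2), it is
    the one that [agm_step] solves. *)
Lemma kfun_sq (x : C) : (Cmod x < 1)%R -> kfun x ^ 2 * (1 + kfun (x * x) ^ 2) = 2 * kfun (x * x).
Proof.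
  intros Hx. assert (N := phi_add_neg_neq0 x Hx). assert (N2 := phi_add_neg_neq0 _ (Cmod_sq_lt_1 x Hx)).
  assert (E1 := phi_sq_add_neg x Hx). assert (E2 := phi_mul_neg x Hx).
  assert (S1 : (phi x - phi (- x)) ^ 2 = 2 * (phi (x * x) ^ 2 - phi (- (x * x)) ^ 2)).
  { replace ((phi x - phi (- x)) ^ 2) with ((phi x ^ 2 + phi (- x) ^ 2) - 2 * (phi x * phi (- x))) by ring.
    rewrite E1, E2. ring. }
  assert (S2 : (phi x + phi (- x)) ^ 2 = 2 * (phi (x * x) ^ 2 + phi (- (x * x)) ^ 2)).
  { replace ((phi x + phi (- x)) ^ 2) with ((phi x ^ 2 + phi (- x) ^ 2) + 2 * (phi x * phi (- x))) by ring.
    rewrite E1, E2. ring. }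
  assert (N3 : phi (x * x) ^ 2 + phi (- (x * x)) ^ 2 <> 0) by (apply phi_sq_add_neg_neq0; auto with disc).
  unfold kfun.
  replace (((phi x - phi (- x)) / (phi x + phi (- x))) ^ 2) with
    ((phi x - phi (- x)) ^ 2 / (phi x + phi (- x)) ^ 2) by (field; auto).
  rewrite S1, S2. field. split; auto.
Qed.

Definition kimage (m : C) : Prop := exists x, (Cmod x < 1)%R /\ kfun x = m.

(** If m' is attained at y, then at a square root of y the value is m up to sign, and oddness
    corrects the sign. The condition on m' excludes 1 + m'^2 = 0. *)
Lemma kimage_descent (m m' : C) : kimage m' -> m' <> 0 -> m ^ 2 * (1 + m' ^ 2) = 2 * m' -> kimage m.
Proof.
  intros [y [Hy Ey]] Hm' H. destruct (csqrt_exists y) as [x Hx].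
  assert (Hx1 : (Cmod x < 1)%R).
  { apply Rnot_le_lt. intros L. rewrite <- Hx, Cmod_mult in Hy. nra. }
  assert (E := kfun_sq x Hx1). rewrite Hx, Ey in E.
  assert (N : 1 + m' ^ 2 <> 0).
  { intros Z. rewrite Z in H. apply Hm'. replace m' with (2 * m' / 2) by field. rewrite <- H. field. }
  assert (E2 : (kfun x - m) * (kfun x + m) = 0).
  { destruct (Cmult_integral ((kfun x - m) * (kfun x + m)) (1 + m' ^ 2)); auto; [|contradiction].
    transitivity (kfun x ^ 2 * (1 + m' ^ 2) - m ^ 2 * (1 + m' ^ 2)); [ring|]. rewrite E, H. ring. }
  destruct (Cmult_integral _ _ E2) as [E3|E3].
  - exists x. split; auto. now apply Ceq_minus.
  - exists (- x). split; auto with disc. rewrite kfun_opp by auto.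
    replace m with (kfun x + m - kfun x) by ring. rewrite E3. ring.
Qed.

Lemma kfun_0 : kfun 0 = 0.
Proof. unfold kfun. replace (- 0) with (RtoC 0) by ring. rewrite phi_0. field. Qed.

(** A local inverse at 0, where the derivative of [kfun] is 2, found by Newton iteration with fixed
    slope. *)
Lemma kimage_near_0 : exists rho : R, (0 < rho)%R /\ forall m, (Cmod m <= rho)%R -> kimage m.
Proof.
  set (N := fun x => phi x - phi (- x)). set (D := fun x => phi x + phi (- x)).
  set (dN := fun x => dphi x - - dphi (- x)). set (dD := fun x => dphi x + - dphi (- x)).
  set (dk := fun x => (dN x * D x - N x * dD x) / (D x * D x)).
  assert (HN : forall x, (Cmod x < 1)%R -> cderiv N x (dN x)).
  { intros x Hx. apply (cderiv_minus _ _ _ _ _ (cderiv_phi x Hx) (cderiv_phi_neg x Hx)). }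
  assert (HD : forall x, (Cmod x < 1)%R -> cderiv D x (dD x)).
  { intros x Hx. apply (cderiv_plus _ _ _ _ _ (cderiv_phi x Hx) (cderiv_phi_neg x Hx)). }
  assert (Hk : forall x, (Cmod x < 1)%R -> cderiv kfun x (dk x)).
  { intros x Hx. apply (cderiv_div N D x _ _ (phi_add_neg_neq0 x Hx) (HN x Hx) (HD x Hx)). }
  assert (D0 : (Cmod 0 < 1)%R) by (rewrite Cmod_0; lra).
  assert (N0 := phi_add_neg_neq0 0 D0).
  assert (Cdk : ccont dk 0).
  { assert (H1 := cderiv_minus _ _ _ _ _ (cderiv_dphi 0 D0) (cderiv_opp _ _ _ (cderiv_dphi_neg 0 D0))).
    assert (H2 := cderiv_plus _ _ _ _ _ (cderiv_dphi 0 D0) (cderiv_opp _ _ _ (cderiv_dphi_neg 0 D0))).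
    assert (H3 := cderiv_minus _ _ _ _ _ (cderiv_mult dN D 0 _ _ H1 (HD 0 D0)) (cderiv_mult N dD 0 _ _ (HN 0 D0) H2)).
    assert (H4 := cderiv_mult D D 0 _ _ (HD 0 D0) (HD 0 D0)).
    apply (cderiv_ccont _ _ _ (cderiv_div (fun x => dN x * D x - N x * dD x) (fun x => D x * D x) 0 _ _
             (Cmult_neq_0 _ _ N0 N0) H3 H4)). }
  assert (E0 : dk 0 = 2).
  { unfold dk, dN, dD, N, D. replace (- 0) with (RtoC 0) by ring. rewrite phi_0, dphi_0. field. }
  destruct (Cdk 1%R Rlt_0_1) as [d [Hd Hb]].
  set (rho := Rmin (d / 2) (/ 2)).
  assert (R0 : (0 < rho)%R) by (apply Rmin_glb_lt; lra).
  assert (R1 : (rho <= d / 2)%R) by apply Rmin_l. assert (R2 : (rho <= / 2)%R) by apply Rmin_r.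
  exists rho. split; auto. intros m Hm.
  (* Its derivative is 1 - kfun'/2, at most 1/2 in modulus wherever kfun' is within 1 of its value 2
     at 0. *)
  set (G := fun x => x - (kfun x - m) / 2).
  assert (HG : forall x y, (Cmod x <= rho)%R -> (Cmod y <= rho)%R -> (Cmod (G x - G y) <= / 2 * Cmod (x - y))%R).
  { intros x y Hx Hy.
    assert (Seg : forall t : R, (0 <= t <= 1)%R -> (Cmod (y + t * (x - y)) <= rho)%R).
    { intros t Ht. replace (y + t * (x - y)) with (RtoC (1 - t) * y + t * x) by (rewrite RtoC_minus; ring).
      eapply Rle_trans; [apply Cmod_triangle|]. rewrite !Cmod_mult, !Cmod_R, !Rabs_right by lra. nra. }
    assert (MV : (Cmod (kfun x - kfun y - (x - y) * 2) <= 1 * Cmod (x - y))%R).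
    { apply cderiv_mean_value with dk.
      - intros t Ht. apply Hk. specialize (Seg t Ht). lra.
      - intros t Ht. specialize (Seg t Ht). rewrite <- E0. apply Rlt_le, Hb.
        replace (y + t * (x - y) - 0) with (y + t * (x - y)) by ring. lra. }
    unfold G. replace (x - (kfun x - m) / 2 - (y - (kfun y - m) / 2)) with
      (- (kfun x - kfun y - (x - y) * 2) * / 2) by field.
    rewrite Cmod_mult, Cmod_opp, <- RtoC_inv, Cmod_R, Rabs_right by lra. lra. }
  destruct (contraction_fixpoint G rho) as [x [Hx Ex]]; auto; [lra| |].
  - intros x Hx. assert (Z : (Cmod 0 <= rho)%R) by (rewrite Cmod_0; lra).
    specialize (HG x 0 Hx Z). replace (x - 0) with x in HG by ring.
    replace (G x) with ((G x - G 0) + G 0) by ring.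
    eapply Rle_trans; [apply Cmod_triangle|].
    assert (EG : (Cmod (G 0) = / 2 * Cmod m)%R).
    { unfold G. rewrite kfun_0. replace (0 - (0 - m) / 2) with (/ 2 * m) by field.
      rewrite Cmod_mult, <- RtoC_inv, Cmod_R, Rabs_right by lra. reflexivity. }
    lra.
  - exists x. split; [lra|]. unfold G in Ex.
    replace (kfun x) with (m + 2 * (x - (x - (kfun x - m) / 2))) by field. rewrite Ex. ring.
Qed.

(* One step of the complex arithmetic-geometric mean, for the right choice of the root. *)
Lemma agm_step (m : C) : m <> 0 ->
  exists m' : C, m' <> 0 /\ m ^ 2 * (1 + m' ^ 2) = 2 * m' /\ (Cmod m' <= 1)%R /\ (Cmod m' <= Cmod m ^ 2)%R.
Proof.
  intros Hm. destruct (csqrt_exists (1 - m ^ 4)) as [w Hw].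
  (* The two roots of the quadratic have product 1, so one of them lies in the closed unit disc. *)
  assert (Hp : (Cmod ((1 + w) / m ^ 2) * Cmod ((1 - w) / m ^ 2) = 1)%R).
  { rewrite <- Cmod_mult. replace ((1 + w) / m ^ 2 * ((1 - w) / m ^ 2)) with ((1 - w * w) / m ^ 4) by (field; auto).
    rewrite Hw. replace ((1 - (1 - m ^ 4)) / m ^ 4) with (RtoC 1) by (field; auto). apply Cmod_1. }
  assert (K : forall w, w * w = 1 - m ^ 4 -> (Cmod ((1 + w) / m ^ 2) <= 1)%R ->
    exists m' : C, m' <> 0 /\ m ^ 2 * (1 + m' ^ 2) = 2 * m' /\ (Cmod m' <= 1)%R /\ (Cmod m' <= Cmod m ^ 2)%R).
  { clear w Hw Hp. intros w Hw Hle. set (m' := (1 + w) / m ^ 2) in *.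
    assert (E : m ^ 2 * (1 + m' ^ 2) = 2 * m').
    { unfold m'. transitivity ((m ^ 4 + (1 + 2 * w + w * w)) / m ^ 2); [field; auto|].
      rewrite Hw. field. auto. }
    exists m'. split; [|split; [exact E|split; [exact Hle|]]].
    - intros Z. rewrite Z in E. apply (Cmult_neq_0 _ _ Hm Hm).
      transitivity (m ^ 2 * (1 + 0 ^ 2)); [ring|]. rewrite E. ring.
    (* The equation itself gives 2|m'| = |m|^2 |1 + m'^2| <= 2|m|^2. *)
    - assert (E2 : (2 * Cmod m' = Cmod m ^ 2 * Cmod (1 + m' ^ 2))%R).
      { rewrite <- Cmod_pow, <- Cmod_mult, E, Cmod_mult, Cmod_R, Rabs_right by lra. reflexivity. }
      assert (B : (Cmod (1 + m' ^ 2) <= 2)%R).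
      { eapply Rle_trans; [apply Cmod_triangle|]. rewrite Cmod_1, Cmod_pow.
        assert (P := pow_le_1 (Cmod m') 2 (conj (Cmod_ge_0 m') Hle)). lra. }
      assert (P := pow2_ge_0 (Cmod m)). nra. }
  assert (P1 := Cmod_ge_0 ((1 + w) / m ^ 2)). assert (P2 := Cmod_ge_0 ((1 - w) / m ^ 2)).
  destruct (Rle_lt_dec (Cmod ((1 + w) / m ^ 2)) 1) as [L|L].
  - now apply (K w).
  - apply (K (- w)); [rewrite <- Hw; ring|]. replace (1 + - w) with (1 - w) by ring. nra.
Qed.

(** Each step at least squares the modulus, so n steps bring m below |m|^(2^n), into the range of
    [kimage_near_0]. *)
Lemma kimage_disc (m : C) : m <> 0 -> (Cmod m < 1)%R -> kimage m.
Proof.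
  intros Hm0 Hm. destruct kimage_near_0 as [rho [Hr Hnear]].
  assert (K : forall n (m : C), m <> 0 -> (Cmod m < 1)%R -> (Cmod m ^ (2 ^ n) <= rho)%R -> kimage m).
  { induction n as [|n IH]; intros p Hp0 Hp Hle.
    - apply Hnear. simpl in Hle. lra.
    - destruct (agm_step p Hp0) as [p' [H0 [HE [H1 H2]]]].
      apply (kimage_descent p p'); auto. apply IH; auto.
      + eapply Rle_lt_trans; [exact H2|]. assert (P := Cmod_ge_0 p). simpl. nra.
      + eapply Rle_trans; [|exact Hle]. eapply Rle_trans; [apply pow_incr; split; [apply Cmod_ge_0|exact H2]|].
        rewrite <- pow_mult. apply Req_le. reflexivity. }
  destruct (pow2_small m rho Hm Hr) as [n Hn]. rewrite Cmod_pow in Hn. apply (K n); auto. lra.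
Qed.

(** If m'^2 = 1, then m^2 = m' and m^4 = 1; if m'^2 = -1, the equation gives m' = 0. Both are
    excluded. *)
Lemma agm_step_unit_free (m m' : C) : m <> 0 -> m ^ 4 <> 1 -> m' <> 0 ->
  m ^ 2 * (1 + m' ^ 2) = 2 * m' -> m' ^ 4 <> 1.
Proof.
  intros Hm Hm4 Hm' H E.
  destruct (Cmult_integral (m' ^ 2 - 1) (m' ^ 2 + 1)) as [Z|Z].
  { transitivity (m' ^ 4 - 1); [ring|]. rewrite E. ring. }
  - assert (Z' : m' ^ 2 = 1) by (now apply Ceq_minus). apply Hm4.
    replace (m ^ 4) with ((m ^ 2 * (1 + 1) / 2) ^ 2) by field.
    rewrite Z' in H. rewrite H. replace ((2 * m' / 2) ^ 2) with (m' ^ 2) by field. exact Z'.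
  - apply Hm'. replace m' with (2 * m' / 2) by field. rewrite <- H.
    replace (m ^ 2 * (1 + m' ^ 2) / 2) with (m ^ 2 * (m' ^ 2 + 1) / 2) by field. rewrite Z. field.
Qed.

(* After two steps of the mean the iterate lies strictly inside the unit disc. *)
Lemma kimage_all (m : C) : m <> 0 -> m ^ 4 <> 1 -> kimage m.
Proof.
  intros Hm Hm4.
  destruct (agm_step m Hm) as [m1 [N1 [E1 [L1 _]]]].
  assert (U1 := agm_step_unit_free m m1 Hm Hm4 N1 E1).
  apply (kimage_descent m m1); auto.
  destruct (agm_step m1 N1) as [m2 [N2 [E2 [L2 _]]]].
  apply (kimage_descent m1 m2); auto. apply kimage_disc; auto.
  destruct L2 as [L2|L2]; auto. exfalso.
  (* On the unit circle 1 + m2^2 = 2 Re(m2) m2, so the step equation becomes m1^2 Re(m2) = 1. Both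
     factors have modulus at most 1, hence exactly 1; then Re(m2)^2 = 1 and m1^4 = 1, a
     contradiction. *)
  assert (C2 : m2 * Cconj m2 = 1) by (rewrite <- Cmod2_conj, L2; f_equal; ring).
  assert (R2 : m2 + Cconj m2 = 2 * Re m2).
  { apply C_eq_Re_Im; destruct m2; unfold Re, Im, Cconj, Cplus, Cmult, RtoC; simpl; ring. }
  assert (K : m1 ^ 2 * Re m2 = 1).
  { destruct (Cmult_integral (m1 ^ 2 * Re m2 - 1) (2 * m2)) as [Z|Z].
    - transitivity (m1 ^ 2 * (m2 * (2 * Re m2)) - 2 * m2); [ring|]. rewrite <- R2, <- E2.
      transitivity (m1 ^ 2 * (m2 * Cconj m2 - 1)); [ring|]. rewrite C2. ring.
    - now apply Ceq_minus.
    - exfalso. apply N2. replace m2 with (2 * m2 / 2) by field. rewrite Z. field. }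
  assert (KM : (Cmod m1 ^ 2 * Rabs (Re m2) = 1)%R).
  { rewrite <- Cmod_R, <- Cmod_pow, <- Cmod_mult, K. apply Cmod_1. }
  assert (B1 := pow_le_1 (Cmod m1) 2 (conj (Cmod_ge_0 m1) L1)).
  assert (B2 : (Rabs (Re m2) <= 1)%R) by (rewrite <- L2; apply re_le_Cmod).
  assert (B3 := Rabs_pos (Re m2)).
  assert (RR : (Rabs (Re m2) = 1)%R) by nra.
  assert (R4 : (Re m2 * Re m2 = 1)%R).
  { rewrite <- (Rabs_right (Re m2 * Re m2)) by (apply Rle_ge, Rle_0_sqr). rewrite Rabs_mult, RR. ring. }
  apply U1. transitivity ((m1 ^ 2 * Re m2) ^ 2).
  - transitivity (m1 ^ 4 * (Re m2 * Re m2)); [|ring]. rewrite <- RtoC_mult, R4. ring.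
  - rewrite K. ring.
Qed.

(** The Cayley transform m = (1 - w) / (1 + w) reduces this to [kimage_all]. Since (1+w)^4 - (1-w)^4
    = 8 w (1 + w^2), the excluded values correspond: w = 0 and w^2 = -1 to m^4 = 1, w = 1 to m = 0,
    and w = -1 to the pole. *)
Lemma theta_ratio_surj (w : C) : w <> 0 -> w ^ 4 <> 1 ->
  exists T, (0 < Im T)%R /\ theta4 T = w * theta3 T /\ theta3 T <> 0 /\ theta2 T <> 0.
Proof.
  intros Hw Hw4.
  assert (N1 : 1 + w <> 0).
  { intros E. apply Hw4. replace w with (1 + w - 1) by ring. rewrite E. ring. }
  assert (N2 : 1 - w <> 0).
  { intros E. apply Hw4. replace w with (1 - (1 - w)) by ring. rewrite E. ring. }
  set (m := (1 - w) / (1 + w)).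
  assert (Em : m * (1 + w) = 1 - w) by (unfold m; field; auto).
  assert (M0 : m <> 0) by (intros E; apply N2; rewrite <- Em, E; ring).
  destruct (kimage_all m M0) as [x [Hx Ex]].
  { intros E. assert (Z : w * (1 + w ^ 2) = 0).
    { transitivity (((1 + w) ^ 4 - (m * (1 + w)) ^ 4) / 8); [rewrite Em; field|].
      replace ((m * (1 + w)) ^ 4) with (m ^ 4 * (1 + w) ^ 4) by ring. rewrite E. field. }
    destruct (Cmult_integral _ _ Z) as [|Z2]; auto.
    apply Hw4. replace (w ^ 4) with ((1 + w ^ 2 - 1) ^ 2) by ring. rewrite Z2. ring. }
  assert (X0 : x <> 0) by (intros E; apply M0; rewrite <- Ex, E; apply kfun_0).
  (* A logarithm of the nome gives T; |x| < 1 is what puts T in the upper half-plane. *)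
  destruct (cexp_surj x X0) as [u Hu].
  assert (NP := PI_C_neq0). assert (NI := Ci_nz).
  set (T := u / (PI * Ci)).
  assert (ET : nome T = x).
  { unfold nome, T. rewrite <- Hu. f_equal. field. auto. }
  assert (HT : (0 < Im T)%R).
  { assert (A := Hx). rewrite <- ET in A. unfold nome in A. rewrite Cmod_cexp, Re_PI_Ci, <- exp_0 in A.
    apply exp_lt_inv in A. assert (P := PI_RGT_0). nra. }
  exists T. split; [exact HT|].
  assert (NS := phi_add_neg_neq0 x Hx).
  rewrite theta4_nome, theta3_nome, theta2_nome, ET by auto. split; [|split].
  - assert (Q : phi x - phi (- x) = m * (phi x + phi (- x))) by (rewrite <- Ex; unfold kfun; field; auto).
    destruct (Cmult_integral (phi (- x) - w * phi x) 2) as [Z|Z].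
    + transitivity (- (1 + w) * (phi x - phi (- x)) + (1 - w) * (phi x + phi (- x))); [ring|].
      rewrite Q, <- Em. ring.
    + now apply Ceq_minus.
    + exfalso. revert Z. apply IZR_C_neq0. lia.
  - now apply phi_neq0.
  - assert (N4 : nome4 T <> 0).
    { apply Cmod_gt_0. unfold nome4. rewrite Cmod_cexp. apply exp_pos. }
    assert (N5 := phi_neq_neg _ N4 (nome4_lt_1 T HT)).
    intros Z. apply N5. replace (phi (nome4 T) - phi (- nome4 T)) with
      (2 * ((phi (nome4 T) - phi (- nome4 T)) / 2)) by field. rewrite Z. ring.
Qed.

(** * Uniqueness for polynomial systems *)

(* A state is a sequence of which only the first four entries matter. *)
Definition dist4 (v w : nat -> C) : R :=
  (Cmod (v 0%nat - w 0%nat) + Cmod (v 1%nat - w 1%nat) + Cmod (v 2%nat - w 2%nat) + Cmod (v 3%nat - w 3%nat))%R.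

Definition bounded4 (M : R) (v : nat -> C) : Prop := forall i, (i < 4)%nat -> (Cmod (v i) <= M)%R.

(** One constant bounds both the values and the increments, so that the notion is closed under
    products and hence holds for all polynomials. *)
Definition loc_lipschitz (F : (nat -> C) -> C) : Prop :=
  forall M : R, exists L : R, (0 <= L)%R /\ forall v w, bounded4 M v -> bounded4 M w ->
    (Cmod (F v) <= L)%R /\ (Cmod (F v - F w) <= L * dist4 v w)%R.

Lemma dist4_pos (v w : nat -> C) : (0 <= dist4 v w)%R.
Proof. unfold dist4. repeat apply Rplus_le_le_0_compat; apply Cmod_ge_0. Qed.

Lemma loc_lipschitz_const (c : C) : loc_lipschitz (fun _ => c).
Proof.
  intros M. exists (Cmod c). split; [apply Cmod_ge_0|]. intros v w _ _. split; [lra|].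
  replace (c - c) with (RtoC 0) by ring. rewrite Cmod_0.
  apply Rmult_le_pos; [apply Cmod_ge_0|apply dist4_pos].
Qed.

Lemma loc_lipschitz_proj (i : nat) : (i < 4)%nat -> loc_lipschitz (fun v => v i).
Proof.
  intros Hi M. exists (Rmax 1 M). assert (M1 := Rmax_l 1 M). assert (M2 := Rmax_r 1 M).
  split; [lra|]. intros v w Hv Hw. split; [specialize (Hv i Hi); lra|].
  apply Rle_trans with (1 * dist4 v w)%R; [|apply Rmult_le_compat_r; [apply dist4_pos|auto]].
  unfold dist4.
  assert (A0 := Cmod_ge_0 (v 0%nat - w 0%nat)). assert (A1 := Cmod_ge_0 (v 1%nat - w 1%nat)).
  assert (A2 := Cmod_ge_0 (v 2%nat - w 2%nat)). assert (A3 := Cmod_ge_0 (v 3%nat - w 3%nat)).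
  destruct i as [|[|[|[|i]]]]; try lia; lra.
Qed.

Lemma loc_lipschitz_plus (F G : (nat -> C) -> C) :
  loc_lipschitz F -> loc_lipschitz G -> loc_lipschitz (fun v => F v + G v).
Proof.
  intros HF HG M. destruct (HF M) as [L1 [P1 H1]]. destruct (HG M) as [L2 [P2 H2]].
  exists (L1 + L2)%R. split; [lra|]. intros v w Hv Hw.
  destruct (H1 v w Hv Hw) as [A1 B1]. destruct (H2 v w Hv Hw) as [A2 B2]. split.
  - eapply Rle_trans; [apply Cmod_triangle|]. lra.
  - replace (F v + G v - (F w + G w)) with ((F v - F w) + (G v - G w)) by ring.
    eapply Rle_trans; [apply Cmod_triangle|]. lra.
Qed.

Lemma loc_lipschitz_mult (F G : (nat -> C) -> C) :
  loc_lipschitz F -> loc_lipschitz G -> loc_lipschitz (fun v => F v * G v).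
Proof.
  intros HF HG M. destruct (HF M) as [L1 [P1 H1]]. destruct (HG M) as [L2 [P2 H2]].
  exists (2 * (L1 * L2))%R. assert (P := Rmult_le_pos _ _ P1 P2). split; [lra|]. intros v w Hv Hw.
  destruct (H1 v w Hv Hw) as [A1 B1]. destruct (H2 v w Hv Hw) as [A2 B2].
  destruct (H1 w v Hw Hv) as [A3 _].
  rewrite Cmod_mult. split.
  - apply Rle_trans with (L1 * L2)%R; [|lra]. apply Rmult_le_compat; auto using Cmod_ge_0.
  - replace (F v * G v - F w * G w) with ((F v - F w) * G v + F w * (G v - G w)) by ring.
    eapply Rle_trans; [apply Cmod_triangle|]. rewrite !Cmod_mult.
    assert (X1 : (Cmod (F v - F w) * Cmod (G v) <= L1 * dist4 v w * L2)%R)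
      by (apply Rmult_le_compat; auto using Cmod_ge_0).
    assert (X2 : (Cmod (F w) * Cmod (G v - G w) <= L1 * (L2 * dist4 v w))%R)
      by (apply Rmult_le_compat; auto using Cmod_ge_0).
    lra.
Qed.

Lemma loc_lipschitz_minus (F G : (nat -> C) -> C) :
  loc_lipschitz F -> loc_lipschitz G -> loc_lipschitz (fun v => F v - G v).
Proof.
  intros HF HG M.
  destruct (loc_lipschitz_plus _ _ HF (loc_lipschitz_mult _ _ (loc_lipschitz_const (-1)) HG) M) as [L [P H]].
  exists L. split; auto. intros v w Hv Hw. specialize (H v w Hv Hw).
  replace (F v - G v) with (F v + -1 * G v) by ring.
  replace (F w - G w) with (F w + -1 * G w) by ring. exact H.
Qed.

Lemma loc_lipschitz_pow (F : (nat -> C) -> C) (n : nat) : loc_lipschitz F -> loc_lipschitz (fun v => F v ^ n).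
Proof.
  intros HF. induction n as [|n IH]; [exact (loc_lipschitz_const 1)|].
  exact (loc_lipschitz_mult _ _ HF IH).
Qed.

(** Picard's argument without integrals: the mean value inequality along the segment from t0 bounds
    Y - Z by |t - t0| times a bound on the difference of the right-hand sides. *)
Lemma ode_unique (F : nat -> (nat -> C) -> C) (Y Z : nat -> C -> C) (t0 : C) (r : R) :
  (0 < r)%R -> (forall i, (i < 4)%nat -> loc_lipschitz (F i)) ->
  (forall i t, (i < 4)%nat -> (Cmod (t - t0) < r)%R -> cderiv (Y i) t (F i (fun j => Y j t))) ->
  (forall i t, (i < 4)%nat -> (Cmod (t - t0) < r)%R -> cderiv (Z i) t (F i (fun j => Z j t))) ->
  (forall i, (i < 4)%nat -> Y i t0 = Z i t0) ->
  exists d : R, (0 < d)%R /\ forall i t, (i < 4)%nat -> (Cmod (t - t0) < d)%R -> Y i t = Z i t.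
Proof.
  intros Hr HF HY HZ H0.
  assert (Z0 : (Cmod (t0 - t0) < r)%R) by (replace (t0 - t0) with (RtoC 0) by ring; rewrite Cmod_0; auto).
  assert (Bd : forall (X : nat -> C -> C), (forall i, (i < 4)%nat -> ccont (X i) t0) ->
     exists M d : R, (0 < d)%R /\ forall t, (Cmod (t - t0) < d)%R -> bounded4 M (fun j => X j t)).
  { intros X HX.
    destruct (ccont_bounded _ _ (HX 0%nat ltac:(lia))) as [d0 [P0 B0]].
    destruct (ccont_bounded _ _ (HX 1%nat ltac:(lia))) as [d1 [P1 B1]].
    destruct (ccont_bounded _ _ (HX 2%nat ltac:(lia))) as [d2 [P2 B2]].
    destruct (ccont_bounded _ _ (HX 3%nat ltac:(lia))) as [d3 [P3 B3]].
    exists (Cmod (X 0%nat t0) + Cmod (X 1%nat t0) + Cmod (X 2%nat t0) + Cmod (X 3%nat t0) + 1)%R,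
      (Rmin (Rmin d0 d1) (Rmin d2 d3)).
    split; [repeat apply Rmin_glb_lt; auto|]. intros t Ht.
    assert (Ta := Rlt_le_trans _ _ _ Ht (Rmin_l _ _)). assert (Tb := Rlt_le_trans _ _ _ Ht (Rmin_r _ _)).
    specialize (B0 t (Rlt_le_trans _ _ _ Ta (Rmin_l _ _))). specialize (B1 t (Rlt_le_trans _ _ _ Ta (Rmin_r _ _))).
    specialize (B2 t (Rlt_le_trans _ _ _ Tb (Rmin_l _ _))). specialize (B3 t (Rlt_le_trans _ _ _ Tb (Rmin_r _ _))).
    assert (Q0 := Cmod_ge_0 (X 0%nat t0)). assert (Q1 := Cmod_ge_0 (X 1%nat t0)).
    assert (Q2 := Cmod_ge_0 (X 2%nat t0)). assert (Q3 := Cmod_ge_0 (X 3%nat t0)).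
    intros i Hi. destruct i as [|[|[|[|i]]]]; try lia; lra. }
  destruct (Bd Y) as [M1 [d1 [P1 B1]]]. { intros i Hi. eapply cderiv_ccont, HY; auto. }
  destruct (Bd Z) as [M2 [d2 [P2 B2]]]. { intros i Hi. eapply cderiv_ccont, HZ; auto. }
  set (M := Rmax M1 M2).
  assert (HL : exists L : R, (0 <= L)%R /\ forall i v w, (i < 4)%nat -> bounded4 M v -> bounded4 M w ->
     (Cmod (F i v - F i w) <= L * dist4 v w)%R).
  { destruct (HF 0%nat ltac:(lia) M) as [L0 [Q0 H1]]. destruct (HF 1%nat ltac:(lia) M) as [L1 [Q1 H2]].
    destruct (HF 2%nat ltac:(lia) M) as [L2 [Q2 H3]]. destruct (HF 3%nat ltac:(lia) M) as [L3 [Q3 H4]].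
    exists (L0 + L1 + L2 + L3)%R. split; [lra|]. intros i v w Hi Hv Hw.
    assert (D := dist4_pos v w).
    destruct i as [|[|[|[|i]]]]; try lia;
      [destruct (H1 v w Hv Hw) as [_ X]|destruct (H2 v w Hv Hw) as [_ X]
      |destruct (H3 v w Hv Hw) as [_ X]|destruct (H4 v w Hv Hw) as [_ X]];
      (eapply Rle_trans; [exact X|]); apply Rmult_le_compat_r; lra. }
  destruct HL as [L [L0 HL]].
  (* Four components each contribute L K |t - t0|, and 4 L |t - t0| <= 1/2 halves the bound K. *)
  set (d := Rmin (Rmin r (/ (8 * (L + 1)))) (Rmin d1 d2)).
  assert (Pd : (0 < d)%R).
  { unfold d. repeat apply Rmin_glb_lt; auto. apply Rinv_0_lt_compat. lra. }
  exists d. split; auto.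
  assert (Hd : forall t, (Cmod (t - t0) < d)%R ->
     (Cmod (t - t0) < r)%R /\ (8 * L * Cmod (t - t0) <= 1)%R /\
     bounded4 M (fun j => Y j t) /\ bounded4 M (fun j => Z j t)).
  { intros t Ht. assert (Ta := Rlt_le_trans _ _ _ Ht (Rmin_l _ _)). assert (Tb := Rlt_le_trans _ _ _ Ht (Rmin_r _ _)).
    assert (T1 := Rlt_le_trans _ _ _ Ta (Rmin_l _ _)). assert (T2 := Rlt_le_trans _ _ _ Ta (Rmin_r _ _)).
    split; [exact T1|]. split.
    - apply (Rmult_lt_compat_r (8 * (L + 1))) in T2; [|lra]. rewrite Rinv_l in T2 by lra.
      assert (P := Cmod_ge_0 (t - t0)). nra.
    - split; intros i Hi.
      + eapply Rle_trans; [apply (B1 t (Rlt_le_trans _ _ _ Tb (Rmin_l _ _)) i Hi)|apply Rmax_l].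
      + eapply Rle_trans; [apply (B2 t (Rlt_le_trans _ _ _ Tb (Rmin_r _ _)) i Hi)|apply Rmax_r]. }
  (* Picard bootstrap: a bound on the distance over the disc improves by a factor 1/2. *)
  assert (Boot : forall n t, (Cmod (t - t0) < d)%R ->
     (dist4 (fun j => Y j t) (fun j => Z j t) <= 8 * M * (/ 2) ^ n)%R).
  { induction n as [|n IH]; intros t Ht.
    (* The initial bound 8 M: four components, each differing by at most 2 M. *)
    - destruct (Hd t Ht) as [_ [_ [BY BZ]]]. simpl pow. unfold dist4.
      assert (X : forall i, (i < 4)%nat -> (Cmod (Y i t - Z i t) <= 2 * M)%R).
      { intros i Hi. eapply Rle_trans; [apply Cmod_triangle_minus|].
        specialize (BY i Hi). specialize (BZ i Hi). cbv beta in *. lra. }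
      assert (X0 := X 0%nat ltac:(lia)). assert (X1 := X 1%nat ltac:(lia)).
      assert (X2 := X 2%nat ltac:(lia)). assert (X3 := X 3%nat ltac:(lia)). lra.
    - set (K := (8 * M * (/ 2) ^ n)%R) in *.
      assert (K0 : (0 <= K)%R) by (eapply Rle_trans; [apply dist4_pos|apply (IH t Ht)]).
      assert (X : forall i, (i < 4)%nat -> (Cmod (Y i t - Z i t) <= L * K * Cmod (t - t0))%R).
      { intros i Hi.
        assert (Seg : forall u : R, (0 <= u <= 1)%R -> (Cmod (t0 + u * (t - t0) - t0) < d)%R).
        { intros u Hu. replace (t0 + u * (t - t0) - t0) with (u * (t - t0)) by ring.
          rewrite Cmod_mult, Cmod_R, Rabs_right by lra. assert (P := Cmod_ge_0 (t - t0)). nra. }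
        assert (MV := cderiv_mean_value (fun x => Y i x - Z i x)
           (fun x => F i (fun j => Y j x) - F i (fun j => Z j x)) t0 t 0 (L * K)).
        cbv beta in MV. rewrite (H0 i Hi) in MV.
        replace (Y i t - Z i t - (Z i t0 - Z i t0) - (t - t0) * 0) with (Y i t - Z i t) in MV by ring.
        apply MV.
        - intros u Hu. destruct (Hd _ (Seg u Hu)) as [Hur _]. apply cderiv_minus; auto.
        - intros u Hu. destruct (Hd _ (Seg u Hu)) as [_ [_ [BY BZ]]].
          set (x := t0 + u * (t - t0)) in *.
          replace (F i (fun j => Y j x) - F i (fun j => Z j x) - 0) with
            (F i (fun j => Y j x) - F i (fun j => Z j x)) by ring.
          eapply Rle_trans; [apply HL; auto|]. apply Rmult_le_compat_l; auto. apply IH, Seg; auto. }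
      destruct (Hd t Ht) as [_ [Hs _]].
      assert (X0 := X 0%nat ltac:(lia)). assert (X1 := X 1%nat ltac:(lia)).
      assert (X2 := X 2%nat ltac:(lia)). assert (X3 := X 3%nat ltac:(lia)). unfold dist4.
      replace (8 * M * (/ 2) ^ S n)%R with (K / 2)%R by (unfold K; simpl; field).
      nra. }
  intros i t Hi Ht.
  assert (D0 : (dist4 (fun j => Y j t) (fun j => Z j t) <= 0)%R).
  { assert (X := is_lim_seq_le (fun _ => dist4 (fun j => Y j t) (fun j => Z j t)) (fun n => 8 * M * (/ 2) ^ n)%R
       (dist4 (fun j => Y j t) (fun j => Z j t)) 0).
    apply X; [intros n; now apply Boot|apply is_lim_seq_const|apply geom_lim0; lra]. }
  apply Ceq_minus, Cmod_eq_0. unfold dist4 in D0.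
  assert (A0 := Cmod_ge_0 (Y 0%nat t - Z 0%nat t)). assert (A1 := Cmod_ge_0 (Y 1%nat t - Z 1%nat t)).
  assert (A2 := Cmod_ge_0 (Y 2%nat t - Z 2%nat t)). assert (A3 := Cmod_ge_0 (Y 3%nat t - Z 3%nat t)).
  destruct i as [|[|[|[|i]]]]; try lia; lra.
Qed.

Lemma halphen_unique (A B : C) (f2 f3 f4 fe g2 g3 g4 ge : C -> C) (t0 : C) (r : R) : (0 < r)%R ->
  halphen_system A B (fun t => Cmod (t - t0) < r)%R f2 f3 f4 fe ->
  halphen_system A B (fun t => Cmod (t - t0) < r)%R g2 g3 g4 ge ->
  f2 t0 = g2 t0 -> f3 t0 = g3 t0 -> f4 t0 = g4 t0 -> fe t0 = ge t0 ->
  exists d : R, (0 < d)%R /\ forall t, (Cmod (t - t0) < d)%R ->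
    f2 t = g2 t /\ f3 t = g3 t /\ f4 t = g4 t /\ fe t = ge t.
Proof.
  intros Hr Hf Hg E2 E3 E4 Ee.
  set (F := fun i (v : nat -> C) => match i with
    | 0%nat => Ci / PI * (v 3%nat + PI ^ 2 / 12 * (v 1%nat ^ 4 + v 2%nat ^ 4)) * v 0%nat
    | 1%nat => Ci / PI * (v 3%nat + PI ^ 2 / 12 * (v 1%nat ^ 4 + v 2%nat ^ 4 - 3 * B ^ 4 * v 2%nat ^ 4)) * v 1%nat
    | 2%nat => Ci / PI * (v 3%nat + PI ^ 2 / 12 * (v 1%nat ^ 4 + v 2%nat ^ 4 - 3 * A ^ 4 * v 1%nat ^ 4)) * v 2%nat
    | _ => Ci / PI * 2 * v 3%nat ^ 2 - PI ^ 3 / 72 * Ci *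
                  (v 1%nat ^ 8 + (9 * A ^ 4 * B ^ 4 - 6 * A ^ 4 - 6 * B ^ 4 + 2)
                               * v 1%nat ^ 4 * v 2%nat ^ 4 + v 2%nat ^ 8)
    end).
  set (Y := fun i => match i with 0%nat => f2 | 1%nat => f3 | 2%nat => f4 | _ => fe end).
  set (Z := fun i => match i with 0%nat => g2 | 1%nat => g3 | 2%nat => g4 | _ => ge end).
  destruct (ode_unique F Y Z t0 r Hr) as [d [Hd H]].
  - intros i Hi. destruct i as [|[|[|[|i]]]]; try lia; unfold F;
    repeat first [ apply loc_lipschitz_const | apply loc_lipschitz_proj; lia
      | apply loc_lipschitz_pow | apply loc_lipschitz_minus
      | apply loc_lipschitz_plus | apply loc_lipschitz_mult ].
  - intros i t Hi Ht. destruct (Hf t Ht) as [D2 [D3 [D4 D5]]].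
    destruct i as [|[|[|[|i]]]]; try lia; assumption.
  - intros i t Hi Ht. destruct (Hg t Ht) as [D2 [D3 [D4 D5]]].
    destruct i as [|[|[|[|i]]]]; try lia; assumption.
  - intros i Hi. destruct i as [|[|[|[|i]]]]; try lia; assumption.
  - exists d. split; auto. intros t Ht.
    split; [|split; [|split]];
      [apply (H 0%nat t)|apply (H 1%nat t)|apply (H 2%nat t)|apply (H 3%nat t)]; auto; lia.
Qed.

(** * Continuous branches of the square root *)

Definition csqrt (z : C) : C :=
  let a := sqrt ((Cmod z + Re z) / 2) in (a, Im z / (2 * a))%R.

Lemma csqrt_Re_pos (z : C) : (0 < Re z)%R -> (0 < Re (csqrt z))%R.
Proof. intros H. simpl. apply sqrt_lt_R0. assert (P := Cmod_ge_0 z). lra. Qed.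

Lemma csqrt_sq (z : C) : (0 < Re z)%R -> csqrt z * csqrt z = z.
Proof.
  intros H. assert (Ha := csqrt_Re_pos z H). simpl in Ha. assert (P := Cmod_ge_0 z).
  unfold csqrt. set (a := sqrt ((Cmod z + Re z) / 2)) in *.
  assert (Ea : (a * a = (Cmod z + Re z) / 2)%R) by (apply sqrt_sqrt; lra).
  assert (EM := Cmod2_alt z).
  apply C_eq_Re_Im.
  - change (a * a - Im z / (2 * a) * (Im z / (2 * a)) = Re z)%R.
    transitivity (a * a - (Im z * Im z) / (4 * (a * a)))%R; [field; lra|].
    rewrite Ea. replace (Im z * Im z)%R with (Cmod z ^ 2 - Re z ^ 2)%R by (rewrite EM; ring).
    field. lra.
  - change (a * (Im z / (2 * a)) + Im z / (2 * a) * a = Im z)%R. field. lra.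
Qed.

(** Continuity is what [csqrt_exists] could not give. It follows from |csqrt y - csqrt z| |csqrt y +
    csqrt z| = |y - z|, since the real part of the sum is at least that of csqrt z. *)
Lemma csqrt_cont (z : C) : (0 < Re z)%R -> ccont csqrt z.
Proof.
  intros H eps He. assert (Pz := csqrt_Re_pos z H). set (a := Re (csqrt z)) in *.
  exists (Rmin (Re z) (eps * a)). split; [apply Rmin_glb_lt; auto; now apply Rmult_lt_0_compat|].
  intros y Hy.
  assert (Y1 := Rlt_le_trans _ _ _ Hy (Rmin_l _ _)). assert (Y2 := Rlt_le_trans _ _ _ Hy (Rmin_r _ _)).
  assert (Hy0 : (0 < Re y)%R).
  { assert (T := re_le_Cmod (y - z)). rewrite Re_minus in T. apply Rabs_le_between in T. lra. }
  assert (Py := csqrt_Re_pos y Hy0).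
  assert (E : (Cmod (csqrt y - csqrt z) * Cmod (csqrt y + csqrt z) = Cmod (y - z))%R).
  { rewrite <- Cmod_mult. f_equal. rewrite <- (csqrt_sq y Hy0) at 3. rewrite <- (csqrt_sq z H) at 3. ring. }
  assert (Q : (a <= Cmod (csqrt y + csqrt z))%R).
  { eapply Rle_trans; [|apply Re_le_Cmod]. change (Re (csqrt y + csqrt z)) with (Re (csqrt y) + Re (csqrt z))%R.
    unfold a. lra. }
  assert (N := Cmod_ge_0 (csqrt y - csqrt z)).
  apply Rmult_lt_reg_r with a; auto. nra.
Qed.

Lemma csqrt_1 : csqrt 1 = 1.
Proof.
  unfold csqrt. rewrite Cmod_1. simpl. replace ((1 + 1) / 2)%R with 1%R by field. rewrite sqrt_1.
  unfold RtoC. f_equal. field.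
Qed.

Lemma ccont_comp (f g : C -> C) (z : C) : ccont f z -> ccont g (f z) -> ccont (fun x => g (f x)) z.
Proof.
  intros Hf Hg eps He. destruct (Hg eps He) as [e [Pe B]]. destruct (Hf e Pe) as [d [Pd D]].
  exists d. split; auto.
Qed.

Lemma cderiv_affine (c dl t : C) : cderiv (fun x => c * x + dl) t c.
Proof.
  eapply cderiv_eq;
    [|apply (cderiv_plus _ _ _ _ _ (cderiv_mult _ _ _ _ _ (cderiv_const c t) (cderiv_id t)) (cderiv_const dl t))].
  cbv beta. ring.
Qed.

(** Dividing by the value at t0 moves it to 1, inside the right half-plane where [csqrt] is
    continuous; the prescribed root s0 is then restored as a factor. *)
Lemma sqrt_branch_exists (c dl t0 s0 : C) : s0 <> 0 -> s0 * s0 = c * t0 + dl ->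
  exists (s : C -> C) (r : R), (0 < r)%R /\ s t0 = s0 /\
    forall t, (Cmod (t - t0) < r)%R -> c * t + dl <> 0 /\ s t * s t = c * t + dl /\ ccont s t.
Proof.
  intros N0 E0. set (l0 := s0 * s0) in *.
  assert (Nl : l0 <> 0) by now apply Cmult_neq_0.
  set (g := fun t => (c * t + dl) * / l0).
  assert (Dg : forall t, cderiv g t (c * (/ l0) + (c * t + dl) * 0)).
  { intros t. apply (cderiv_mult (fun x => c * x + dl) (fun _ => / l0) t c 0);
      [apply cderiv_affine|apply cderiv_const]. }
  assert (g0 : g t0 = 1) by (unfold g; rewrite <- E0; field; auto).
  destruct (cderiv_ccont _ _ _ (Dg t0) 1%R Rlt_0_1) as [r [Hr Hb]].
  exists (fun t => s0 * csqrt (g t)), r. split; [exact Hr|]. split.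
  { rewrite g0, csqrt_1. ring. }
  intros t Ht. specialize (Hb t Ht). rewrite g0 in Hb.
  assert (Rg : (0 < Re (g t))%R).
  { assert (T := re_le_Cmod (g t - 1)). rewrite Re_minus in T. apply Rabs_le_between in T.
    change (Re 1) with 1%R in T. lra. }
  split; [|split].
  - intros Z. assert (E : g t = 0) by (unfold g; rewrite Z; ring). rewrite E in Rg. simpl in Rg. lra.
  - replace (s0 * csqrt (g t) * (s0 * csqrt (g t))) with (l0 * (csqrt (g t) * csqrt (g t))) by (unfold l0; ring).
    rewrite csqrt_sq by auto. unfold g. field. auto.
  - apply (ccont_comp (fun t => csqrt (g t)) (fun z => s0 * z)).
    + apply ccont_comp; [eapply cderiv_ccont, Dg|now apply csqrt_cont].
    + eapply cderiv_ccont. apply (cderiv_mult (fun _ => s0) (fun z => z)); [apply cderiv_const|apply cderiv_id].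
Qed.

(** * Matching the initial data of a generic solution *)

Theorem theorem9p9 (A B : C) (hA : A <> 0) (hB : B <> 0) :
  (* (1) every member of the family solves the system *)
  (forall (a b c dl d : C) (s : C -> C) (U : C -> Prop),
     a * dl - b * c = 1 -> open U -> admissible a b c dl s U ->
     halphen_system A B U (sol2 a b c dl d s) (sol3 A a b c dl s)
       (sol4 B a b c dl s) (soleta A B a b c dl)) /\
  (* (2) generality: every solution, near any point with generic values,
         coincides with a member of the family *)
  (forall (U : C -> Prop) (th2 th3 th4 et : C -> C) (t0 : C),
     open U -> U t0 -> halphen_system A B U th2 th3 th4 et ->
     th3 t0 <> 0 -> th4 t0 <> 0 -> A ^ 4 * th3 t0 ^ 4 <> B ^ 4 * th4 t0 ^ 4 ->
     exists (a b c dl d : C) (s : C -> C) (V : C -> Prop),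
       a * dl - b * c = 1 /\ open V /\ V t0 /\
       (forall t, V t -> U t) /\ admissible a b c dl s V /\
       forall t, V t ->
         th2 t = sol2 a b c dl d s t /\ th3 t = sol3 A a b c dl s t /\
         th4 t = sol4 B a b c dl s t /\ et t = soleta A B a b c dl t).
Proof.
  split.
  { intros a b c dl d s U. now apply sol_system. }
  intros U th2 th3 th4 et t0 HU Ut0 Hsys N3 N4 Ngen.
  (* The quotient theta4 / theta3 that the family must have at T, since the root s cancels between
     [sol4] and [sol3]. *)
  set (w := B * th4 t0 / (A * th3 t0)).
  assert (NA3 : A * th3 t0 <> 0) by now apply Cmult_neq_0.
  assert (Ew : w * (A * th3 t0) = B * th4 t0) by (unfold w; field; auto).
  assert (Nw : w <> 0).
  { intros E. apply (Cmult_neq_0 _ _ hB N4). rewrite <- Ew, E. ring. }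
  assert (Nw4 : w ^ 4 <> 1).
  { intros E. apply Ngen. transitivity (w ^ 4 * (A ^ 4 * th3 t0 ^ 4)); [rewrite E; ring|].
    transitivity ((w * (A * th3 t0)) ^ 4); [ring|]. rewrite Ew. ring. }
  destruct (theta_ratio_surj w Nw Nw4) as [T [HT [E4 [NT3 NT2]]]].
  (* The value of the root at t0 forced by the equation for th3; it thereby fixes l0 = c t0 + dl. *)
  set (s0 := theta3 T / (A * th3 t0)).
  assert (Es0 : s0 * (A * th3 t0) = theta3 T) by (unfold s0; field; auto).
  assert (Ns0 : s0 <> 0) by (intros E; apply NT3; rewrite <- Es0, E; ring).
  assert (NP := PI_C_neq0). assert (NI := Ci_nz).
  set (l0 := s0 * s0).
  assert (Nl0 : l0 <> 0) by now apply Cmult_neq_0.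
  set (E := eta T + PI ^ 2 / 12 * ((1 - / A ^ 4) * theta3 T ^ 4 + (1 - / B ^ 4) * theta4 T ^ 4)).
  (* With l0 known, the condition on eta is linear in c. Then dl comes from l0, a from the
     determinant (which reduces to a l0 - T l0 c = 1), b from mob t0 = T, and d from th2. *)
  set (c := (et t0 - / l0 ^ 2 * E) * 2 * l0 / (PI * Ci)).
  set (dl := l0 - c * t0).
  set (a := (1 + T * l0 * c) / l0).
  set (b := T * l0 - a * t0).
  set (d := th2 t0 * s0 / theta2 T).
  assert (Edet : a * dl - b * c = 1) by (unfold b, dl, a; field; auto).
  assert (El : c * t0 + dl = l0) by (unfold dl; ring).
  assert (Em : mob a b c dl t0 = T).
  { unfold mob. rewrite El. unfold b. field. auto. }
  destruct (sqrt_branch_exists c dl t0 s0 Ns0 (eq_sym El)) as [s [r1 [Hr1 [Est0 Hs]]]].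
  destruct (proj1 (open_C_iff U) HU t0 Ut0) as [r2 [Hr2 HrU]].
  assert (Nl : c * t0 + dl <> 0) by (now rewrite El).
  (* With tolerance Im T, the transformed point stays in the upper half-plane. *)
  destruct (cderiv_ccont _ _ _ (cderiv_mob a b c dl t0 Edet Nl) (Im T) HT) as [r3 [Hr3 Hm]].
  rewrite Em in Hm.
  set (r := Rmin r1 (Rmin r2 r3)).
  assert (Hr : (0 < r)%R) by (unfold r; repeat apply Rmin_glb_lt; auto).
  assert (HV : forall t, (Cmod (t - t0) < r)%R ->
     (Cmod (t - t0) < r1)%R /\ (Cmod (t - t0) < r2)%R /\ (Cmod (t - t0) < r3)%R).
  { intros t Ht. assert (T1 := Rlt_le_trans _ _ _ Ht (Rmin_r _ _)). repeat split.
    - apply (Rlt_le_trans _ _ _ Ht (Rmin_l _ _)).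
    - apply (Rlt_le_trans _ _ _ T1 (Rmin_l _ _)).
    - apply (Rlt_le_trans _ _ _ T1 (Rmin_r _ _)). }
  assert (Hopen : forall q : R, open (fun t => Cmod (t - t0) < q)%R).
  { intros q. apply open_C_iff. intros z Hz. exists (q - Cmod (z - t0))%R. split; [lra|]. intros y Hy.
    replace (y - t0) with ((y - z) + (z - t0)) by ring. eapply Rle_lt_trans; [apply Cmod_triangle|]. lra. }
  assert (Hadm : admissible a b c dl s (fun t => Cmod (t - t0) < r)%R).
  { intros t Ht. destruct (HV t Ht) as [T1 [T2 T3]]. destruct (Hs t T1) as [S1 [S2 S3]].
    split; [exact S1|]. split; [|split; [exact S2|now apply continuous_C_iff]].
    apply Im_near with T. apply (Hm t T3). }
  destruct (halphen_unique A B th2 th3 th4 et (sol2 a b c dl d s) (sol3 A a b c dl s) (sol4 B a b c dl s)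
     (soleta A B a b c dl) t0 r Hr) as [q [Hq Heq]].
  - intros t Ht. apply Hsys, HrU. apply (HV t Ht).
  - now apply sol_system.
  - unfold sol2, d. rewrite Em, Est0. field. auto.
  - unfold sol3. rewrite Em, Est0, <- Es0. field. auto.
  - unfold sol4. rewrite Em, Est0, E4, <- Es0.
    transitivity (B * th4 t0 / B); [field; auto|]. rewrite <- Ew. field. auto.
  - unfold soleta. cbv zeta. rewrite Em, El. fold E. unfold c. field. auto.
  - exists a, b, c, dl, d, s, (fun t => Cmod (t - t0) < Rmin r q)%R.
    assert (Hsub : forall t, (Cmod (t - t0) < Rmin r q)%R -> (Cmod (t - t0) < r)%R /\ (Cmod (t - t0) < q)%R).
    { intros t Ht. split; [apply (Rlt_le_trans _ _ _ Ht (Rmin_l _ _))|apply (Rlt_le_trans _ _ _ Ht (Rmin_r _ _))]. }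
    split; [exact Edet|]. split; [apply Hopen|]. split; [|split; [|split]].
    + replace (t0 - t0) with (RtoC 0) by ring. rewrite Cmod_0. now apply Rmin_glb_lt.
    + intros t Ht. apply HrU. destruct (Hsub t Ht) as [T1 _]. apply (HV t T1).
    + intros t Ht. apply Hadm. apply (Hsub t Ht).
    + intros t Ht. apply Heq. apply (Hsub t Ht).
Qed.
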